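(* Let $\alpha>0$ and $\beta\in\mathbb{R}$, and let $\phi\ge 0$ be a smooth function, not identically zero, with compact support contained in $[1,2]$. Then, as $T\to\infty$, $$\sum_{\ell\in\mathbb{Z}}\big|\zeta(\tfrac12+i(\alpha\ell+\beta))\big|^2\phi\Big(\frac{\ell}{T}\Big)=\Big(1+\delta(\alpha,\beta)+o(1)\Big)\int_{\mathbb{R}}\big|\zeta(\tfrac12+i(\alpha t+\beta))\big|^2\phi\Big(\frac{t}{T}\Big)\,dt,$$ where the $o(1)$ term tends to $0$ as $T\to\infty$ (at a rate possibly depending on $\alpha,\beta,\phi$).
   Context: Define $\delta(\alpha,\beta)$ as follows. If $e^{2\pi\ell/\alpha}$ is irrational for every integer $\ell>0$, set $\delta(\alpha,\beta)=0$. Otherwise, let $\ell_0$ be the least positive integer for which $e^{2\pi\ell_0/\alpha}$ is rational, write $e^{2\pi\ell_0/\alpha}=m/n$ with $m,n$ coprime positive integers (so $m/n>1$), and set $$\delta(\alpha,\beta)=\frac{2\cos(\beta\log(m/n))\sqrt{mn}-2}{mn+1-2\sqrt{mn}\cos(\beta\log(m/n))}.$$ *)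

(* Defs.v *)
From Stdlib Require Import Reals Lra ZArith Znumtheory ClassicalEpsilon.
Open Scope R_scope.

(* The limit of a real sequence (an arbitrary value if it does not converge). *)
Definition seq_lim (u : nat -> R) : R :=
  epsilon (inhabits 0) (fun l => Un_cv u l).

(* Riemann integral of f on [a,b] (an arbitrary value if not integrable). *)
Definition RInt (f : R -> R) (a b : R) : R :=
  epsilon (inhabits 0)
    (fun I => exists pr : Riemann_integrable f a b, RiemannInt pr = I).

Definition RInt_R (f : R -> R) : R :=
  seq_lim (fun n => RInt f (- INR n) (INR n)).

Definition sum_Z (f : Z -> R) : R :=
  seq_lim (fun N => sum_f_R0 (fun k => f (Z.of_nat k - Z.of_nat N)%Z) (2 * N)).

(* For s = 1/2 + i u we use zeta(s) = eta(s) / (1 - 2^{1-s}), where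
   eta(s) = sum_{n>=1} (-1)^{n-1} n^{-s} (convergent for Re s > 0), and
   n^{-s} = n^{-1/2} (cos(u ln n) - i sin(u ln n)). *)

Definition eta_re_partial (u : R) (N : nat) : R :=
  sum_f_R0 (fun k => (-1) ^ k * cos (u * ln (INR (S k))) / sqrt (INR (S k))) N.

Definition eta_im_partial (u : R) (N : nat) : R :=
  sum_f_R0 (fun k => - ((-1) ^ k * sin (u * ln (INR (S k))) / sqrt (INR (S k)))) N.

Definition eta_re (u : R) : R := seq_lim (eta_re_partial u).
Definition eta_im (u : R) : R := seq_lim (eta_im_partial u).

(* 1 - 2^{1-s} = 1 - sqrt 2 (cos(u ln 2) - i sin(u ln 2)) *)
Definition eta_fac_re (u : R) : R := 1 - sqrt 2 * cos (u * ln 2).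
Definition eta_fac_im (u : R) : R := sqrt 2 * sin (u * ln 2).

Definition zeta_crit_abs2 (u : R) : R :=
  (eta_re u ^ 2 + eta_im u ^ 2) / (eta_fac_re u ^ 2 + eta_fac_im u ^ 2).

Definition smooth (f : R -> R) : Prop :=
  exists D : nat -> R -> R,
    D 0%nat = f /\ forall (k : nat) (x : R), derivable_pt_lim (D k) x (D (S k) x).

(* compact support contained in [a,b] ([a,b] is closed, so this is the same
   as: the closure of {x | f x <> 0} is contained in [a,b]) *)
Definition support_in (f : R -> R) (a b : R) : Prop :=
  forall x, f x <> 0 -> a <= x <= b.

Definition is_rational (x : R) : Prop :=
  exists p q : Z, (q <> 0)%Z /\ x = IZR p / IZR q.

Definition delta_formula (m n : Z) (beta : R) : R :=
  let mn := IZR m * IZR n in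
  let c := cos (beta * ln (IZR m / IZR n)) in
  (2 * c * sqrt mn - 2) / (mn + 1 - 2 * sqrt mn * c).

Definition delta_spec (alpha beta d : R) : Prop :=
  ((forall l : Z, (l > 0)%Z -> ~ is_rational (exp (2 * PI * IZR l / alpha))) /\ d = 0)
  \/
  (exists (l0 m n : Z),
      (l0 > 0)%Z /\
      is_rational (exp (2 * PI * IZR l0 / alpha)) /\
      (forall l : Z, (0 < l < l0)%Z -> ~ is_rational (exp (2 * PI * IZR l / alpha))) /\
      (m > 0)%Z /\ (n > 0)%Z /\ Z.gcd m n = 1%Z /\
      exp (2 * PI * IZR l0 / alpha) = IZR m / IZR n /\
      d = delta_formula m n beta).

Definition delta (alpha beta : R) : R :=
  epsilon (inhabits 0) (fun d => delta_spec alpha beta d).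

(* Main.v *)
Require Import Defs.
From Stdlib Require Import Reals ZArith Znumtheory Zpow_facts Lra Lia.
From Stdlib Require Import FunctionalExtensionality ClassicalEpsilon Classical.
From Coquelicot Require Import Coquelicot.
Open Scope R_scope.

(** With [s = 1/2 + iu] and [N] a large constant times [T], one has
    [zeta(s) = sum_{n <= N} n^{-s} + O(T^{-1/2})] for [u] of size [T]: writing
    [f(n) = c_n (f(n) - f(n+1))] with [c_n = 1 / (1 - f(n+1)/f(n))] and summing by
    parts bounds both the tail of the alternating series for eta and the block
    [N < n <= 2N] of the zeta series.  Hence [|zeta(s)|^2] may be replaced by
    [sum_{m,n <= N} (mn)^{-1/2} (m/n)^{-iu}] at the cost of [O(1)] per point.

    Summing over [u = alpha l + beta] against [phi(l/T)], a pair [(m,n)] contributes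
    an exponential sum of frequency [alpha log(m/n)], which is
    [O(T min(1, (T |1 - e^{i alpha log(m/n)}|)^{-2}))] by two summations by parts.
    Pairs with [m/n] exactly equal to some [e^{2 pi k/alpha}] give the main term; if
    [p/q] is the least such rational above 1, they are [m/n = (p/q)^{+-j}] and
    contribute [log N * sum_j (pq)^{-|j|/2} cos(j beta log(p/q))], a geometric series
    equal to [(1 + delta) log N].  For the other pairs, fix [k] and put
    [x = e^{2 pi k/alpha}]: those with [|m - xn| >= eta] contribute [O(T)] altogether,
    and the [n] for which some [m] has [0 < |m - xn| < eta] are so sparse when [eta]
    is small that they contribute [o(T log T)].  The contributions of the various [k]
    are dominated by a geometric series.  The integral is treated in the same way,
    with the single main term [m = n]. *)

(** Both moments are compared with [T log T], so an error of [O(1)] per point is harmless, and the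
    theorem is the quotient of two limits, the lower one being the positive integral of [phi]. The
    detour through eta costs nothing on the critical line, where [|1 - 2^{1-s}| >= sqrt 2 - 1]. The
    obstacle is that nothing quantitative is known about rational approximations to
    [x = e^{2 pi k/alpha}]. What replaces it is soft: if [m - xn] and [m' - xn'] are both tiny, then
    [(n' - n) x] is almost an integer, which for irrational [x] forces [n' - n] to be large; for
    rational [x], [|m - xn|] is zero or bounded below. The near pairs with given [k] are therefore
    negligible, but at no explicit rate. As the number of relevant [k] grows like [log T], the
    passage from each [k] to their sum needs dominated convergence. The domination comes from the
    weight: [m] is comparable with [xn], so [(mn)^{-1/2}] is comparable with [x^{-1/2}/n], and
    [x^{-1/2}] is geometric in [k]. *)

(** * Finite real sums *)

Fixpoint rsum (f : nat -> R) (n : nat) : R :=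
  match n with O => 0 | S n => rsum f n + f n end.

Lemma rsum_ext (f g : nat -> R) n :
  (forall k, (k < n)%nat -> f k = g k) -> rsum f n = rsum g n.
Proof.
  induction n as [|n IH]; intros H; simpl; [easy|].
  rewrite IH, H; auto.
Qed.

Lemma rsum_le (f g : nat -> R) n :
  (forall k, (k < n)%nat -> f k <= g k) -> rsum f n <= rsum g n.
Proof.
  induction n as [|n IH]; intros H; simpl; [lra|].
  apply Rplus_le_compat; auto.
Qed.

Lemma rsum_const c n : rsum (fun _ => c) n = INR n * c.
Proof.
  induction n as [|n IH]; [simpl; ring|].
  rewrite S_INR; simpl rsum; rewrite IH; ring.
Qed.

Lemma rsum_zero (f : nat -> R) n :
  (forall k, (k < n)%nat -> f k = 0) -> rsum f n = 0.
Proof. intros H; rewrite (rsum_ext _ (fun _ => 0)), rsum_const; auto; ring. Qed.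

Lemma rsum_ge0 (f : nat -> R) n :
  (forall k, (k < n)%nat -> 0 <= f k) -> 0 <= rsum f n.
Proof.
  intros H; rewrite <- (rsum_zero (fun _ => 0) n) by easy; now apply rsum_le.
Qed.

Lemma rsum_plus (f g : nat -> R) n :
  rsum (fun k => f k + g k) n = rsum f n + rsum g n.
Proof. induction n as [|n IH]; simpl; [ring|]; rewrite IH; ring. Qed.

Lemma rsum_minus (f g : nat -> R) n :
  rsum (fun k => f k - g k) n = rsum f n - rsum g n.
Proof. induction n as [|n IH]; simpl; [ring|]; rewrite IH; ring. Qed.

Lemma rsum_scal c (f : nat -> R) n : rsum (fun k => c * f k) n = c * rsum f n.
Proof. induction n as [|n IH]; simpl; [ring|]; rewrite IH; ring. Qed.

Lemma rsum_abs (f : nat -> R) n : Rabs (rsum f n) <= rsum (fun k => Rabs (f k)) n.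
Proof.
  induction n as [|n IH]; simpl; [rewrite Rabs_R0; lra|].
  eapply Rle_trans; [apply Rabs_triang|lra].
Qed.

Lemma rsum_swap (f : nat -> nat -> R) n m :
  rsum (fun i => rsum (fun j => f i j) m) n = rsum (fun j => rsum (fun i => f i j) n) m.
Proof.
  induction n as [|n IH]; simpl.
  - symmetry; now apply rsum_zero.
  - rewrite IH, <- rsum_plus; reflexivity.
Qed.

Lemma rsum_split (f : nat -> R) n m :
  rsum f (n + m) = rsum f n + rsum (fun k => f (n + k)%nat) m.
Proof.
  induction m as [|m IH]; simpl.
  - rewrite Nat.add_0_r; ring.
  - rewrite Nat.add_succ_r; simpl; rewrite IH; ring.
Qed.

Lemma rsum_le_more (f : nat -> R) n m :
  (n <= m)%nat -> (forall k, (n <= k < m)%nat -> 0 <= f k) -> rsum f n <= rsum f m.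
Proof.
  intros Hnm H; replace m with (n + (m - n))%nat by lia; rewrite rsum_split.
  assert (0 <= rsum (fun k => f (n + k)%nat) (m - n)); [|lra].
  apply rsum_ge0; intros; apply H; lia.
Qed.

Lemma rsum_single (f : nat -> R) n i :
  (i < n)%nat -> (forall k, (k < n)%nat -> k <> i -> f k = 0) -> rsum f n = f i.
Proof.
  intros Hi H; replace n with (i + S (n - i - 1))%nat by lia.
  rewrite rsum_split, rsum_zero by (intros; apply H; lia).
  replace (S (n - i - 1)) with (1 + (n - i - 1))%nat by lia.
  rewrite rsum_split, (rsum_zero (fun k => f (i + (1 + k))%nat)) by (intros; apply H; lia).
  simpl; rewrite Nat.add_0_r; ring.
Qed.

Lemma rsum_mult (f g : nat -> R) n :
  rsum f n * rsum g n = rsum (fun i => rsum (fun j => f i * g j) n) n.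
Proof.
  rewrite (rsum_ext (fun i => rsum (fun j => f i * g j) n) (fun i => rsum g n * f i)).
  - rewrite rsum_scal; ring.
  - intros; rewrite rsum_scal; ring.
Qed.

Lemma rsum_telescope (f : nat -> R) n : rsum (fun k => f (S k) - f k) n = f n - f O.
Proof. induction n as [|n IH]; simpl; [ring|]; rewrite IH; ring. Qed.

Lemma sum_f_R0_rsum (f : nat -> R) n : sum_f_R0 f n = rsum f (S n).
Proof.
  induction n as [|n IH]; [simpl; ring|].
  rewrite tech5, IH; reflexivity.
Qed.

Lemma rsum_geom_le r n : 0 <= r < 1 -> rsum (fun k => r ^ k) n <= / (1 - r).
Proof.
  intros Hr.
  assert (H : (1 - r) * rsum (fun k => r ^ k) n = 1 - r ^ n)
    by (induction n as [|n IH]; simpl; [ring|]; rewrite Rmult_plus_distr_l, IH; ring).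
  assert (0 <= r ^ n) by (apply pow_le; lra).
  apply Rmult_le_reg_l with (1 - r); [lra|].
  rewrite H, Rinv_r by lra; lra.
Qed.

(** * Functions of [T] tending to zero, and dominated convergence *)

Definition vanishes (f : R -> R) : Prop :=
  forall eps, 0 < eps -> exists T0, forall T, T0 <= T -> Rabs (f T) <= eps.

Lemma vanishes_is_lim f l : vanishes (fun T => f T - l) -> is_lim f p_infty l.
Proof.
  intros H; apply is_lim_spec; intros eps; simpl.
  destruct (H (eps / 2)) as [T0 HT]; [destruct eps; simpl; lra|].
  exists T0; intros x Hx; specialize (HT x (Rlt_le _ _ Hx)); destruct eps; simpl in *; lra.
Qed.

Lemma is_lim_vanishes f (l : R) : is_lim f p_infty l -> vanishes (fun T => f T - l).
Proof.
  intros H eps He; apply is_lim_spec in H; destruct (H (mkposreal eps He)) as [T0 HT].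
  exists (T0 + 1); intros T Ht; apply Rlt_le, HT; lra.
Qed.

Lemma vanishes_ext f g T1 : (forall T, T1 <= T -> f T = g T) -> vanishes f -> vanishes g.
Proof.
  intros E H eps He; destruct (H eps He) as [T0 HT].
  exists (Rmax T0 T1); intros T Ht.
  rewrite <- E by (eapply Rle_trans; [apply Rmax_r|eassumption]).
  apply HT; eapply Rle_trans; [apply Rmax_l|eassumption].
Qed.

Lemma vanishes_le f g T1 : (forall T, T1 <= T -> Rabs (f T) <= g T) -> vanishes g -> vanishes f.
Proof.
  intros E H eps He; destruct (H eps He) as [T0 HT].
  exists (Rmax T0 T1); intros T Ht.
  eapply Rle_trans; [apply E; eapply Rle_trans; [apply Rmax_r|eassumption]|].
  eapply Rle_trans; [apply RRle_abs|].
  apply HT; eapply Rle_trans; [apply Rmax_l|eassumption].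
Qed.

Lemma vanishes_plus f g : vanishes f -> vanishes g -> vanishes (fun T => f T + g T).
Proof.
  intros Hf Hg eps He; destruct (Hf (eps / 2)) as [T1 H1]; [lra|].
  destruct (Hg (eps / 2)) as [T2 H2]; [lra|].
  exists (Rmax T1 T2); intros T Ht.
  assert (T1 <= T) by (eapply Rle_trans; [apply Rmax_l|eassumption]).
  assert (T2 <= T) by (eapply Rle_trans; [apply Rmax_r|eassumption]).
  eapply Rle_trans; [apply Rabs_triang|].
  specialize (H1 T H); specialize (H2 T H0); lra.
Qed.

Lemma vanishes_scal c f : vanishes f -> vanishes (fun T => c * f T).
Proof.
  intros Hf eps He; destruct (Hf (eps / (Rabs c + 1))) as [T1 H1].
  - apply Rdiv_lt_0_compat; [lra|]; assert (H := Rabs_pos c); lra.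
  - exists T1; intros T Ht; rewrite Rabs_mult; specialize (H1 T Ht).
    assert (H := Rabs_pos c).
    apply Rle_trans with (Rabs c * (eps / (Rabs c + 1))).
    + now apply Rmult_le_compat_l.
    + apply Rmult_le_reg_r with (Rabs c + 1); [lra|].
      field_simplify; [nra|lra].
Qed.

Lemma vanishes_rsum (g : nat -> R -> R) n :
  (forall k, (k < n)%nat -> vanishes (g k)) -> vanishes (fun T => rsum (fun k => g k T) n).
Proof.
  induction n as [|n IH]; intros H; simpl.
  - intros eps He; exists 0; intros; rewrite Rabs_R0; lra.
  - apply vanishes_plus; auto.
Qed.

(** Dominated convergence for series: a fixed head of [K0] terms vanishes term by term, and the tail
    is at most [C r^K0 / (1 - r)]. The length [K T] may grow in any way, because the bound is
    uniform in [T]. *)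
Lemma tannery_vanishes (g : nat -> R -> R) (K : R -> nat) C r T1 :
  0 <= r < 1 ->
  (forall k, vanishes (g k)) ->
  (forall k T, T1 <= T -> Rabs (g k T) <= C * r ^ k) ->
  vanishes (fun T => rsum (fun k => g k T) (K T)).
Proof.
  intros Hr Hg Hb eps He.
  assert (HC : 0 <= C).
  { specialize (Hb O T1 (Rle_refl _)); simpl in Hb.
    assert (H := Rabs_pos (g O T1)); lra. }
  (* [K0] makes the tail at most [eps / 2]; [C + 1] stands in for [C], which may be zero. *)
  destruct (pow_lt_1_zero r) with (y := eps * (1 - r) / (2 * (C + 1))) as [K0 HK].
  { rewrite Rabs_pos_eq; lra. }
  { apply Rdiv_lt_0_compat; [apply Rmult_lt_0_compat|]; lra. }
  assert (Hh : vanishes (fun T => rsum (fun k => Rabs (g k T)) K0)).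
  { apply (vanishes_rsum (fun k T => Rabs (g k T))); intros k _ e Hepos.
    destruct (Hg k e Hepos) as [T0 HT]; exists T0; intros; rewrite Rabs_Rabsolu; auto. }
  destruct (Hh (eps / 2)) as [T0 HT]; [lra|].
  exists (Rmax T0 T1); intros T Ht.
  assert (Ht0 : T0 <= T) by (eapply Rle_trans; [apply Rmax_l|eassumption]).
  assert (Ht1 : T1 <= T) by (eapply Rle_trans; [apply Rmax_r|eassumption]).
  specialize (HT T Ht0).
  eapply Rle_trans; [apply rsum_abs|].
  (* Lengthening the sum to [K0 + K T] terms avoids a comparison of [K T] with [K0]. *)
  apply Rle_trans with (rsum (fun k => Rabs (g k T)) (K0 + K T)).
  { apply rsum_le_more; [lia|intros; apply Rabs_pos]. }
  rewrite rsum_split.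
  assert (H1 := RRle_abs (rsum (fun k => Rabs (g k T)) K0)).
  assert (H2 : rsum (fun k => Rabs (g (K0 + k)%nat T)) (K T) <= eps / 2).
  { apply Rle_trans with (rsum (fun k => C * r ^ K0 * r ^ k) (K T)).
    - apply rsum_le; intros k _; rewrite Rmult_assoc, <- pow_add; auto.
    - rewrite rsum_scal.
      assert (Hp : 0 <= r ^ K0) by (apply pow_le; lra).
      assert (Hk := HK K0 (Nat.le_refl _)); rewrite Rabs_pos_eq in Hk by lra.
      apply Rle_trans with (C * r ^ K0 * / (1 - r)).
      + apply Rmult_le_compat_l; [now apply Rmult_le_pos|now apply rsum_geom_le].
      + assert (Hi : 0 < / (1 - r)) by (apply Rinv_0_lt_compat; lra).
        apply Rle_trans with ((C + 1) * (eps * (1 - r) / (2 * (C + 1))) * / (1 - r)).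
        * apply Rmult_le_compat_r; [lra|].
          apply Rmult_le_compat; lra.
        * right; field; lra. }
  lra.
Qed.

(** * Kusmin-Landau bounds and approximation of zeta *)

Fixpoint csum (f : nat -> C) (n : nat) : C :=
  match n with O => RtoC 0 | S n => Cplus (csum f n) (f n) end.

Lemma csum_fst f n : fst (csum f n) = rsum (fun k => fst (f k)) n.
Proof. induction n as [|n IH]; simpl; congruence. Qed.

Lemma csum_snd f n : snd (csum f n) = rsum (fun k => snd (f k)) n.
Proof. induction n as [|n IH]; simpl; congruence. Qed.

Lemma csum_split (f : nat -> C) n m :
  csum f (n + m) = Cplus (csum f n) (csum (fun k => f (n + k)%nat) m).
Proof.
  induction m as [|m IH]; simpl.
  - rewrite Nat.add_0_r; ring.
  - rewrite Nat.add_succ_r; simpl; rewrite IH; ring.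
Qed.

Lemma csum_Cmod (f : nat -> C) n : Cmod (csum f n) <= rsum (fun k => Cmod (f k)) n.
Proof.
  induction n as [|n IH]; simpl; [rewrite Cmod_0; lra|].
  eapply Rle_trans; [apply Cmod_triangle|lra].
Qed.

Lemma abel_ratio_sum (f c : nat -> C) n :
  (forall k, (k < n)%nat -> f k = Cmult (c k) (Cminus (f k) (f (S k)))) ->
  csum f n =
  Cplus (Cminus (Cmult (c O) (f O)) (Cmult (c n) (f n)))
        (csum (fun k => Cmult (Cminus (c (S k)) (c k)) (f (S k))) n).
Proof.
  induction n as [|n IH]; intros H; simpl; [ring|].
  rewrite IH by (intros; apply H; lia).
  rewrite (H n) at 2 by lia; ring.
Qed.

(** With [c_k = 1/(1 - r_k)], of modulus at most [B], the boundary terms cost [2 B F], and [c_{k+1}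
    - c_k = c_{k+1} c_k (r_{k+1} - r_k)] makes the rest cost [B^2 V F]. The ratios need not have
    modulus 1, so the weight [n^{-1/2}] can stay inside [f]. *)
Lemma kusmin_landau_bound (f r : nat -> C) n B F V :
  0 <= B -> 0 <= F -> 0 <= V ->
  (forall k, (k <= n)%nat -> f (S k) = Cmult (r k) (f k)) ->
  (forall k, (k <= n)%nat -> Cmod (f k) <= F) ->
  (forall k, (k <= n)%nat -> 1 <= B * Cmod (Cminus 1 (r k))) ->
  rsum (fun k => Cmod (Cminus (r (S k)) (r k))) n <= V ->
  Cmod (csum f n) <= (2 * B + B * B * V) * F.
Proof.
  intros HB HF HV Hr Hf HB1 Hv.
  assert (Hnz : forall k, (k <= n)%nat -> Cminus 1 (r k) <> RtoC 0).
  { intros k Hk E; specialize (HB1 k Hk); rewrite E, Cmod_0 in HB1; lra. }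
  assert (Hc : forall k, (k <= n)%nat -> Cmod (Cinv (Cminus 1 (r k))) <= B).
  { intros k Hk; rewrite Cmod_inv by auto.
    assert (0 < Cmod (Cminus 1 (r k))) by (apply Cmod_gt_0; auto).
    apply Rmult_le_reg_r with (Cmod (Cminus 1 (r k))); [easy|].
    rewrite Rinv_l by lra; auto. }
  rewrite (abel_ratio_sum f (fun k => Cinv (Cminus 1 (r k)))).
  2: { intros k Hk; rewrite Hr by lia.
       replace (Cminus (f k) (Cmult (r k) (f k))) with (Cmult (Cminus 1 (r k)) (f k)) by ring.
       rewrite Cmult_assoc, Cinv_l by (apply Hnz; lia); ring. }
  eapply Rle_trans; [apply Cmod_triangle|].
  assert (Hb : forall k, (k <= n)%nat -> Cmod (Cmult (Cinv (Cminus 1 (r k))) (f k)) <= B * F).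
  { intros k Hk; rewrite Cmod_mult; apply Rmult_le_compat; auto using Cmod_ge_0. }
  assert (H1 : Cmod (Cminus (Cmult (Cinv (Cminus 1 (r O))) (f O)) (Cmult (Cinv (Cminus 1 (r n))) (f n)))
               <= 2 * (B * F)).
  { eapply Rle_trans; [apply Cmod_triangle|]; rewrite Cmod_opp.
    assert (A1 := Hb O (Nat.le_0_l _)); assert (A2 := Hb n (Nat.le_refl _)); lra. }
  assert (H2 : rsum (fun k => Cmod (Cmult (Cminus (Cinv (Cminus 1 (r (S k)))) (Cinv (Cminus 1 (r k)))) (f (S k)))) n
               <= B * B * F * V).
  { apply Rle_trans with (rsum (fun k => B * B * F * Cmod (Cminus (r (S k)) (r k))) n).
    - apply rsum_le; intros k Hk.
      replace (Cminus (Cinv (Cminus 1 (r (S k)))) (Cinv (Cminus 1 (r k))))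
        with (Cmult (Cmult (Cinv (Cminus 1 (r (S k)))) (Cinv (Cminus 1 (r k))))
                    (Cminus (r (S k)) (r k))).
      2: { field; split; apply Hnz; lia. }
      rewrite !Cmod_mult.
      replace (B * B * F * Cmod (Cminus (r (S k)) (r k)))
        with (B * B * Cmod (Cminus (r (S k)) (r k)) * F) by ring.
      apply Rmult_le_compat; auto using Cmod_ge_0, Rmult_le_pos.
      apply Rmult_le_compat_r; [apply Cmod_ge_0|].
      apply Rmult_le_compat; auto using Cmod_ge_0; apply Hc; lia.
    - rewrite rsum_scal; apply Rmult_le_compat_l; [|easy].
      repeat apply Rmult_le_pos; easy. }
  assert (H3 := csum_Cmod (fun k => Cmult (Cminus (Cinv (Cminus 1 (r (S k)))) (Cinv (Cminus 1 (r k)))) (f (S k))) n).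
  lra.
Qed.

Lemma ln_le_sub1 x : 0 < x -> ln x <= x - 1.
Proof.
  intros H; apply Rnot_lt_le; intros L.
  apply exp_increasing in L; rewrite exp_ln in L by easy.
  assert (A := exp_ineq1_le (x - 1)); lra.
Qed.

Lemma ln_ge_1sub x : 0 < x -> 1 - / x <= ln x.
Proof.
  intros H; assert (A := ln_le_sub1 (/ x) (Rinv_0_lt_compat _ H)).
  rewrite ln_Rinv in A by easy; lra.
Qed.

Definition expi (t : R) : C := (cos t, sin t).

Lemma expi_add s t : expi (s + t) = Cmult (expi s) (expi t).
Proof.
  unfold expi, Cmult; simpl; rewrite cos_plus, sin_plus.
  f_equal; ring.
Qed.

Lemma Cmod_expi t : Cmod (expi t) = 1.
Proof.
  unfold Cmod, expi; simpl fst; simpl snd.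
  replace (cos t ^ 2 + sin t ^ 2) with 1; [apply sqrt_1|].
  assert (A := sin2_cos2 t); unfold Rsqr in A; lra.
Qed.

Lemma Rabs_sin_le x : Rabs (sin x) <= Rabs x.
Proof.
  destruct (MVT_gen sin 0 x cos) as [c [_ H]].
  - intros; apply is_derive_sin.
  - intros; apply continuity_pt_filterlim; apply continuous_sin.
  - rewrite sin_0, !Rminus_0_r in H; rewrite H, Rabs_mult.
    rewrite <- (Rmult_1_l (Rabs x)) at 2.
    apply Rmult_le_compat_r; [apply Rabs_pos|].
    apply Rabs_le; assert (A := COS_bound c); lra.
Qed.

(** The chord is exactly [2 |sin((s - t)/2)|]. *)
Lemma Cmod_expi_sub s t : Cmod (Cminus (expi s) (expi t)) <= Rabs (s - t).
Proof.
  unfold Cmod, expi; simpl fst; simpl snd.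
  replace ((cos s + - cos t) ^ 2 + (sin s + - sin t) ^ 2) with ((2 * sin ((s - t) / 2)) ^ 2).
  - rewrite <- Rsqr_pow2, sqrt_Rsqr_abs, Rabs_mult, (Rabs_pos_eq 2) by lra.
    assert (A := Rabs_sin_le ((s - t) / 2)).
    unfold Rdiv in A; rewrite (Rabs_mult (s - t)), (Rabs_pos_eq (/ 2)) in A by lra; unfold Rdiv; lra.
  - assert (A1 := sin2_cos2 s); assert (A2 := sin2_cos2 t); unfold Rsqr in *.
    assert (A3 := cos_2a_sin ((s - t) / 2)).
    replace (2 * ((s - t) / 2)) with (s - t) in A3 by field.
    rewrite cos_minus in A3; nra.
Qed.

(** Mean value theorem, with [cos >= cos(pi/3) = 1/2] on [[0,1]]. *)
Lemma sin_ge_half x : 0 <= x <= 1 -> x / 2 <= sin x.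
Proof.
  intros H.
  destruct (MVT_gen sin 0 x cos) as [c [Hc E]].
  - intros; apply is_derive_sin.
  - intros; apply continuity_pt_filterlim; apply continuous_sin.
  - rewrite Rmin_left, Rmax_right in Hc by lra.
    rewrite sin_0, !Rminus_0_r in E; rewrite E.
    assert (Q := PI2_3_2).
    assert (cos (PI / 3) <= cos c) by (apply cos_decr_1; lra).
    rewrite cos_PI3 in *; nra.
Qed.

(** * Ratios of consecutive terms of the Dirichlet series *)

Notation pos1 k := (INR (S k)).

Lemma pos1_gt0 k : 0 < pos1 k.
Proof. apply lt_0_INR; lia. Qed.

Lemma pos1_ge1 k : 1 <= pos1 k.
Proof. rewrite S_INR; assert (H := pos_INR k); lra. Qed.

(* [dterm u k] is [(k+1)^{-1/2 - iu}]. *)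
Definition dterm (u : R) (k : nat) : C :=
  Cmult (RtoC (/ sqrt (pos1 k))) (expi (- (u * ln (pos1 k)))).

Lemma dterm_fst u k : fst (dterm u k) = cos (u * ln (pos1 k)) / sqrt (pos1 k).
Proof. unfold dterm, expi; cbn [fst snd Cmult RtoC]; rewrite cos_neg; unfold Rdiv; ring. Qed.

Lemma dterm_snd u k : snd (dterm u k) = - (sin (u * ln (pos1 k)) / sqrt (pos1 k)).
Proof. unfold dterm, expi; cbn [fst snd Cmult RtoC]; rewrite sin_neg; unfold Rdiv; ring. Qed.

Lemma Cmod_dterm u k : Cmod (dterm u k) = / sqrt (pos1 k).
Proof.
  unfold dterm; rewrite Cmod_mult, Cmod_expi, Cmod_R, Rabs_pos_eq; [ring|].
  apply Rlt_le, Rinv_0_lt_compat, sqrt_lt_R0, pos1_gt0.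
Qed.

Definition dratio (u : R) (k : nat) : C :=
  Cmult (RtoC (sqrt (pos1 k) / sqrt (pos1 (S k))))
        (expi (- (u * (ln (pos1 (S k)) - ln (pos1 k))))).

Lemma dterm_S u k : dterm u (S k) = Cmult (dratio u k) (dterm u k).
Proof.
  unfold dterm, dratio.
  replace (- (u * ln (pos1 (S k)))) with
    (- (u * (ln (pos1 (S k)) - ln (pos1 k))) + - (u * ln (pos1 k))) by ring.
  rewrite expi_add.
  replace (/ sqrt (pos1 (S k))) with (sqrt (pos1 k) / sqrt (pos1 (S k)) * / sqrt (pos1 k)).
  - rewrite RtoC_mult; ring.
  - field; split; apply Rgt_not_eq, sqrt_lt_R0, pos1_gt0.
Qed.

Lemma ln_step_bounds k : / pos1 (S k) <= ln (pos1 (S k)) - ln (pos1 k) <= / pos1 k.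
Proof.
  assert (H := pos1_gt0 k); assert (H' := pos1_gt0 (S k)).
  rewrite <- ln_div by easy.
  assert (Hq : 0 < pos1 (S k) / pos1 k) by (apply Rdiv_lt_0_compat; easy).
  assert (A := ln_le_sub1 _ Hq); assert (B := ln_ge_1sub _ Hq).
  assert (E : pos1 (S k) = pos1 k + 1) by (rewrite (S_INR (S k)); ring).
  split.
  - eapply Rle_trans; [|exact B]; rewrite E; right; field; lra.
  - eapply Rle_trans; [exact A|]; rewrite E; right; field; lra.
Qed.

(** With [x = k + 1], the second difference is the logarithm of [x(x+2)/(x+1)^2 = 1 - 1/(x+1)^2].
    The bound is left in telescoping form because it will be summed into a total variation. *)
Lemma ln_second_diff k :
  Rabs ((ln (pos1 (S (S k))) - ln (pos1 (S k))) - (ln (pos1 (S k)) - ln (pos1 k)))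
  <= / pos1 k - / pos1 (S k).
Proof.
  assert (H := ln_step_bounds k); assert (H' := ln_step_bounds (S k)).
  assert (E1 : pos1 (S k) = pos1 k + 1) by (rewrite (S_INR (S k)); ring).
  assert (E2 : pos1 (S (S k)) = pos1 k + 2) by (rewrite (S_INR (S (S k))), E1; ring).
  assert (P := pos1_gt0 k).
  set (x := pos1 k) in *; rewrite E1, E2 in *.
  assert (Hq : 0 < (x + 2) * x / ((x + 1) * (x + 1)))
    by (apply Rdiv_lt_0_compat; apply Rmult_lt_0_compat; lra).
  replace (ln (x + 2) - ln (x + 1) - (ln (x + 1) - ln x))
    with (ln ((x + 2) * x / ((x + 1) * (x + 1)))).
  2: { rewrite ln_div by (apply Rmult_lt_0_compat; lra).
       rewrite !ln_mult by lra; ring. }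
  assert (A := ln_le_sub1 _ Hq); assert (B := ln_ge_1sub _ Hq).
  assert (D : 0 < / (x * (x + 1))) by (apply Rinv_0_lt_compat, Rmult_lt_0_compat; lra).
  assert (D1 : 0 < / ((x + 2) * x)) by (apply Rinv_0_lt_compat, Rmult_lt_0_compat; lra).
  assert (D2 : / ((x + 2) * x) <= / (x * (x + 1))) by (apply Rinv_le_contravar; nra).
  assert (D3 : 0 < / ((x + 1) * (x + 1))) by (apply Rinv_0_lt_compat, Rmult_lt_0_compat; lra).
  replace (/ x - / (x + 1)) with (/ (x * (x + 1))) by (field; lra).
  replace ((x + 2) * x / ((x + 1) * (x + 1)) - 1) with (- / ((x + 1) * (x + 1))) in A by (field; lra).
  replace (1 - / ((x + 2) * x / ((x + 1) * (x + 1)))) with (- / ((x + 2) * x)) in B by (field; lra).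
  apply Rabs_le; lra.
Qed.

Lemma dratio_mod_bounds k : / 2 <= sqrt (pos1 k) / sqrt (pos1 (S k)) <= 1.
Proof.
  assert (P := pos1_ge1 k).
  assert (E1 : pos1 (S k) = pos1 k + 1) by (rewrite (S_INR (S k)); ring).
  rewrite E1, <- sqrt_div by lra.
  split.
  - replace (/ 2) with (sqrt (/ 2 * / 2)) by (apply sqrt_square; lra).
    apply sqrt_le_1_alt, Rmult_le_reg_r with (pos1 k + 1); [lra|].
    unfold Rdiv; rewrite (Rmult_assoc (pos1 k)), Rinv_l by lra; lra.
  - rewrite <- sqrt_1 at 2; apply sqrt_le_1_alt.
    apply Rmult_le_reg_r with (pos1 k + 1); [lra|].
    unfold Rdiv; rewrite (Rmult_assoc (pos1 k)), Rinv_l by lra; lra.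
Qed.

(** The squares of the two quotients differ by [1/((x+1)(x+2))] and the quotients add up to at least
    1, so they differ by no more than their squares do. *)
Lemma dratio_mod_diff k :
  Rabs (sqrt (pos1 (S k)) / sqrt (pos1 (S (S k))) - sqrt (pos1 k) / sqrt (pos1 (S k)))
  <= / pos1 k - / pos1 (S k).
Proof.
  assert (B1 := dratio_mod_bounds k); assert (B2 := dratio_mod_bounds (S k)).
  assert (E1 : pos1 (S k) = pos1 k + 1) by (rewrite (S_INR (S k)); ring).
  assert (E2 : pos1 (S (S k)) = pos1 k + 2) by (rewrite (S_INR (S (S k))), E1; ring).
  assert (P := pos1_gt0 k).
  set (x := pos1 k) in *; rewrite E1, E2 in *.
  assert (Q1 : (sqrt x / sqrt (x + 1)) * (sqrt x / sqrt (x + 1)) = x / (x + 1)).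
  { rewrite <- sqrt_div by lra; apply sqrt_sqrt, Rlt_le, Rdiv_lt_0_compat; lra. }
  assert (Q2 : (sqrt (x + 1) / sqrt (x + 2)) * (sqrt (x + 1) / sqrt (x + 2)) = (x + 1) / (x + 2)).
  { rewrite <- sqrt_div by lra; apply sqrt_sqrt, Rlt_le, Rdiv_lt_0_compat; lra. }
  set (a := sqrt x / sqrt (x + 1)) in *; set (b := sqrt (x + 1) / sqrt (x + 2)) in *.
  assert (D : b * b - a * a = / ((x + 1) * (x + 2))) by (rewrite Q1, Q2; field; lra).
  assert (D1 : 0 < / ((x + 1) * (x + 2))) by (apply Rinv_0_lt_compat, Rmult_lt_0_compat; lra).
  assert (D2 : / ((x + 1) * (x + 2)) <= / (x * (x + 1))) by (apply Rinv_le_contravar; nra).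
  replace (/ x - / (x + 1)) with (/ (x * (x + 1))) by (field; lra).
  apply Rabs_le; nra.
Qed.

Lemma dratio_diff u k :
  Cmod (Cminus (dratio u (S k)) (dratio u k)) <= (1 + Rabs u) * (/ pos1 k - / pos1 (S k)).
Proof.
  unfold dratio.
  set (a := sqrt (pos1 (S k)) / _); set (b := sqrt (pos1 k) / _).
  set (s := - (u * (ln (pos1 (S (S k))) - _))); set (t := - (u * (ln (pos1 (S k)) - _))).
  replace (Cminus (Cmult (RtoC a) (expi s)) (Cmult (RtoC b) (expi t)))
    with (Cplus (Cmult (RtoC (a - b)) (expi s)) (Cmult (RtoC b) (Cminus (expi s) (expi t)))).
  2: { rewrite RtoC_minus; ring. }
  eapply Rle_trans; [apply Cmod_triangle|].
  rewrite !Cmod_mult, Cmod_expi, !Cmod_R, Rmult_1_r.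
  assert (H1 := dratio_mod_diff k); fold a b in H1.
  assert (H2 := dratio_mod_bounds k); fold b in H2.
  rewrite (Rabs_pos_eq b) by lra.
  assert (H3 := Cmod_expi_sub s t).
  assert (H4 : Rabs (s - t) <= Rabs u * (/ pos1 k - / pos1 (S k))).
  { unfold s, t; rewrite <- Rabs_Ropp.
    match goal with |- Rabs ?e <= _ => replace e with
     (u * ((ln (pos1 (S (S k))) - ln (pos1 (S k))) - (ln (pos1 (S k)) - ln (pos1 k)))) by ring end.
    rewrite Rabs_mult; apply Rmult_le_compat_l; [apply Rabs_pos|apply ln_second_diff]. }
  assert (H5 := Cmod_ge_0 (Cminus (expi s) (expi t))).
  nra.
Qed.

Lemma dratio_variation u N n :
  rsum (fun k => Cmod (Cminus (dratio u (S (N + k))) (dratio u (N + k)))) n <= (1 + Rabs u) / pos1 N.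
Proof.
  apply Rle_trans with (rsum (fun k => (1 + Rabs u) * ((fun k => - / pos1 (N + k)) (S k) - (fun k => - / pos1 (N + k)) k)) n).
  - apply rsum_le; intros k _; eapply Rle_trans; [apply dratio_diff|].
    cbv beta; rewrite Nat.add_succ_r; right; ring.
  - rewrite rsum_scal, (rsum_telescope (fun k => - / pos1 (N + k))), Nat.add_0_r.
    apply Rmult_le_compat_l; [assert (H := Rabs_pos u); lra|].
    assert (H := Rinv_0_lt_compat _ (pos1_gt0 (N + n))); lra.
Qed.

(** The condition [|u| <= k + 1] keeps the angle of the ratio in [[-1,1]]. There [cos] is
    nonnegative, as the alternating series needs, and [sin] is comparable with its argument, as the
    plain series needs. *)
Lemma dratio_angle u k : Rabs u <= pos1 k ->
  Rabs u / pos1 (S k) <= Rabs (u * (ln (pos1 (S k)) - ln (pos1 k))) <= 1.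
Proof.
  intros Hu; assert (A := ln_step_bounds k).
  assert (P := Rinv_0_lt_compat _ (pos1_gt0 (S k))).
  rewrite Rabs_mult, (Rabs_pos_eq (ln _ - _)) by lra.
  assert (H := Rabs_pos u); split.
  - apply Rmult_le_compat_l; lra.
  - apply Rle_trans with (Rabs u * / pos1 k); [apply Rmult_le_compat_l; lra|].
    apply Rmult_le_reg_r with (pos1 k); [apply pos1_gt0|].
    rewrite Rmult_assoc, Rinv_l by (apply Rgt_not_eq, pos1_gt0); lra.
Qed.

Lemma dterm_le u N k : Cmod (dterm u (N + k)) <= / sqrt (pos1 N).
Proof.
  rewrite Cmod_dterm; apply Rinv_le_contravar; [apply sqrt_lt_R0, pos1_gt0|].
  apply sqrt_le_1_alt, le_INR; lia.
Qed.

Lemma inv_sqrt_pos k : 0 < / sqrt (pos1 k).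
Proof. apply Rinv_0_lt_compat, sqrt_lt_R0, pos1_gt0. Qed.

Definition eterm (u : R) (k : nat) : C := Cmult (RtoC ((-1) ^ k)) (dterm u k).

Lemma Cmod_ge_Rabs_fst z : Rabs (fst z) <= Cmod z.
Proof.
  eapply Rle_trans; [apply (Rmax_l _ (Rabs (snd z)))|apply Rmax_Cmod].
Qed.

Lemma Cmod_ge_Rabs_snd z : Rabs (snd z) <= Cmod z.
Proof.
  eapply Rle_trans; [apply (Rmax_r (Rabs (fst z)))|apply Rmax_Cmod].
Qed.

(** The ratio is [-r] with [r] of nonnegative real part, so [|1 + r| >= 1], and the Kusmin-Landau
    bound applies with [B = 1] and [V = 2]. *)
Lemma eta_block_bound u N n : Rabs u <= pos1 N ->
  Cmod (csum (fun k => eterm u (N + k)) n) <= 4 / sqrt (pos1 N).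
Proof.
  intros Hu.
  assert (P := pos1_gt0 N); assert (PI := Rinv_0_lt_compat _ P).
  assert (Hv : (1 + Rabs u) / pos1 N <= 2).
  { apply Rmult_le_reg_r with (pos1 N); [easy|].
    unfold Rdiv; rewrite Rmult_assoc, Rinv_l by lra; assert (A := pos1_ge1 N); lra. }
  eapply Rle_trans.
  - apply (kusmin_landau_bound _ (fun k => Copp (dratio u (N + k))) n 1 (/ sqrt (pos1 N)) 2); try lra.
    + apply Rlt_le, inv_sqrt_pos.
    + intros k _; unfold eterm; rewrite Nat.add_succ_r, dterm_S, <- tech_pow_Rmult, RtoC_mult.
      replace (RtoC (-1)) with (Copp 1) by (apply injective_projections; simpl; ring).
      ring.
    + intros k _; unfold eterm; rewrite Cmod_mult, Cmod_R, pow_1_abs, Rmult_1_l; apply dterm_le.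
    + intros k _; rewrite Rmult_1_l.
      eapply Rle_trans; [|apply Cmod_ge_Rabs_fst].
      eapply Rle_trans; [|apply RRle_abs].
      unfold dratio, expi; cbn [fst snd Cmult Cminus Cplus Copp RtoC]; rewrite cos_neg.
      assert (A := dratio_mod_bounds (N + k)).
      assert (B := dratio_angle u (N + k)).
      destruct B as [_ B]; [eapply Rle_trans; [exact Hu|apply le_INR; lia]|].
      set (t := u * _) in *.
      assert (0 <= cos t); [|nra].
      apply Rabs_le_between in B; assert (Q := PI2_1); apply cos_ge_0; lra.
    + eapply Rle_trans; [|exact Hv]; eapply Rle_trans; [|apply (dratio_variation u N n)].
      right; apply rsum_ext; intros k _; rewrite Nat.add_succ_r.
      rewrite <- Cmod_opp; f_equal; ring.
  - right; unfold Rdiv; ring.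
Qed.

(** Without the alternating sign [|1 - r|] is only known to be at least of order [|u|/N], through
    its imaginary part; this loss turns [1 / sqrt N] into [sqrt N / |u|]. *)
Lemma dirichlet_block_bound u N : (1 <= N)%nat -> 1 <= Rabs u <= pos1 N ->
  Cmod (csum (fun k => dterm u (N + k)) N) <= 144 * sqrt (pos1 N) / Rabs u.
Proof.
  intros HN Hu.
  assert (P := pos1_gt0 N); assert (PI := Rinv_0_lt_compat _ P).
  assert (Hu' : 0 < / Rabs u) by (apply Rinv_0_lt_compat; lra).
  assert (HB : 0 <= 8 * pos1 N / Rabs u) by (apply Rmult_le_pos; lra).
  assert (HV : 0 <= (1 + Rabs u) / pos1 N) by (apply Rmult_le_pos; lra).
  eapply Rle_trans.
  - apply (kusmin_landau_bound _ (fun k => dratio u (N + k)) N (8 * pos1 N / Rabs u)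
             (/ sqrt (pos1 N)) ((1 + Rabs u) / pos1 N)); try easy.
    + apply Rlt_le, inv_sqrt_pos.
    + intros k _; rewrite Nat.add_succ_r; apply dterm_S.
    + intros k _; apply dterm_le.
    + intros k Hk.
      assert (B := dratio_angle u (N + k)).
      destruct B as [B1 B2]; [eapply Rle_trans; [apply Hu|apply le_INR; lia]|].
      assert (A := dratio_mod_bounds (N + k)).
      assert (H1 := Cmod_ge_Rabs_snd (Cminus 1 (dratio u (N + k)))).
      unfold dratio at 1 in H1; unfold expi in H1; cbn [fst snd Cmult Cminus Cplus Copp RtoC] in H1.
      rewrite sin_neg in H1.
      set (t := u * (ln _ - _)) in *; set (a := sqrt _ / sqrt _) in *.
      replace (0 + - (a * - sin t + 0 * cos (- t))) with (a * sin t) in H1 by ring.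
      assert (H2 : Rabs t / 2 <= Rabs (sin t)).
      { destruct (Rle_or_lt 0 t) as [Ht|Ht].
        - rewrite (Rabs_pos_eq t) in * by easy.
          eapply Rle_trans; [apply sin_ge_half|apply RRle_abs]; lra.
        - rewrite (Rabs_left t) in * by easy.
          rewrite <- (Rabs_Ropp (sin t)), <- sin_neg.
          eapply Rle_trans; [apply sin_ge_half|apply RRle_abs]; lra. }
      rewrite Rabs_mult, (Rabs_pos_eq a) in H1 by lra.
      assert (H3 : Rabs u / (2 * pos1 N) <= Rabs t).
      { eapply Rle_trans; [|exact B1]; apply Rmult_le_compat_l; [lra|].
        apply Rinv_le_contravar; [apply pos1_gt0|].
        rewrite !S_INR, plus_INR; assert (INR k <= INR N) by (apply le_INR; lia). lra. }
      (* The constant 8 collects a 2 from [N + k + 2 <= 2 (N + 1)], a 2 from [|sin t| >= |t|/2] and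
         a 2 from the modulus of the ratio. *)
      apply Rle_trans with (8 * pos1 N / Rabs u * (Rabs u / (2 * pos1 N) / 4)).
      * right; field; lra.
      * apply Rmult_le_compat_l; [easy|].
        assert (H4 : / 2 * (Rabs t / 2) <= a * Rabs (sin t))
          by (assert (H5 := Rabs_pos t); apply Rmult_le_compat; lra).
        lra.
    + eapply Rle_trans; [|apply (dratio_variation u N N)].
      right; apply rsum_ext; intros k _; rewrite Nat.add_succ_r; reflexivity.
  - assert (Hs := sqrt_sqrt _ (Rlt_le _ _ P)); assert (Hs' := sqrt_lt_R0 _ P).
    set (q := sqrt _) in *; rewrite <- Hs.
    replace ((2 * (8 * (q * q) / Rabs u) + 8 * (q * q) / Rabs u * (8 * (q * q) / Rabs u) * ((1 + Rabs u) / (q * q))) * / q)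
      with (q / Rabs u * (16 + 64 * (1 + / Rabs u))) by (field; lra).
    replace (144 * q / Rabs u) with (q / Rabs u * 144) by (field; lra).
    apply Rmult_le_compat_l; [apply Rmult_le_pos; lra|].
    assert (/ Rabs u <= 1); [|lra].
    rewrite <- Rinv_1; apply Rinv_le_contravar; lra.
Qed.

(** * Convergence of the eta series and its tail *)

Lemma seq_lim_unique u l : Un_cv u l -> seq_lim u = l.
Proof.
  intros H; apply (UL_sequence u); [|easy].
  unfold seq_lim; apply epsilon_spec; now exists l.
Qed.

Lemma inv_sqrt_small eps : 0 < eps -> exists N, forall n, (N <= n)%nat -> 4 / sqrt (pos1 n) < eps.
Proof.
  intros He; destruct (INR_unbounded ((4 / eps) * (4 / eps))) as [N HN].
  exists N; intros n Hn.
  assert (Hq : 4 / eps < sqrt (pos1 n)).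
  { rewrite <- (sqrt_square (4 / eps)) by (apply Rlt_le, Rdiv_lt_0_compat; lra).
    apply sqrt_lt_1_alt; split.
    - apply Rle_0_sqr.
    - eapply Rlt_le_trans; [exact HN|]; apply le_INR; lia. }
  assert (0 < sqrt (pos1 n)) by (apply sqrt_lt_R0, pos1_gt0).
  apply Rmult_lt_reg_r with (sqrt (pos1 n)); [easy|].
  unfold Rdiv; rewrite Rmult_assoc, Rinv_l by lra.
  apply Rmult_lt_compat_l with (r := eps) in Hq; [|easy].
  replace (eps * (4 / eps)) with 4 in Hq by (field; lra); lra.
Qed.

(** The block bounds give the Cauchy criterion, and then pass to the limit. The shift [S n] matches
    [sum_f_R0], whose value at [n] has [n + 1] terms. *)
Lemma tail_bound_converges (a : nat -> R) N0 :
  (forall N d, (N0 <= N)%nat -> Rabs (a (N + d)%nat - a N) <= 4 / sqrt (pos1 N)) ->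
  forall N, (N0 <= N)%nat -> Rabs (seq_lim (fun n => a (S n)) - a N) <= 4 / sqrt (pos1 N).
Proof.
  intros H.
  assert (HC : Cauchy_crit (fun n => a (S n))).
  { intros eps He; destruct (inv_sqrt_small (eps / 2)) as [N1 HN1]; [lra|].
    exists (N0 + N1)%nat; intros n m Hn Hm.
    assert (A := HN1 (N0 + N1)%nat ltac:(lia)).
    assert (A1 := H (N0 + N1)%nat (S n - (N0 + N1))%nat ltac:(lia)).
    assert (A2 := H (N0 + N1)%nat (S m - (N0 + N1))%nat ltac:(lia)).
    replace (N0 + N1 + (S n - (N0 + N1)))%nat with (S n) in A1 by lia.
    replace (N0 + N1 + (S m - (N0 + N1)))%nat with (S m) in A2 by lia.
    unfold Rdist; apply Rabs_def1; apply Rabs_le_between in A1, A2; lra. }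
  destruct (Rcomplete.R_complete _ HC) as [l Hl].
  rewrite (seq_lim_unique _ _ Hl).
  intros N HN; apply le_epsilon; intros eps He.
  destruct (Hl eps He) as [M HM].
  assert (A := HM (N + M)%nat ltac:(lia)); unfold Rdist in A.
  assert (B := H N (S M) HN); replace (N + S M)%nat with (S (N + M)) in B by lia.
  apply Rabs_def2 in A; apply Rabs_le_between in B; apply Rabs_le; lra.
Qed.

Definition eta (u : R) : C := (eta_re u, eta_im u).

Lemma eterm_fst u k : fst (eterm u k) = (-1) ^ k * cos (u * ln (pos1 k)) / sqrt (pos1 k).
Proof.
  unfold eterm; cbn [fst snd Cmult RtoC]; rewrite dterm_fst; unfold Rdiv; ring.
Qed.

Lemma eterm_snd u k : snd (eterm u k) = - ((-1) ^ k * sin (u * ln (pos1 k)) / sqrt (pos1 k)).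
Proof.
  unfold eterm; cbn [fst snd Cmult RtoC]; rewrite dterm_snd; unfold Rdiv; ring.
Qed.

Lemma seq_lim_ext u v : (forall n, u n = v n) -> seq_lim u = seq_lim v.
Proof.
  intros H; replace v with u; [easy|].
  apply functional_extensionality; exact H.
Qed.

Lemma eta_re_tail u N : Rabs u <= pos1 N ->
  Rabs (eta_re u - fst (csum (eterm u) N)) <= 4 / sqrt (pos1 N).
Proof.
  intros Hu.
  rewrite <- (tail_bound_converges (fun n => fst (csum (eterm u) n)) N).
  - right; f_equal; f_equal; unfold eta_re; apply seq_lim_ext; intros n.
    unfold eta_re_partial; rewrite sum_f_R0_rsum, csum_fst.
    apply rsum_ext; intros; symmetry; apply eterm_fst.
  - intros M d HM; rewrite csum_split.
    eapply Rle_trans; [|apply (eta_block_bound u M d)].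
    + eapply Rle_trans; [|apply Cmod_ge_Rabs_fst]; right; f_equal; simpl; ring.
    + eapply Rle_trans; [exact Hu|apply le_INR; lia].
  - lia.
Qed.

Lemma eta_im_tail u N : Rabs u <= pos1 N ->
  Rabs (eta_im u - snd (csum (eterm u) N)) <= 4 / sqrt (pos1 N).
Proof.
  intros Hu.
  rewrite <- (tail_bound_converges (fun n => snd (csum (eterm u) n)) N).
  - right; f_equal; f_equal; unfold eta_im; apply seq_lim_ext; intros n.
    unfold eta_im_partial; rewrite sum_f_R0_rsum, csum_snd.
    apply rsum_ext; intros; symmetry; apply eterm_snd.
  - intros M d HM; rewrite csum_split.
    eapply Rle_trans; [|apply (eta_block_bound u M d)].
    + eapply Rle_trans; [|apply Cmod_ge_Rabs_snd]; right; f_equal; simpl; ring.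
    + eapply Rle_trans; [exact Hu|apply le_INR; lia].
  - lia.
Qed.

Lemma Cmod_sqr z : Cmod z * Cmod z = fst z ^ 2 + snd z ^ 2.
Proof.
  unfold Cmod; apply sqrt_sqrt; assert (A := pow2_ge_0 (fst z)); assert (B := pow2_ge_0 (snd z)); lra.
Qed.

Lemma Cmod_le_sum z : Cmod z <= Rabs (fst z) + Rabs (snd z).
Proof.
  assert (A := Rabs_pos (fst z)); assert (B := Rabs_pos (snd z)).
  apply Rsqr_incr_0; [|apply Cmod_ge_0|lra].
  unfold Rsqr; rewrite Cmod_sqr.
  rewrite <- (pow2_abs (fst z)), <- (pow2_abs (snd z)); nra.
Qed.

Lemma eta_tail u N : Rabs u <= pos1 N ->
  Cmod (Cminus (eta u) (csum (eterm u) N)) <= 8 / sqrt (pos1 N).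
Proof.
  intros Hu; eapply Rle_trans; [apply Cmod_le_sum|].
  assert (A := eta_re_tail u N Hu); assert (B := eta_im_tail u N Hu).
  unfold eta; cbn [fst snd Cminus Cplus Copp]; unfold Rminus in *; lra.
Qed.

(** * From eta to zeta *)

(** This is [2^{1-s}] at [s = 1/2 + iu]. *)
Definition twofac (u : R) : C := Cmult (RtoC (sqrt 2)) (expi (- (u * ln 2))).

(** That is, [2 (2n)^{-s} = 2^{1-s} n^{-s}] for [n = k + 1]; the even integer [2n] sits at the odd
    index [2k + 1]. *)
Lemma dterm_double u k : Cmult 2 (dterm u (S (2 * k))) = Cmult (twofac u) (dterm u k).
Proof.
  unfold dterm, twofac.
  assert (P := pos1_gt0 k).
  replace (pos1 (S (2 * k))) with (2 * pos1 k) by (rewrite !S_INR, mult_INR; simpl; ring).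
  rewrite ln_mult, sqrt_mult by lra.
  replace (- (u * (ln 2 + ln (pos1 k)))) with (- (u * ln 2) + - (u * ln (pos1 k))) by ring.
  rewrite expi_add.
  assert (S1 := sqrt_lt_R0 _ P); assert (S2 := sqrt_lt_R0 2 ltac:(lra)).
  assert (S3 := sqrt_sqrt 2 ltac:(lra)).
  replace (Cmult 2 (Cmult (RtoC (/ (sqrt 2 * sqrt (pos1 k)))) (Cmult (expi (- (u * ln 2))) (expi (- (u * ln (pos1 k)))))))
    with (Cmult (RtoC (2 * (/ (sqrt 2 * sqrt (pos1 k))))) (Cmult (expi (- (u * ln 2))) (expi (- (u * ln (pos1 k))))))
    by (rewrite RtoC_mult; ring).
  replace (2 * / (sqrt 2 * sqrt (pos1 k))) with (sqrt 2 * / sqrt (pos1 k)).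
  - rewrite RtoC_mult; ring.
  - rewrite <- S3 at 2; field; lra.
Qed.

(** Finite form of [eta(s) = (1 - 2^{1-s}) zeta(s)]. The two Dirichlet sums have different lengths,
    which is why the block [N < n <= 2N] has to be estimated. *)
Lemma eta_partial_double u N :
  csum (eterm u) (2 * N) = Cminus (csum (dterm u) (2 * N)) (Cmult (twofac u) (csum (dterm u) N)).
Proof.
  induction N as [|N IH]; [simpl; ring|].
  replace (2 * S N)%nat with (S (S (2 * N))) by lia.
  cbn [csum]; rewrite IH.
  replace (eterm u (2 * N)) with (dterm u (2 * N)).
  2: { unfold eterm; rewrite pow_1_even; ring. }
  replace (eterm u (S (2 * N))) with (Copp (dterm u (S (2 * N)))).
  2: { unfold eterm; rewrite pow_1_odd.
       replace (RtoC (-1)) with (Copp 1) by (apply injective_projections; simpl; ring); ring. }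
  rewrite Cmult_plus_distr_l, <- dterm_double; ring.
Qed.

Lemma eta_fac_eq u : Cminus 1 (twofac u) = (eta_fac_re u, eta_fac_im u).
Proof.
  unfold twofac, expi, eta_fac_re, eta_fac_im; rewrite cos_neg, sin_neg.
  apply injective_projections; cbn [fst snd Cminus Cplus Copp Cmult RtoC]; ring.
Qed.

(** Triangle inequality: [2^{1-s}] has constant modulus [sqrt 2 >= 7/5] on the critical line. *)
Lemma eta_fac_lower u : 2 / 5 <= Cmod (Cminus 1 (twofac u)).
Proof.
  assert (A : Cmod (twofac u) = sqrt 2).
  { unfold twofac; rewrite Cmod_mult, Cmod_expi, Cmod_R, Rabs_pos_eq by apply sqrt_pos; ring. }
  assert (B : 7 / 5 <= sqrt 2).
  { rewrite <- (sqrt_square (7 / 5)) by lra; apply sqrt_le_1_alt; lra. }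
  assert (D := Cmod_triangle (Cminus 1 (twofac u)) (-(1))%C).
  rewrite Cmod_opp, Cmod_1 in D.
  replace (Cplus (Cminus 1 (twofac u)) (Copp 1)) with (Copp (twofac u)) in D by ring.
  rewrite Cmod_opp in D; lra.
Qed.

Lemma zeta_crit_abs2_Cmod u :
  zeta_crit_abs2 u =
  Cmod (Cdiv (eta u) (Cminus 1 (twofac u))) * Cmod (Cdiv (eta u) (Cminus 1 (twofac u))).
Proof.
  assert (A := eta_fac_lower u).
  assert (NZ : Cminus 1 (twofac u) <> RtoC 0).
  { intros E; rewrite E, Cmod_0 in A; lra. }
  rewrite Cmod_div by easy.
  unfold zeta_crit_abs2.
  replace (eta_fac_re u ^ 2 + eta_fac_im u ^ 2)
    with (Cmod (Cminus 1 (twofac u)) * Cmod (Cminus 1 (twofac u))) by (rewrite Cmod_sqr, eta_fac_eq; reflexivity).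
  replace (eta_re u ^ 2 + eta_im u ^ 2) with (Cmod (eta u) * Cmod (eta u)) by (rewrite Cmod_sqr; reflexivity).
  field; lra.
Qed.

Lemma rsum_inv_sqrt N : rsum (fun k => / sqrt (pos1 k)) N <= 2 * sqrt (INR N).
Proof.
  induction N as [|N IH]; [simpl; rewrite sqrt_0; lra|].
  cbn [rsum].
  assert (P := pos1_gt0 N); assert (S1 := sqrt_lt_R0 _ P).
  assert (S2 := sqrt_sqrt _ (Rlt_le _ _ P)); assert (S3 := sqrt_sqrt _ (pos_INR N)); assert (S4 := sqrt_pos (INR N)).
  assert (E := S_INR N).
  enough (/ sqrt (pos1 N) <= 2 * sqrt (pos1 N) - 2 * sqrt (INR N)) by lra.
  apply Rmult_le_reg_r with (sqrt (pos1 N)); [easy|].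
  rewrite Rinv_l by lra.
  set (a := sqrt (pos1 N)) in *; set (b := sqrt (INR N)) in *; nra.
Qed.

(** Multiplied by [1 - 2^{1-s}], the difference of zeta and the partial sum is the tail of eta
    beyond [2N] plus the block [N < n <= 2N], hence [O(sqrt N / |u|)]. For the squares this is
    multiplied by the trivial bound [O(sqrt N)] on the partial sum. *)
Lemma zeta_approx u N : (1 <= N)%nat -> 1 <= Rabs u <= pos1 N ->
  Rabs (zeta_crit_abs2 u - (fst (csum (dterm u) N) ^ 2 + snd (csum (dterm u) N) ^ 2))
  <= 145920 * (pos1 N / Rabs u).
Proof.
  intros HN Hu.
  rewrite zeta_crit_abs2_Cmod, <- Cmod_sqr.
  assert (A := eta_fac_lower u).
  assert (NZ : Cminus 1 (twofac u) <> RtoC 0).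
  { intros E; rewrite E, Cmod_0 in A; lra. }
  set (z := Cdiv (eta u) _); set (w := csum (dterm u) N).
  assert (P := pos1_gt0 N); assert (Q := sqrt_lt_R0 _ P); assert (QQ := sqrt_sqrt _ (Rlt_le _ _ P)).
  assert (U : 0 < / Rabs u <= 1).
  { split; [apply Rinv_0_lt_compat; lra|rewrite <- Rinv_1; apply Rinv_le_contravar; lra]. }
  assert (D1 : Cmod (Cmult (Cminus z w) (Cminus 1 (twofac u))) <= 152 * (sqrt (pos1 N) / Rabs u)).
  { replace (Cmult (Cminus z w) (Cminus 1 (twofac u)))
      with (Cplus (Cminus (eta u) (csum (eterm u) (2 * N))) (csum (fun k => dterm u (N + k)) N)).
    2: { rewrite eta_partial_double; replace (2 * N)%nat with (N + N)%nat by lia.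
         rewrite csum_split; unfold z, w; field; easy. }
    eapply Rle_trans; [apply Cmod_triangle|].
    assert (B1 := dirichlet_block_bound u N HN Hu).
    assert (Hle : pos1 N <= pos1 (2 * N)) by (apply le_INR; lia).
    assert (B2 := eta_tail u (2 * N) ltac:(lra)).
    assert (B3 : / sqrt (pos1 (2 * N)) <= sqrt (pos1 N) / Rabs u).
    { apply Rle_trans with (/ sqrt (pos1 N)).
      - apply Rinv_le_contravar; [easy|]; now apply sqrt_le_1_alt.
      - apply Rmult_le_reg_r with (Rabs u); [lra|].
        unfold Rdiv; rewrite Rmult_assoc, Rinv_l, Rmult_1_r by lra.
        apply Rmult_le_reg_l with (sqrt (pos1 N)); [easy|].
        rewrite <- Rmult_assoc, Rinv_r by lra; lra. }
    unfold Rdiv in *; lra. }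
  rewrite Cmod_mult in D1.
  (* [152 = 8 + 144] adds the two bounds, and dividing by [2/5] gives 380. *)
  assert (D2 : Cmod (Cminus z w) <= 380 * (sqrt (pos1 N) / Rabs u)).
  { assert (H := Cmod_ge_0 (Cminus z w)); nra. }
  assert (D3 : Cmod w <= 2 * sqrt (pos1 N)).
  { eapply Rle_trans; [apply csum_Cmod|].
    rewrite (rsum_ext _ (fun k => / sqrt (pos1 k))) by (intros; apply Cmod_dterm).
    eapply Rle_trans; [apply rsum_inv_sqrt|].
    apply Rmult_le_compat_l; [lra|]; apply sqrt_le_1_alt, le_INR; lia. }
  assert (T1 : Cmod z <= Cmod w + Cmod (Cminus z w)).
  { replace z with (Cplus w (Cminus z w)) at 1 by ring; apply Cmod_triangle. }
  assert (T2 : Cmod w <= Cmod z + Cmod (Cminus z w)).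
  { replace w with (Cplus z (Copp (Cminus z w))) at 1 by ring.
    eapply Rle_trans; [apply Cmod_triangle|]; rewrite Cmod_opp; lra. }
  assert (G := Cmod_ge_0 (Cminus z w)); assert (G1 := Cmod_ge_0 z); assert (G2 := Cmod_ge_0 w).
  set (d := Cmod (Cminus z w)) in *; set (a := Cmod z) in *; set (b := Cmod w) in *.
  set (q := sqrt (pos1 N)) in *.
  (* From [b <= 2 q] and [d <= 380 q] the second factor is at most [384 q]; 145920 is 380 times
     384. *)
  apply Rle_trans with (d * (2 * b + d)).
  - replace (a * a - b * b) with ((a - b) * (a + b)) by ring.
    rewrite Rabs_mult; apply Rmult_le_compat; try apply Rabs_pos.
    + apply Rabs_le; lra.
    + rewrite Rabs_pos_eq by lra; lra.
  - assert (K : d <= 380 * q).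
    { eapply Rle_trans; [exact D2|]; unfold Rdiv; nra. }
    apply Rle_trans with (380 * (q / Rabs u) * (384 * q)).
    + apply Rmult_le_compat; lra.
    + right; rewrite <- QQ; unfold Rdiv; ring.
Qed.

(** * Continuity of zeta on the critical line *)

Lemma continuous_rsum (f : nat -> R -> R) n x :
  (forall k, continuous (f k) x) -> continuous (fun u => rsum (fun k => f k u) n) x.
Proof.
  intros H; induction n as [|n IH]; simpl; [apply continuous_const|].
  apply (continuous_plus (fun u => rsum (fun k => f k u) n) (f n)); auto.
Qed.

(** A locally uniform limit of continuous functions: on the unit ball around [u] a single [N] serves
    all points. *)
Lemma continuous_of_tail (g : R -> R) (p : nat -> R -> R) :
  (forall u N, Rabs u <= pos1 N -> Rabs (g u - p N u) <= 4 / sqrt (pos1 N)) ->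
  (forall N u, continuous (p N) u) -> forall u, continuous g u.
Proof.
  intros H Hp u.
  apply continuity_pt_filterlim; intros eps He.
  destruct (inv_sqrt_small (eps / 3)) as [N1 HN1]; [lra|].
  destruct (INR_unbounded (Rabs u + 1)) as [N2 HN2].
  set (N := (N1 + N2)%nat).
  assert (C := Hp N u); apply continuity_pt_filterlim in C.
  destruct (C (eps / 3)) as [d [Hd HC]]; [lra|].
  exists (Rmin d 1); split; [apply Rmin_pos; lra|].
  intros x [Hx1 Hx2]; specialize (HC x).
  simpl in HC, Hx2 |- *; unfold Rdist in *.
  assert (HC' : Rabs (p N x - p N u) < eps / 3).
  { apply HC; split; [easy|]; eapply Rlt_le_trans; [exact Hx2|apply Rmin_l]. }
  assert (Hx3 : Rabs (x - u) < 1) by (eapply Rlt_le_trans; [exact Hx2|apply Rmin_r]).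
  assert (HNN : Rabs u + 1 < pos1 N) by (eapply Rlt_le_trans; [exact HN2|apply le_INR; unfold N; lia]).
  assert (Hx4 : Rabs x <= Rabs u + 1).
  { replace x with (u + (x - u)) by ring; eapply Rle_trans; [apply Rabs_triang|lra]. }
  assert (A1 := H x N ltac:(lra)); assert (A2 := H u N ltac:(lra)).
  assert (A3 := HN1 N ltac:(unfold N; lia)).
  apply Rabs_def2 in HC'; apply Rabs_le_between in A1, A2; apply Rabs_def1; lra.
Qed.

Lemma continuous_eta_re u : continuous eta_re u.
Proof.
  apply (continuous_of_tail eta_re (fun N u => fst (csum (eterm u) N))).
  - intros; now apply eta_re_tail.
  - intros N v.
    apply continuous_ext with (fun u => rsum (fun k => (-1) ^ k * cos (u * ln (pos1 k)) / sqrt (pos1 k)) N).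
    { intros w; rewrite csum_fst; apply rsum_ext; intros; symmetry; apply eterm_fst. }
    apply (continuous_rsum (fun k u => (-1) ^ k * cos (u * ln (pos1 k)) / sqrt (pos1 k))); intros k.
    apply (ex_derive_continuous (fun u => (-1) ^ k * cos (u * ln (pos1 k)) / sqrt (pos1 k))); auto_derive; easy.
Qed.

Lemma continuous_eta_im u : continuous eta_im u.
Proof.
  apply (continuous_of_tail eta_im (fun N u => snd (csum (eterm u) N))).
  - intros; now apply eta_im_tail.
  - intros N v.
    apply continuous_ext with (fun u => rsum (fun k => - ((-1) ^ k * sin (u * ln (pos1 k)) / sqrt (pos1 k))) N).
    { intros w; rewrite csum_snd; apply rsum_ext; intros; symmetry; apply eterm_snd. }
    apply (continuous_rsum (fun k u => - ((-1) ^ k * sin (u * ln (pos1 k)) / sqrt (pos1 k)))); intros k.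
    apply (ex_derive_continuous (fun u => - ((-1) ^ k * sin (u * ln (pos1 k)) / sqrt (pos1 k)))); auto_derive; easy.
Qed.

Lemma continuous_zeta_crit_abs2 u : continuous zeta_crit_abs2 u.
Proof.
  assert (A := eta_fac_lower u).
  assert (NZ : eta_fac_re u ^ 2 + eta_fac_im u ^ 2 <> 0).
  { assert (B := Cmod_sqr (Cminus 1 (twofac u))); rewrite eta_fac_eq in *; simpl fst in B; simpl snd in B; nra. }
  apply continuity_pt_filterlim.
  assert (Cr := continuous_eta_re u); assert (Ci := continuous_eta_im u).
  apply continuity_pt_filterlim in Cr, Ci.
  assert (D1 : continuity_pt eta_fac_re u).
  { apply continuity_pt_filterlim, (ex_derive_continuous eta_fac_re); unfold eta_fac_re; auto_derive; easy. }
  assert (D2 : continuity_pt eta_fac_im u).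
  { apply continuity_pt_filterlim, (ex_derive_continuous eta_fac_im); unfold eta_fac_im; auto_derive; easy. }
  apply continuity_pt_ext with
    (((eta_re * eta_re) + (eta_im * eta_im)) / ((eta_fac_re * eta_fac_re) + (eta_fac_im * eta_fac_im)))%F.
  { intros t; unfold zeta_crit_abs2, div_fct, plus_fct, mult_fct; f_equal; simpl; ring. }
  apply continuity_pt_div.
  - apply continuity_pt_plus; apply continuity_pt_mult; easy.
  - apply continuity_pt_plus; apply continuity_pt_mult; easy.
  - unfold plus_fct, mult_fct; intros E; apply NZ; simpl; lra.
Qed.

(** * Oscillatory sums and integrals against the test function *)

(** What is kept of smoothness: two continuous derivatives under a common bound, enough for two
    summations or integrations by parts. *)
Record test_function (B : R) (phi phi1 phi2 : R -> R) : Prop := {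
  test_derive : forall x, is_derive phi x (phi1 x);
  test_derive1 : forall x, is_derive phi1 x (phi2 x);
  test_cont2 : forall x, continuous phi2 x;
  test_supp : support_in phi 1 2;
  test_supp1 : support_in phi1 1 2;
  test_bound : forall x, Rabs (phi x) <= B;
  test_bound1 : forall x, Rabs (phi1 x) <= B;
  test_bound2 : forall x, Rabs (phi2 x) <= B }.

Lemma support_out f x : support_in f 1 2 -> x < 1 \/ 2 < x -> f x = 0.
Proof.
  intros H Hx; destruct (Req_dec (f x) 0) as [E|E]; [easy|].
  specialize (H x E); lra.
Qed.

(** The complement of [[1,2]] is open, so [f] vanishes on a neighbourhood of each of its points. *)
Lemma support_derive (f g : R -> R) :
  (forall x, is_derive f x (g x)) -> support_in f 1 2 -> support_in g 1 2.
Proof.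
  intros Hd Hs x Hx.
  destruct (Rlt_dec x 1) as [H1|H1]; [exfalso|destruct (Rlt_dec 2 x) as [H2|H2]; [exfalso|lra]].
  - apply Hx; rewrite <- (is_derive_unique _ _ _ (Hd x)).
    apply is_derive_unique, (is_derive_ext_loc (fun _ => 0)); [|auto_derive; easy].
    exists (mkposreal (1 - x) ltac:(lra)); intros y Hy.
    symmetry; apply support_out; [easy|left].
    apply Rabs_def2 in Hy; simpl in Hy; unfold minus, plus, opp in Hy; simpl in Hy; lra.
  - apply Hx; rewrite <- (is_derive_unique _ _ _ (Hd x)).
    apply is_derive_unique, (is_derive_ext_loc (fun _ => 0)); [|auto_derive; easy].
    exists (mkposreal (x - 2) ltac:(lra)); intros y Hy.
    symmetry; apply support_out; [easy|right].
    apply Rabs_def2 in Hy; simpl in Hy; unfold minus, plus, opp in Hy; simpl in Hy; lra.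
Qed.

Lemma support_bounded (f : R -> R) :
  (forall x, continuous f x) -> support_in f 1 2 -> exists B, 0 <= B /\ forall x, Rabs (f x) <= B.
Proof.
  intros Hc Hs.
  destruct (continuity_ab_maj (fun x => Rabs (f x)) 1 2) as [y [Hy _]]; [lra| |].
  - intros c _; apply continuity_pt_filterlim.
    apply (continuous_comp f Rabs); [easy|apply (continuous_Rabs (f c))].
  - exists (Rabs (f y)); split; [apply Rabs_pos|]; intros x.
    destruct (Req_dec (f x) 0) as [E|E]; [rewrite E, Rabs_R0; apply Rabs_pos|auto].
Qed.

Lemma smooth_test_function phi :
  smooth phi -> support_in phi 1 2 -> exists B phi1 phi2, test_function B phi phi1 phi2.
Proof.
  intros [D [H0 HD]] Hs.
  assert (Hd : forall k x, is_derive (D k) x (D (S k) x)).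
  { intros k x; apply is_derive_Reals, HD. }
  assert (Hc : forall k x, continuous (D k) x).
  { intros k x; apply (ex_derive_continuous (D k)); now exists (D (S k) x). }
  assert (Hk : forall k, support_in (D k) 1 2).
  { induction k as [|k IH]; [rewrite H0; exact Hs|].
    apply support_derive with (D k); auto. }
  destruct (support_bounded (D 0%nat)) as [B0 [P0 Q0]]; auto.
  destruct (support_bounded (D 1%nat)) as [B1 [P1 Q1]]; auto.
  destruct (support_bounded (D 2%nat)) as [B2 [P2 Q2]]; auto.
  exists (B0 + B1 + B2), (D 1%nat), (D 2%nat).
  rewrite <- H0; constructor; auto.
  - intros x; specialize (Q0 x); lra.
  - intros x; specialize (Q1 x); lra.
  - intros x; specialize (Q2 x); lra.
Qed.

Lemma lipschitz_derive (f g : R -> R) B :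
  (forall x, is_derive f x (g x)) -> (forall x, Rabs (g x) <= B) ->
  forall x y, Rabs (f y - f x) <= B * Rabs (y - x).
Proof.
  intros Hd Hb x y.
  destruct (MVT_gen f x y g) as [c [_ E]].
  - intros; auto.
  - intros z _; apply continuity_pt_filterlim, (ex_derive_continuous f); now exists (g z).
  - rewrite E, Rabs_mult; apply Rmult_le_compat_r; [apply Rabs_pos|auto].
Qed.

(** The mean value theorem on each side gives [(phi1 c - phi1 d) h] with [|c - d| <= 2h]. *)
Lemma second_difference_bound B phi phi1 phi2 x h : test_function B phi phi1 phi2 -> 0 <= h ->
  Rabs (phi (x + h) + phi (x - h) - 2 * phi x) <= 2 * B * (h * h).
Proof.
  intros H Hh.
  destruct (MVT_gen phi x (x + h) phi1) as [c [Hc E]];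
    [intros; apply H|intros z _; apply continuity_pt_filterlim, (ex_derive_continuous phi); exists (phi1 z); apply H|].
  destruct (MVT_gen phi (x - h) x phi1) as [d [Hd E']];
    [intros; apply H|intros z _; apply continuity_pt_filterlim, (ex_derive_continuous phi); exists (phi1 z); apply H|].
  rewrite Rmin_left, Rmax_right in * by lra.
  replace (phi (x + h) + phi (x - h) - 2 * phi x) with ((phi1 c - phi1 d) * h) by lra.
  rewrite Rabs_mult, (Rabs_pos_eq h) by lra.
  assert (A := lipschitz_derive phi1 phi2 B (test_derive1 _ _ _ _ H) (test_bound2 _ _ _ _ H) d c).
  assert (A' : Rabs (c - d) <= 2 * h) by (apply Rabs_le; lra).
  assert (HB : 0 <= B) by (eapply Rle_trans; [apply Rabs_pos|apply (test_bound _ _ _ _ H 0)]).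
  assert (Rabs (phi1 c - phi1 d) <= B * (2 * h)).
  { eapply Rle_trans; [exact A|]; now apply Rmult_le_compat_l. }
  nra.
Qed.

Definition natup (x : R) : nat := Z.to_nat (up x).

Lemma natup_spec x : 0 <= x -> x < INR (natup x) <= x + 1.
Proof.
  intros Hx; destruct (archimed x) as [A1 A2].
  assert (0 < up x)%Z by (apply lt_IZR; lra).
  unfold natup; rewrite INR_IZR_INZ, Z2Nat.id by lia; lra.
Qed.

Lemma cos_rec t h : cos (t + h) + cos (t - h) = 2 * cos h * cos t.
Proof. rewrite cos_plus, cos_minus; ring. Qed.

Lemma Rmin1_bound x K U V : 0 < V -> 0 <= K ->
  Rabs x <= K * U -> V * Rabs x <= K * U -> Rabs x <= K * (U * Rmin 1 (/ V)).
Proof.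
  intros HV HK H1 H2.
  unfold Rmin; destruct (Rle_dec 1 (/ V)); [lra|].
  apply Rmult_le_reg_l with V; [easy|].
  replace (V * (K * (U * / V))) with (K * U) by (field; lra); easy.
Qed.

(** Multiplication by [2 - 2 cos th = |1 - e^{i th}|^2] turns the cosine wave into minus its second
    difference. Two summations by parts move that difference onto [phi(l/T)], where it is
    [O(T^{-2})]. The condition [2T + 1 < M] puts both upper boundary points, [M - 1] and [M], beyond
    the support. *)
Lemma osc_sum_bound B phi phi1 phi2 T M th c : test_function B phi phi1 phi2 ->
  2 <= T -> 2 * T + 1 < INR M <= 3 * T -> 0 < 2 - 2 * cos th ->
  Rabs (rsum (fun l => cos (th * INR l + c) * phi (INR l / T)) M)
  <= 6 * B * (T * Rmin 1 (/ (T * T * (2 - 2 * cos th)))).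
Proof.
  intros H HT HM Hth.
  assert (HB : 0 <= B) by (eapply Rle_trans; [apply Rabs_pos|apply (test_bound _ _ _ _ H 0)]).
  assert (IT : 0 < / T) by (apply Rinv_0_lt_compat; lra).
  apply Rmin1_bound; [repeat apply Rmult_lt_0_compat; lra|lra| |].
  - eapply Rle_trans; [apply rsum_abs|].
    apply Rle_trans with (rsum (fun _ => B) M).
    + apply rsum_le; intros l _; rewrite Rabs_mult.
      rewrite <- (Rmult_1_l B); apply Rmult_le_compat; try apply Rabs_pos; [|apply H].
      apply Rabs_le; assert (A := COS_bound (th * INR l + c)); lra.
    + rewrite rsum_const; nra.
  - set (a := fun x => cos (th * x + c)); set (g := fun x => phi (x / T)).
    assert (E : (2 - 2 * cos th) * rsum (fun l => a (INR l) * g (INR l)) M =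
                - rsum (fun l => a (INR l) * (g (INR l + 1) + g (INR l - 1) - 2 * g (INR l))) M).
    { assert (T1 : rsum (fun l => a (INR (S l)) * g (INR (S l) - 1) - a (INR l) * g (INR l - 1)) M = 0).
      { rewrite (rsum_telescope (fun l => a (INR l) * g (INR l - 1))).
        replace (g (INR M - 1)) with 0; [replace (g (INR 0 - 1)) with 0; [ring|]|]; symmetry;
          apply (support_out phi); try apply H.
        - left; simpl; unfold Rdiv; nra.
        - right; apply Rmult_lt_reg_r with T; [lra|].
          unfold Rdiv; rewrite Rmult_assoc, Rinv_l by lra; lra. }
      assert (T2 : rsum (fun l => a (INR (S l) - 1) * g (INR (S l)) - a (INR l - 1) * g (INR l)) M = 0).
      { rewrite (rsum_telescope (fun l => a (INR l - 1) * g (INR l))).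
        replace (g (INR M)) with 0; [replace (g (INR 0)) with 0; [ring|]|]; symmetry;
          apply (support_out phi); try apply H.
        - left; simpl; unfold Rdiv; nra.
        - right; apply Rmult_lt_reg_r with T; [lra|].
          unfold Rdiv; rewrite Rmult_assoc, Rinv_l by lra; lra. }
      (* The recurrence [a(l+1) + a(l-1) = 2 cos th a(l)] makes the left summand a difference of two
         telescoping ones. *)
      assert (E0 : rsum (fun l => ((2 - 2 * cos th) * (a (INR l) * g (INR l)) +
                      a (INR l) * (g (INR l + 1) + g (INR l - 1) - 2 * g (INR l)))) M =
                   rsum (fun l => (a (INR (S l) - 1) * g (INR (S l)) - a (INR l - 1) * g (INR l)) -
                      (a (INR (S l)) * g (INR (S l) - 1) - a (INR l) * g (INR l - 1))) M).
      { apply rsum_ext; intros l _; rewrite S_INR.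
        replace (INR l + 1 - 1) with (INR l) by ring.
        assert (R := cos_rec (th * INR l + c) th).
        replace (th * INR l + c + th) with (th * (INR l + 1) + c) in R by ring.
        replace (th * INR l + c - th) with (th * (INR l - 1) + c) in R by ring.
        fold (a (INR l + 1)) (a (INR l - 1)) (a (INR l)) in R.
        replace (a (INR l + 1)) with (2 * cos th * a (INR l) - a (INR l - 1)) by lra.
        ring. }
      rewrite rsum_minus, T1, T2, rsum_plus, rsum_scal in E0; lra. }
    rewrite Rmult_assoc, <- (Rabs_pos_eq (2 - 2 * cos th)) at 1 by lra.
    rewrite <- Rabs_mult.
    change (rsum (fun l => cos (th * INR l + c) * phi (INR l / T)) M)
      with (rsum (fun l => a (INR l) * g (INR l)) M).
    rewrite E, Rabs_Ropp.
    assert (A : Rabs (rsum (fun l => a (INR l) * (g (INR l + 1) + g (INR l - 1) - 2 * g (INR l))) M)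
                <= INR M * (2 * B * (/ T * / T))).
    { eapply Rle_trans; [apply rsum_abs|]; rewrite <- rsum_const.
      apply rsum_le; intros l _; rewrite Rabs_mult.
      assert (Q := second_difference_bound _ _ _ _ (INR l / T) (/ T) H (Rlt_le _ _ IT)).
      unfold g; replace ((INR l + 1) / T) with (INR l / T + / T) by (field; lra).
      replace ((INR l - 1) / T) with (INR l / T - / T) by (field; lra).
      rewrite <- (Rmult_1_l (2 * B * (/ T * / T))).
      apply Rmult_le_compat; try apply Rabs_pos; [|exact Q].
      apply Rabs_le; apply COS_bound. }
    apply Rle_trans with (T * T * (INR M * (2 * B * (/ T * / T)))).
    + apply Rmult_le_compat_l; [nra|exact A].
    + replace (T * T * (INR M * (2 * B * (/ T * / T)))) with (INR M * (2 * B)) by (field; lra).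
      nra.
Qed.

Lemma continuous_derivable (f g : R -> R) x : is_derive f x (g x) -> continuous f x.
Proof. intros H; apply (ex_derive_continuous f); now exists (g x). Qed.

Lemma continuous_dilate (f : R -> R) T : (forall x, continuous f x) -> forall t, continuous (fun t => f (t / T)) t.
Proof.
  intros H t; apply (continuous_comp (fun t => t / T) f); [|apply H].
  apply (continuous_mult (fun t : R => t) (fun _ => / T)); [apply continuous_id|apply continuous_const].
Qed.

Lemma continuous_cos_lin th c t : continuous (fun t => cos (th * t + c)) t.
Proof. apply (ex_derive_continuous (fun t => cos (th * t + c))); auto_derive; easy. Qed.

(** Two integrations by parts at once. The bound has the shape of the one for sums, with [th^2] in
    place of [|1 - e^{i th}|^2], so that the first can later be dominated by the second. *)
Lemma osc_int_bound B phi phi1 phi2 T M th c : test_function B phi phi1 phi2 ->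
  2 <= T -> 2 * T + 1 < INR M <= 3 * T -> th <> 0 ->
  Rabs (RInt (fun t => cos (th * t + c) * phi (t / T)) 0 (INR M))
  <= 6 * B * (T * Rmin 1 (/ (T * T * (th * th)))).
Proof.
  intros H HT HM Hth.
  assert (HB : 0 <= B) by (eapply Rle_trans; [apply Rabs_pos|apply (test_bound _ _ _ _ H 0)]).
  assert (IT : 0 < / T) by (apply Rinv_0_lt_compat; lra).
  assert (Hth2 : 0 < th * th) by (assert (A := Rsqr_pos_lt th Hth); exact A).
  assert (C0 : forall x, continuous phi x) by (intros x; apply (continuous_derivable phi phi1), H).
  assert (CC : forall f, (forall x, continuous f x) -> forall t,
              continuous (fun t => cos (th * t + c) * f (t / T)) t).
  { intros f Hf t; apply (continuous_mult (fun t => cos (th * t + c)) (fun t => f (t / T)));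
      [apply continuous_cos_lin|now apply continuous_dilate]. }
  assert (EX : forall f a b, (forall x, continuous f x) ->
              ex_RInt (fun t => cos (th * t + c) * f (t / T)) a b).
  { intros f a b Hf; apply (ex_RInt_continuous (V := R_CompleteNormedModule)); intros; now apply CC. }
  assert (BD : forall f, (forall x, continuous f x) -> (forall x, Rabs (f x) <= B) ->
     Rabs (RInt (fun t => cos (th * t + c) * f (t / T)) 0 (INR M)) <= 3 * T * B).
  { intros f Hf Hb; eapply Rle_trans.
    - apply (abs_RInt_le_const _ _ _ B); [lra|now apply EX|].
      intros t _; rewrite Rabs_mult, <- (Rmult_1_l B).
      apply Rmult_le_compat; try apply Rabs_pos; [|auto].
      apply Rabs_le; apply COS_bound.
    - nra. }
  apply Rmin1_bound; [apply Rmult_lt_0_compat; [nra|easy]|lra| |].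
  - eapply Rle_trans; [apply BD; [easy|apply H]|nra].
  - assert (E : RInt (fun t => cos (th * t + c) * phi (t / T)) 0 (INR M) =
                - (/ (T * T * (th * th)) * RInt (fun t => cos (th * t + c) * phi2 (t / T)) 0 (INR M))).
    (* In the derivative of [F] the two terms with [phi1] cancel; what remains is the integrand plus
       a multiple of the one with [phi2]. *)
    { set (F := fun t => sin (th * t + c) / th * phi (t / T) + cos (th * t + c) / (th * th * T) * phi1 (t / T)).
      assert (I : is_RInt (fun t => cos (th * t + c) * phi (t / T) +
                      / (T * T * (th * th)) * (cos (th * t + c) * phi2 (t / T))) 0 (INR M)
                  (minus (F (INR M)) (F 0))).
      { apply (is_RInt_derive F).
        - intros t _.
          assert (D0 := test_derive _ _ _ _ H (t / T)); assert (D1 := test_derive1 _ _ _ _ H (t / T)).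
          assert (L : is_derive (fun t => t / T) t (/ T)) by (auto_derive; [easy|field; lra]).
          assert (E0 := is_derive_comp phi (fun t => t / T) t _ _ D0 L).
          assert (E1 := is_derive_comp phi1 (fun t => t / T) t _ _ D1 L).
          assert (G0 : is_derive (fun t => sin (th * t + c) / th) t (cos (th * t + c)))
            by (auto_derive; [easy|field; lra]).
          assert (G1 : is_derive (fun t => cos (th * t + c) / (th * th * T)) t (- sin (th * t + c) / (th * T)))
            by (auto_derive; [easy|field; lra]).
          unfold F.
          evar_last.
          + apply (is_derive_plus (V := R_NormedModule)).
            * apply (is_derive_mult _ _ _ _ _ G0 E0); intros; apply Rmult_comm.
            * apply (is_derive_mult _ _ _ _ _ G1 E1); intros; apply Rmult_comm.
          + unfold plus, mult, scal; simpl; unfold mult; simpl; field; lra.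
        - intros t _.
          apply (continuous_plus (fun t => cos (th * t + c) * phi (t / T))
                  (fun t => / (T * T * (th * th)) * (cos (th * t + c) * phi2 (t / T)))).
          + now apply CC.
          + apply (continuous_mult (fun _ => / (T * T * (th * th)))
                    (fun t => cos (th * t + c) * phi2 (t / T))); [apply continuous_const|apply CC, H]. }
      apply (is_RInt_unique (V := R_CompleteNormedModule)) in I.
      rewrite (RInt_plus (V := R_CompleteNormedModule) (fun t => cos (th * t + c) * phi (t / T))
         (fun t => / (T * T * (th * th)) * (cos (th * t + c) * phi2 (t / T)))) in I.
      + rewrite (RInt_scal (V := R_CompleteNormedModule) (fun t => cos (th * t + c) * phi2 (t / T))) in I
          by (apply EX, H).
        unfold F, minus, plus, opp, scal in I; simpl in I; unfold mult in I; simpl in I.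
        assert (Z : 2 < INR M / T).
        { apply Rmult_lt_reg_r with T; [lra|].
          unfold Rdiv; rewrite Rmult_assoc, Rinv_l by lra; lra. }
        assert (Z0 : 0 / T < 1) by (unfold Rdiv; rewrite Rmult_0_l; lra).
        rewrite !(support_out phi), !(support_out phi1) in I; try apply H; try (left; easy); try (right; easy).
        lra.
      + now apply EX.
      + apply (ex_RInt_scal (V := R_CompleteNormedModule) (fun t => cos (th * t + c) * phi2 (t / T))), EX, H. }
    rewrite E, Rabs_Ropp, Rabs_mult.
    assert (HV : 0 < T * T * (th * th)) by (apply Rmult_lt_0_compat; [nra|easy]).
    rewrite (Rabs_pos_eq (/ _)) by (apply Rlt_le, Rinv_0_lt_compat; easy).
    rewrite <- Rmult_assoc, Rinv_r, Rmult_1_l by lra.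
    eapply Rle_trans; [apply BD; apply H|nra].
Qed.

(** Each unit interval costs at most [B / T] by the Lipschitz bound, and there are at most [3T] of
    them. *)
Lemma riemann_sum_error B phi phi1 phi2 T M : test_function B phi phi1 phi2 ->
  2 <= T -> INR M <= 3 * T ->
  Rabs (rsum (fun l => phi (INR l / T)) M - RInt (fun t => phi (t / T)) 0 (INR M)) <= 3 * B.
Proof.
  intros H HT HM.
  assert (HB : 0 <= B) by (eapply Rle_trans; [apply Rabs_pos|apply (test_bound _ _ _ _ H 0)]).
  assert (IT : 0 < / T) by (apply Rinv_0_lt_compat; lra).
  assert (C0 : forall x, continuous phi x) by (intros x; apply (continuous_derivable phi phi1), H).
  assert (EX : forall a b, ex_RInt (fun t => phi (t / T)) a b).
  { intros a b; apply (ex_RInt_continuous (V := R_CompleteNormedModule)); intros; now apply continuous_dilate. }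
  apply Rle_trans with (INR M * (B * / T)).
  - clear HM; induction M as [|M IH].
    + simpl; rewrite RInt_point; unfold zero; simpl; rewrite Rminus_0_r, Rabs_R0; lra.
    + cbn [rsum].
      assert (Ch : RInt (fun t => phi (t / T)) 0 (INR (S M)) =
        RInt (fun t => phi (t / T)) 0 (INR M) + RInt (fun t => phi (t / T)) (INR M) (INR (S M)))
        by (symmetry; apply (RInt_Chasles (V := R_CompleteNormedModule)); apply EX).
      rewrite Ch.
      assert (Q : Rabs (phi (INR M / T) - RInt (fun t => phi (t / T)) (INR M) (INR (S M))) <= B * / T).
      { replace (phi (INR M / T)) with (RInt (fun _ => phi (INR M / T)) (INR M) (INR (S M))).
        2: { etransitivity; [apply (RInt_const (V := R_CompleteNormedModule))|].
             change ((INR (S M) - INR M) * phi (INR M / T) = phi (INR M / T)); rewrite S_INR; ring. }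
        rewrite <- (RInt_minus (V := R_CompleteNormedModule) (fun _ => phi (INR M / T))).
        2: apply ex_RInt_const.
        2: apply EX.
        eapply Rle_trans.
        - apply (abs_RInt_le_const _ _ _ (B * / T)).
          + rewrite S_INR; lra.
          + apply (ex_RInt_minus (V := R_CompleteNormedModule) (fun _ => phi (INR M / T))); [apply ex_RInt_const|apply EX].
          + intros t Ht; rewrite S_INR in Ht.
            eapply Rle_trans.
            * apply (lipschitz_derive phi phi1 B (test_derive _ _ _ _ H) (test_bound1 _ _ _ _ H)).
            * apply Rmult_le_compat_l; [easy|].
              replace (INR M / T - t / T) with ((INR M - t) * / T) by (field; lra).
              rewrite Rabs_mult, (Rabs_pos_eq (/ T)) by lra.
              assert (Rabs (INR M - t) <= 1) by (apply Rabs_le; lra); nra.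
        - rewrite S_INR; right; ring. }
      replace (INR (S M) * (B * / T)) with (INR M * (B * / T) + B * / T) by (rewrite S_INR; ring).
      match goal with |- Rabs ?e <= _ => replace e with
        ((rsum (fun l => phi (INR l / T)) M - RInt (fun t => phi (t / T)) 0 (INR M)) +
         (phi (INR M / T) - RInt (fun t => phi (t / T)) (INR M) (INR (S M)))) end.
      * eapply Rle_trans; [apply Rabs_triang|lra].
      * ring.
  - apply Rle_trans with (3 * T * (B * / T)).
    + apply Rmult_le_compat_r; [nra|easy].
    + right; field; lra.
Qed.

Lemma RInt_dilate B phi phi1 phi2 T M : test_function B phi phi1 phi2 ->
  2 <= T -> 2 * T + 1 < INR M <= 3 * T ->
  RInt (fun t => phi (t / T)) 0 (INR M) = T * RInt phi 0 3.
Proof.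
  intros H HT HM.
  assert (IT : 0 < / T) by (apply Rinv_0_lt_compat; lra).
  assert (C0 : forall x, continuous phi x) by (intros x; apply (continuous_derivable phi phi1), H).
  assert (EX : forall a b, ex_RInt phi a b).
  { intros a b; apply (ex_RInt_continuous (V := R_CompleteNormedModule)); intros; apply C0. }
  assert (Z : 2 < INR M / T).
  { apply Rmult_lt_reg_r with T; [lra|].
    unfold Rdiv; rewrite Rmult_assoc, Rinv_l by lra; lra. }
  assert (Z' : INR M / T <= 3).
  { apply Rmult_le_reg_r with T; [lra|].
    unfold Rdiv; rewrite Rmult_assoc, Rinv_l by lra; lra. }
  assert (E := RInt_comp_lin phi (/ T) 0 0 (INR M) (EX _ _)).
  replace (/ T * 0 + 0) with 0 in E by ring.
  replace (/ T * INR M + 0) with (INR M / T) in E by (unfold Rdiv; ring).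
  rewrite <- (RInt_Chasles (V := R_CompleteNormedModule) phi 0 (INR M / T) 3) by apply EX.
  rewrite (RInt_ext phi (fun _ => 0) (INR M / T) 3).
  2: { intros x Hx; rewrite Rmin_left, Rmax_right in Hx by lra.
       apply support_out; [apply H|lra]. }
  rewrite RInt_const, <- E.
  rewrite (RInt_ext (fun t => phi (t / T)) (fun t => scal T (scal (/ T) (phi (/ T * t + 0))))).
  - rewrite (RInt_scal (V := R_CompleteNormedModule) (fun t => scal (/ T) (phi (/ T * t + 0)))).
    + unfold plus, scal; simpl; unfold mult; simpl; rewrite Rmult_0_r, Rplus_0_r; reflexivity.
    + apply (ex_RInt_comp_lin phi); apply EX.
  - intros t _; unfold scal; simpl; unfold mult; simpl.
    replace (/ T * t + 0) with (t / T) by (unfold Rdiv; ring); field; lra.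
Qed.

Lemma RInt_test_pos B phi phi1 phi2 : test_function B phi phi1 phi2 ->
  (forall x, 0 <= phi x) -> (exists x, phi x <> 0) -> 0 < RInt phi 0 3.
Proof.
  intros H Hp [x0 Hx0].
  assert (C0 : forall x, continuous phi x) by (intros x; apply (continuous_derivable phi phi1), H).
  assert (EX : forall a b, ex_RInt phi a b).
  { intros a b; apply (ex_RInt_continuous (V := R_CompleteNormedModule)); intros; apply C0. }
  assert (Hx := test_supp _ _ _ _ H x0 Hx0).
  assert (P : 0 < phi x0) by (specialize (Hp x0); lra).
  assert (HC := C0 x0); apply continuity_pt_filterlim in HC.
  destruct (HC (phi x0) P) as [d [Hd HC']].
  (* The interval of radius [e] lies in the ball where [phi] is positive and, since [x0] is in
     [[1,2]], inside [[0,3]]. *)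
  set (e := Rmin d 1 / 2).
  assert (He : 0 < e < d /\ e < 1).
  { unfold e, Rmin; destruct (Rle_dec d 1); lra. }
  rewrite <- (RInt_Chasles (V := R_CompleteNormedModule) phi 0 (x0 - e) 3) by apply EX.
  rewrite <- (RInt_Chasles (V := R_CompleteNormedModule) phi (x0 - e) (x0 + e) 3) by apply EX.
  assert (A1 : 0 <= RInt phi 0 (x0 - e)) by (apply RInt_ge_0; auto; lra).
  assert (A2 : 0 <= RInt phi (x0 + e) 3) by (apply RInt_ge_0; auto; lra).
  assert (A3 : 0 < RInt phi (x0 - e) (x0 + e)).
  { apply RInt_gt_0; [lra| |intros; apply C0].
    intros x Hxx.
    destruct (Req_dec x x0) as [->|Ne]; [easy|].
    assert (Q : Rabs (phi x - phi x0) < phi x0).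
    { apply (HC' x); split; [split; [exact I|auto]|].
      simpl; unfold Rdist; apply Rabs_def1; lra. }
    apply Rabs_def2 in Q; lra. }
  unfold plus; simpl; lra.
Qed.

(** * Off-diagonal pairs *)

Definition harmonic (N : nat) : R := rsum (fun k => / pos1 k) N.

Lemma harmonic_ge0 N : 0 <= harmonic N.
Proof. apply rsum_ge0; intros; apply Rlt_le, Rinv_0_lt_compat, pos1_gt0. Qed.

Lemma harmonic_bounds N : ln (pos1 N) <= harmonic N <= 1 + ln (pos1 N).
Proof.
  unfold harmonic; split.
  - replace (ln (pos1 N)) with (rsum (fun k => ln (pos1 (S k)) - ln (pos1 k)) N).
    + apply rsum_le; intros; apply ln_step_bounds.
    + rewrite (rsum_telescope (fun k => ln (pos1 k))); change (pos1 0) with 1; rewrite ln_1; ring.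
  - destruct N as [|N]; [simpl; rewrite ln_1; lra|].
    change (S N) with (1 + N)%nat at 1; rewrite rsum_split.
    replace (rsum (fun k => / pos1 k) 1) with 1 by (simpl; field).
    apply Rplus_le_compat_l.
    apply Rle_trans with (rsum (fun k => ln (pos1 (S k)) - ln (pos1 k)) N).
    + apply rsum_le; intros; apply ln_step_bounds.
    + rewrite (rsum_telescope (fun k => ln (pos1 k))); change (pos1 0) with 1; rewrite ln_1.
      assert (A := ln_step_bounds N); assert (B := Rinv_0_lt_compat _ (pos1_gt0 (S N))); lra.
Qed.

Lemma vanishes_const_ln C : vanishes (fun T => C / ln T).
Proof.
  intros eps He; exists (exp (Rabs C / eps + 1)); intros T HT.
  assert (A : 0 <= Rabs C / eps) by (apply Rmult_le_pos; [apply Rabs_pos|apply Rlt_le, Rinv_0_lt_compat; easy]).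
  assert (L : Rabs C / eps + 1 <= ln T).
  { rewrite <- (ln_exp (Rabs C / eps + 1)); apply ln_le; [apply exp_pos|easy]. }
  unfold Rdiv; rewrite Rabs_mult, Rabs_inv, (Rabs_pos_eq (ln T)) by lra.
  apply Rmult_le_reg_r with (ln T); [lra|].
  rewrite Rmult_assoc, Rinv_l, Rmult_1_r by lra.
  apply Rle_trans with (eps * (Rabs C / eps)); [right; field; lra|].
  apply Rmult_le_compat_l; lra.
Qed.

Lemma ln_ge0 x : 1 <= x -> 0 <= ln x.
Proof. intros; rewrite <- ln_1; apply ln_le; lra. Qed.

Lemma ln_ge1 T : 3 <= T -> 1 <= ln T.
Proof.
  intros H; rewrite <- (ln_exp 1); apply ln_le; [apply exp_pos|].
  assert (A := exp_le_3); lra.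
Qed.

Lemma harmonic_natup c : 0 < c -> exists C, 0 <= C /\
  forall T, 1 <= T -> Rabs (harmonic (natup (c * T)) - ln T) <= C.
Proof.
  intros Hc; exists (1 + Rabs (ln c) + Rabs (ln (c + 2))).
  assert (A1 := Rabs_pos (ln c)); assert (A2 := Rabs_pos (ln (c + 2))).
  split; [lra|]; intros T HT.
  assert (B := natup_spec (c * T) ltac:(nra)); assert (H := harmonic_bounds (natup (c * T))).
  rewrite S_INR in H.
  assert (L1 : ln (c * T) <= ln (INR (natup (c * T)) + 1)) by (apply ln_le; nra).
  assert (L2 : ln (INR (natup (c * T)) + 1) <= ln ((c + 2) * T)) by (apply ln_le; nra).
  rewrite ln_mult in L1, L2 by lra.
  assert (B1 := RRle_abs (ln (c + 2))); assert (B2 := RRle_abs (- ln c)); rewrite Rabs_Ropp in B2.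
  apply Rabs_le; lra.
Qed.

Lemma rsum_ge_term (f : nat -> R) n i :
  (i < n)%nat -> (forall k, (k < n)%nat -> 0 <= f k) -> f i <= rsum f n.
Proof.
  intros Hi H; apply Rle_trans with (rsum f (S i)).
  - simpl; assert (0 <= rsum f i) by (apply rsum_ge0; intros; apply H; lia); lra.
  - apply rsum_le_more; [lia|intros; apply H; lia].
Qed.

(** [min(1, t^{-2})] is at most [5 / (1 + c^2)] for every [c] in [[t, t + 1]], hence at most an
    integral over a unit interval. Sums over shifted integers then telescope, with a bound
    independent of the shift. *)
Lemma inv_sqr_le_atan t : Rmin 1 (/ (t * t)) <= 5 * (atan (t + 1) - atan t).
Proof.
  destruct (MVT_gen atan t (t + 1) (fun x => / (1 + x ^ 2))) as [c [Hc E]].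
  - intros x _; apply is_derive_Reals, derivable_pt_lim_atan.
  - intros x _; apply derivable_continuous_pt; eexists; apply derivable_pt_lim_atan.
  - rewrite Rmin_left, Rmax_right in Hc by lra.
    rewrite E; replace (t + 1 - t) with 1 by ring; rewrite Rmult_1_r.
    assert (P : 0 < 1 + c ^ 2) by (assert (A := pow2_ge_0 c); lra).
    destruct (Rle_dec (t * t) 1) as [L|L].
    + apply Rle_trans with 1; [apply Rmin_l|].
      apply Rmult_le_reg_r with (1 + c ^ 2); [easy|].
      rewrite Rmult_assoc, Rinv_l by lra.
      assert (-1 <= t <= 1) by nra; nra.
    + eapply Rle_trans; [apply Rmin_r|].
      apply Rmult_le_reg_r with (1 + c ^ 2); [easy|].
      rewrite (Rmult_assoc 5), Rinv_l by lra.
      apply Rmult_le_reg_l with (t * t); [lra|].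
      rewrite <- Rmult_assoc, Rinv_r by lra.
      rewrite Rmult_1_l; destruct (Rle_dec 0 t).
      * assert (1 < t) by nra; assert (c * c <= (2 * t) * (2 * t)) by nra; nra.
      * assert (t < -1) by nra; assert (c * c <= t * t) by nra; nra.
Qed.

Lemma rsum_inv_sqr M y : rsum (fun m => Rmin 1 (/ ((pos1 m - y) * (pos1 m - y)))) M <= 20.
Proof.
  apply Rle_trans with (rsum (fun m => 5 * (atan (pos1 (S m) - y) - atan (pos1 m - y))) M).
  - apply rsum_le; intros m _.
    eapply Rle_trans; [apply inv_sqr_le_atan|].
    rewrite (S_INR (S m)); replace (pos1 m + 1 - y) with (pos1 m - y + 1) by ring; lra.
  - rewrite rsum_scal, (rsum_telescope (fun m => atan (pos1 m - y))).
    assert (A := atan_bound (pos1 M - y)); assert (B := atan_bound (pos1 0 - y)).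
    assert (C := PI_4); lra.
Qed.

(** Each [n >= Q] satisfying [P] is charged to the [Q] consecutive indices ending at [n]. These
    blocks are disjoint, and [Q / (n + 1)] is at most the sum of the reciprocals over the block. At
    most one [n] lies below [Q], and it costs the 1. *)
Lemma gapped_harmonic (P : nat -> Prop) (Q N : nat) : (1 <= Q)%nat ->
  (forall n n', P n -> P n' -> (n < n')%nat -> (Q <= n' - n)%nat) ->
  rsum (fun n => if excluded_middle_informative (P n) then / pos1 n else 0) N
  <= 1 + harmonic N / INR Q.
Proof.
  intros HQ HP.
  assert (IQ : 0 < / INR Q) by (apply Rinv_0_lt_compat, lt_0_INR; lia).
  set (f := fun n => if excluded_middle_informative (P n) then / pos1 n else 0).
  assert (F0 : forall n, ~ P n -> f n = 0).
  { intros n Hn; unfold f; destruct (excluded_middle_informative (P n)); easy. }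
  induction N as [N IH] using (well_founded_induction lt_wf).
  destruct N as [|n].
  - unfold harmonic; simpl; unfold Rdiv; lra.
  - destruct (excluded_middle_informative (P n)) as [Hn|Hn].
    + cbn [rsum].
      assert (Fn : f n = / pos1 n) by (unfold f; destruct (excluded_middle_informative (P n)); easy).
      assert (Pn := pos1_ge1 n).
      destruct (Nat.lt_ge_cases n Q) as [L|L].
      * rewrite rsum_zero.
        -- assert (/ pos1 n <= 1) by (rewrite <- Rinv_1; apply Rinv_le_contravar; lra).
           assert (A := Rmult_le_pos _ _ (harmonic_ge0 (S n)) (Rlt_le _ _ IQ)).
           rewrite Fn; unfold Rdiv; lra.
        -- intros k Hk; apply F0; intros Hk'.
           assert (A := HP k n Hk' Hn Hk); lia.
      (* [n0] opens the block of [Q] indices ending at [n]; by the gap condition [f] vanishes on the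
         block except at [n]. *)
      * set (n0 := (S n - Q)%nat).
        assert (E : rsum f n = rsum f n0).
        { replace n with (n0 + (Q - 1))%nat at 1 by (unfold n0; lia).
          rewrite rsum_split, (rsum_zero (fun k => f (n0 + k)%nat)); [ring|].
          intros k Hk; apply F0; intros Hk'.
          assert (A := HP _ n Hk' Hn ltac:(unfold n0; lia)); unfold n0 in A; lia. }
        rewrite E, Fn.
        assert (A := IH n0 ltac:(unfold n0; lia)).
        assert (B : harmonic n0 + INR Q * / pos1 n <= harmonic (S n)).
        { unfold harmonic; replace (S n) with (n0 + Q)%nat at 2 by (unfold n0; lia).
          rewrite rsum_split; apply Rplus_le_compat_l; rewrite <- rsum_const.
          apply rsum_le; intros k Hk; apply Rinv_le_contravar; [apply pos1_gt0|].
          apply le_INR; unfold n0; lia. }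
        assert (HQ' : 0 < INR Q) by (apply lt_0_INR; lia).
        apply Rle_trans with (1 + (harmonic n0 + INR Q * / pos1 n) / INR Q).
        -- replace ((harmonic n0 + INR Q * / pos1 n) / INR Q) with (harmonic n0 / INR Q + / pos1 n) by (field; lra).
           lra.
        -- apply Rplus_le_compat_l, Rmult_le_compat_r; lra.
    + cbn [rsum]; rewrite (F0 n Hn).
      assert (A := IH n ltac:(lia)).
      assert (B : harmonic n <= harmonic (S n)).
      { apply rsum_le_more; [lia|]; intros; apply Rlt_le, Rinv_0_lt_compat, pos1_gt0. }
      assert (harmonic n / INR Q <= harmonic (S n) / INR Q) by (apply Rmult_le_compat_r; lra).
      lra.
Qed.

(** * Sparsity of the pairs with [m] close to [xn] *)

Lemma far_from_integers y : (forall p : Z, y <> IZR p) ->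
  exists d, 0 < d /\ forall p : Z, d <= Rabs (y - IZR p).
Proof.
  intros H; destruct (archimed y) as [A1 A2].
  assert (A4 := H (up y - 1)%Z); rewrite minus_IZR in A4.
  exists (Rmin (IZR (up y) - y) (y - (IZR (up y) - 1))); split.
  - apply Rmin_pos; lra.
  - intros p; destruct (Z.lt_ge_cases p (up y)) as [L|L].
    + eapply Rle_trans; [apply Rmin_r|].
      assert (IZR p <= IZR (up y) - 1) by (rewrite <- minus_IZR; apply IZR_le; lia).
      eapply Rle_trans; [|apply RRle_abs]; lra.
    + eapply Rle_trans; [apply Rmin_l|].
      apply IZR_le in L.
      rewrite <- Rabs_Ropp; eapply Rle_trans; [|apply RRle_abs]; lra.
Qed.

(** Finitely many multiples are involved, so the least of their distances to the integers is
    positive; no rate in [Q] is claimed. *)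
Lemma irrational_multiples_far x : ~ is_rational x -> forall Q : nat,
  exists d, 0 < d /\ forall q, (1 <= q < Q)%nat -> forall p : Z, d <= Rabs (INR q * x - IZR p).
Proof.
  intros Hx Q; induction Q as [|Q [d [Hd IH]]].
  - exists 1; split; [lra|]; intros; lia.
  - destruct Q as [|Q].
    + exists 1; split; [lra|]; intros; lia.
    + destruct (far_from_integers (INR (S Q) * x)) as [d' [Hd' H']].
      * intros p E; apply Hx; exists p, (Z.of_nat (S Q)); split; [lia|].
        rewrite <- INR_IZR_INZ, <- E; field; apply Rgt_not_eq, pos1_gt0.
      * exists (Rmin d d'); split; [now apply Rmin_pos|]; intros q Hq p.
        destruct (Nat.eq_dec q (S Q)) as [->|Ne].
        -- eapply Rle_trans; [apply Rmin_r|apply H'].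
        -- eapply Rle_trans; [apply Rmin_l|apply IH; lia].
Qed.

Definition near (x eta : R) (n m : nat) : Prop := 0 < Rabs (pos1 m - x * pos1 n) < eta.

(** For irrational [x], near pairs with [0 < n' - n < Q] would put [(n' - n) x] within [2 eta] of an
    integer; so the [n] that occur are [Q]-separated, and [eta <= 1/2] leaves at most one [m] for
    each. For rational [x] of denominator [q], [|m - xn|] is zero or at least [1/|q|], so a small
    [eta] admits no near pair. *)
Lemma near_pairs_sparse x (Q : nat) : (1 <= Q)%nat ->
  exists eta, 0 < eta <= / 2 /\ forall N,
    rsum (fun n => / pos1 n *
      rsum (fun m => if excluded_middle_informative (near x eta n m) then 1 else 0) N) N
    <= 1 + harmonic N / INR Q.
Proof.
  intros HQ.
  assert (HN : forall N, 0 <= harmonic N / INR Q).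
  { intros N; apply Rmult_le_pos; [apply harmonic_ge0|].
    apply Rlt_le, Rinv_0_lt_compat, lt_0_INR; lia. }
  destruct (classic (is_rational x)) as [[p [q [Hq E]]]|Hx].
  - assert (Aq : 1 <= Rabs (IZR q)).
    { rewrite <- abs_IZR; apply IZR_le; lia. }
    assert (Iq : 0 < / Rabs (IZR q)) by (apply Rinv_0_lt_compat; lra).
    assert (Hq' : IZR q <> 0) by (apply not_0_IZR; easy).
    exists (Rmin (/ 2) (/ Rabs (IZR q))); split; [split; [apply Rmin_pos; lra|apply Rmin_l]|].
    intros N; rewrite rsum_zero; [specialize (HN N); lra|].
    intros n _; rewrite rsum_zero; [ring|].
    intros m _; destruct (excluded_middle_informative _) as [[H1 H2]|]; [exfalso|easy].
    assert (H3 : Rabs (pos1 m - x * pos1 n) < / Rabs (IZR q)) by (eapply Rlt_le_trans; [exact H2|apply Rmin_r]).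
    replace (pos1 m - x * pos1 n) with (IZR (Z.of_nat (S m) * q - p * Z.of_nat (S n)) * / IZR q) in *.
    2: { rewrite minus_IZR, !mult_IZR, <- !INR_IZR_INZ, E; field; easy. }
    set (z := (Z.of_nat (S m) * q - p * Z.of_nat (S n))%Z) in *.
    rewrite Rabs_mult, Rabs_inv in *.
    assert (H4 : Rabs (IZR z) < 1) by (apply Rmult_lt_reg_r with (/ Rabs (IZR q)); lra).
    assert (H5 : 0 < Rabs (IZR z)).
    { destruct (Rle_lt_or_eq_dec 0 (Rabs (IZR z)) (Rabs_pos _)) as [|E0]; [easy|].
      rewrite <- E0 in H1; lra. }
    rewrite <- abs_IZR in H4, H5; apply lt_IZR in H4, H5; lia.
  - destruct (irrational_multiples_far x Hx Q) as [d [Hd Hfar]].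
    exists (Rmin (/ 2) (d / 2)); split; [split; [apply Rmin_pos; lra|apply Rmin_l]|].
    set (eta := Rmin _ _).
    assert (E1 : eta <= / 2) by apply Rmin_l; assert (E2 : eta <= d / 2) by apply Rmin_r.
    set (P := fun n => exists m, near x eta n m).
    intros N.
    eapply Rle_trans; [|apply (gapped_harmonic P Q N HQ)].
    + apply rsum_le; intros n _.
      destruct (excluded_middle_informative (P n)) as [[m Hm]|Hn].
      * rewrite <- (Rmult_1_r (/ pos1 n)) at 2.
        apply Rmult_le_compat_l; [apply Rlt_le, Rinv_0_lt_compat, pos1_gt0|].
        assert (Hz : forall k, k <> m -> (if excluded_middle_informative (near x eta n k) then 1 else 0) = 0).
        { intros k Hk; destruct (excluded_middle_informative (near x eta n k)) as [Hk'|]; [exfalso|easy].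
          destruct Hk' as [_ Hk']; destruct Hm as [_ Hm].
          assert (A : Rabs (pos1 k - pos1 m) < 1).
          { apply Rabs_def2 in Hk', Hm; apply Rabs_def1; lra. }
          rewrite !INR_IZR_INZ, <- minus_IZR, <- abs_IZR in A; apply lt_IZR in A; lia. }
        destruct (Nat.lt_ge_cases m N) as [L|L].
        -- rewrite (rsum_single _ N m L) by (intros; auto).
           destruct (excluded_middle_informative _); lra.
        -- rewrite rsum_zero; [lra|]; intros; apply Hz; lia.
      * rewrite rsum_zero; [lra|]; intros m _.
        destruct (excluded_middle_informative _) as [Hm|]; [exfalso; apply Hn; now exists m|easy].
    + intros n n' [m [_ Hm]] [m' [_ Hm']] L.
      destruct (Nat.lt_ge_cases (n' - n) Q) as [LQ|]; [exfalso|easy].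
      assert (A := Hfar (n' - n)%nat ltac:(lia) (Z.of_nat (S m') - Z.of_nat (S m))%Z).
      rewrite minus_IZR, <- !INR_IZR_INZ, minus_INR in A by lia.
      assert (B : Rabs ((INR n' - INR n) * x - (pos1 m' - pos1 m)) < d).
      { rewrite (S_INR n) in Hm; rewrite (S_INR n') in Hm'.
        apply Rabs_def2 in Hm, Hm'; apply Rabs_def1; lra. }
      lra.
Qed.

(** [2 - 2 cos d = 4 sin^2(d/2)] and [|sin(d/2)| >= |d|/8]; where [|d|/2] exceeds 1, monotonicity of
    the sine up to [pi/2] replaces the bound [sin t >= t/2]. *)
Lemma one_sub_cos_lower d : Rabs d <= PI -> d * d / 16 <= 2 - 2 * cos d.
Proof.
  intros Hd.
  assert (Q := PI2_3_2); assert (Q4 := PI_4).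
  assert (J : forall t, 0 <= t <= PI -> t / 8 <= sin (t / 2)).
  { intros t Ht; destruct (Rle_dec (t / 2) 1) as [L|L].
    - assert (A := sin_ge_half (t / 2) ltac:(lra)); lra.
    - assert (A := sin_ge_half 1 ltac:(lra)).
      assert (sin 1 <= sin (t / 2)) by (apply sin_incr_1; lra); lra. }
  assert (A := J (Rabs d) (conj (Rabs_pos d) Hd)).
  assert (E := cos_2a_sin (Rabs d / 2)).
  replace (2 * (Rabs d / 2)) with (Rabs d) in E by field.
  replace (cos d) with (cos (Rabs d)).
  2: { unfold Rabs; destruct (Rcase_abs d); [apply cos_neg|easy]. }
  replace (d * d) with (Rabs d * Rabs d) by (rewrite <- Rabs_mult; apply Rabs_pos_eq, Rle_0_sqr).
  assert (B := Rabs_pos d); nra.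
Qed.

(** From [1 - 1/x <= ln x <= x - 1]. For [m > y] the natural denominator is [m], and [E] converts it
    into [y]. *)
Lemma ln_ratio_lower m y E : 0 < m -> 0 < y -> 1 <= E -> m <= E * y ->
  Rabs (m - y) / (E * y) <= Rabs (ln m - ln y).
Proof.
  intros Hm Hy HE Hle.
  rewrite <- ln_div by easy.
  destruct (Rle_dec y m) as [L|L].
  - rewrite Rabs_pos_eq by lra.
    eapply Rle_trans; [|apply RRle_abs].
    eapply Rle_trans; [|apply ln_ge_1sub, Rdiv_lt_0_compat; easy].
    replace (1 - / (m / y)) with ((m - y) * / m) by (field; lra).
    apply Rmult_le_compat_l; [lra|]; apply Rinv_le_contravar; lra.
  - rewrite Rabs_left by lra.
    rewrite <- Rabs_Ropp; eapply Rle_trans; [|apply RRle_abs].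
    assert (A := ln_le_sub1 (m / y) ltac:(apply Rdiv_lt_0_compat; easy)).
    apply Rle_trans with ((y - m) * / y).
    + replace (- (m - y)) with (y - m) by ring.
      apply Rmult_le_compat_l; [lra|]; apply Rinv_le_contravar; nra.
    + replace ((y - m) * / y) with (- (m / y - 1)) by (field; lra); lra.
Qed.

(** * The off-diagonal sum, arranged by the nearest [k] *)

Definition ldiff (m n : nat) : R := ln (pos1 m) - ln (pos1 n).

Definition wt (m n : nat) : R := / (sqrt (pos1 m) * sqrt (pos1 n)).

Lemma wt_pos m n : 0 < wt m n.
Proof. apply Rinv_0_lt_compat, Rmult_lt_0_compat; apply sqrt_lt_R0, pos1_gt0. Qed.

Lemma wt_sym m n : wt m n = wt n m.
Proof. unfold wt; rewrite Rmult_comm; reflexivity. Qed.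

Definition osc_ker (T th : R) : R := Rmin 1 (/ (T * T * (2 - 2 * cos th))).

(** Resonant pairs, for which [a log(m/n)] is a multiple of [2 pi], are set to zero here and left to
    [diag_entry]. *)
Definition off_entry (a T : R) (m n : nat) : R :=
  if Req_EM_T (cos (a * ldiff m n)) 1 then 0 else wt m n * osc_ker T (a * ldiff m n).

Definition rsum2 (f : nat -> nat -> R) (N : nat) : R := rsum (fun m => rsum (fun n => f m n) N) N.

Lemma rsum2_swap f N : rsum2 f N = rsum2 (fun m n => f n m) N.
Proof. apply rsum_swap. Qed.

Lemma rsum2_single (f : nat -> nat -> R) N m0 n0 : (m0 < N)%nat -> (n0 < N)%nat ->
  (forall m n, (m < N)%nat -> (n < N)%nat -> ~ (m = m0 /\ n = n0) -> f m n = 0) ->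
  rsum2 f N = f m0 n0.
Proof.
  intros Hm Hn H; unfold rsum2; rewrite (rsum_single _ N m0 Hm).
  - apply rsum_single; [easy|]; intros; apply H; tauto.
  - intros m Hm' Hne; apply rsum_zero; intros; apply H; tauto.
Qed.

Lemma rsum2_rsum (f : nat -> nat -> nat -> R) N K :
  rsum2 (fun m n => rsum (fun k => f k m n) K) N = rsum (fun k => rsum2 (f k) N) K.
Proof.
  unfold rsum2.
  rewrite (rsum_ext _ (fun m => rsum (fun k => rsum (fun n => f k m n) N) K)) by (intros; apply rsum_swap).
  apply rsum_swap.
Qed.

Lemma rsum2_plus (f g : nat -> nat -> R) N :
  rsum2 (fun m n => f m n + g m n) N = rsum2 f N + rsum2 g N.
Proof. unfold rsum2; rewrite <- rsum_plus; apply rsum_ext; intros; apply rsum_plus. Qed.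

Lemma rsum2_minus (f g : nat -> nat -> R) N :
  rsum2 (fun m n => f m n - g m n) N = rsum2 f N - rsum2 g N.
Proof. unfold rsum2; rewrite <- rsum_minus; apply rsum_ext; intros; apply rsum_minus. Qed.

Lemma rsum2_ext (f g : nat -> nat -> R) N :
  (forall m n, (m < N)%nat -> (n < N)%nat -> f m n = g m n) -> rsum2 f N = rsum2 g N.
Proof. intros H; apply rsum_ext; intros; apply rsum_ext; auto. Qed.

Lemma rsum2_scal c (f : nat -> nat -> R) N : rsum2 (fun m n => c * f m n) N = c * rsum2 f N.
Proof. unfold rsum2; rewrite <- rsum_scal; apply rsum_ext; intros; apply rsum_scal. Qed.

Lemma rsum2_le (f g : nat -> nat -> R) N :
  (forall m n, f m n <= g m n) -> rsum2 f N <= rsum2 g N.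
Proof. intros H; apply rsum_le; intros; apply rsum_le; auto. Qed.

Lemma rsum2_abs (f : nat -> nat -> R) N : Rabs (rsum2 f N) <= rsum2 (fun m n => Rabs (f m n)) N.
Proof.
  unfold rsum2; eapply Rle_trans; [apply rsum_abs|]; apply rsum_le; intros; apply rsum_abs.
Qed.

Definition scale_pt (a : R) (k : nat) : R := exp (2 * PI * INR k / a).

(* Majorant of [off_entry a T m n] when [k] is the integer nearest to
   [a * ldiff m n / (2 PI)]; then [pos1 m] is comparable to [scale_pt a k * pos1 n]. *)
Definition maj (a Y T : R) (k m n : nat) : R :=
  let y := scale_pt a k * pos1 n in
  if excluded_middle_informative (y <= Y * T /\ pos1 m <> y) then
    exp (PI / a) * exp (- (PI / a)) ^ k / pos1 n *
    Rmin 1 (16 * (exp (PI / a) / a) ^ 2 * ((y / T) * (y / T)) / ((pos1 m - y) * (pos1 m - y)))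
  else 0.

Lemma Rmin1_pos x : 0 < x -> 0 < Rmin 1 x.
Proof. intros; apply Rmin_pos; lra. Qed.

Lemma Rmult_self_pos x : x <> 0 -> 0 < x * x.
Proof. intros H; apply (Rsqr_pos_lt x H). Qed.

Lemma scale_pt_pos a k : 0 < scale_pt a k.
Proof. apply exp_pos. Qed.

(** Thus [exp(-pi/a)^k] is [x^{-1/2}] for [x = scale_pt a k], the source of geometric decay in
    [k]. *)
Lemma scale_pt_pow a k : 0 < a ->
  exp (- (PI / a)) ^ k * exp (- (PI / a)) ^ k * scale_pt a k = 1.
Proof.
  intros Ha; unfold scale_pt.
  rewrite <- !Rpower_pow by apply exp_pos.
  unfold Rpower; rewrite ?ln_exp, <- ?exp_plus.
  match goal with |- exp ?e = 1 => replace e with 0 by (field; lra) end; apply exp_0.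
Qed.

Lemma maj_ge0 a Y T k m n : 0 < a -> 0 < T -> 0 <= maj a Y T k m n.
Proof.
  intros Ha HT; unfold maj; destruct (excluded_middle_informative _) as [[_ Hne]|]; [|lra].
  assert (P := pos1_gt0 n); assert (S := scale_pt_pos a k).
  assert (0 < scale_pt a k * pos1 n / T) by (apply Rdiv_lt_0_compat; [apply Rmult_lt_0_compat|]; easy).
  assert (0 < exp (PI / a) / a) by (apply Rdiv_lt_0_compat; [apply exp_pos|easy]).
  apply Rmult_le_pos.
  - apply Rlt_le, Rdiv_lt_0_compat; [apply Rmult_lt_0_compat; [|apply pow_lt]; apply exp_pos|easy].
  - apply Rlt_le, Rmin1_pos, Rdiv_lt_0_compat; [|apply Rmult_self_pos; lra].
    apply Rmult_lt_0_compat; [|now apply Rmult_lt_0_compat].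
    apply Rmult_lt_0_compat; [lra|]; apply pow_lt; easy.
Qed.

Lemma nearest_nat y : 0 <= y -> exists k : nat, Rabs (y - INR k) <= / 2.
Proof.
  intros Hy; assert (A := natup_spec (y + / 2) ltac:(lra)).
  destruct (natup (y + / 2)) as [|k]; [simpl in A; lra|].
  rewrite S_INR in A; exists k; apply Rabs_le; lra.
Qed.

Lemma exp_mono x y : x <= y -> exp x <= exp y.
Proof. intros [H|H]; [apply Rlt_le, exp_increasing; easy|subst; lra]. Qed.

Lemma exp_ge1 x : 0 <= x -> 1 <= exp x.
Proof. intros; assert (A := exp_ineq1_le x); lra. Qed.

(** Take [k] nearest to [a log(m/n) / (2 pi)] and [y = xn]; then [d = a ln(m/y)] lies in
    [[-pi, pi]]. So [m] and [y] agree up to the factor [E = e^{pi/a}], which bounds the weight by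
    [E x^{-1/2} / n], and [|1 - e^{id}|] is at least a constant times [|d|], hence a constant times
    [|m - y| / y]. *)
Lemma off_entry_le_maj a c T m n : 0 < a -> 0 < T -> pos1 m <= c * T -> 0 <= ldiff m n ->
  cos (a * ldiff m n) <> 1 ->
  exists k, INR k <= a * ldiff m n + 1 /\
    wt m n * osc_ker T (a * ldiff m n) <= maj a (exp (PI / a) * c) T k m n.
Proof.
  intros Ha HT Hm HL Hcos.
  assert (HPI := PI2_3_2).
  destruct (nearest_nat (a * ldiff m n / (2 * PI))) as [k Hk].
  { apply Rmult_le_pos; [nra|]; apply Rlt_le, Rinv_0_lt_compat; lra. }
  exists k; split.
  { apply Rabs_le_between in Hk.
    assert (a * ldiff m n / (2 * PI) <= a * ldiff m n).
    { rewrite <- (Rmult_1_r (a * ldiff m n)) at 2; apply Rmult_le_compat_l; [nra|].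
      rewrite <- Rinv_1; apply Rinv_le_contravar; lra. }
    lra. }
  set (x := scale_pt a k); set (y := x * pos1 n).
  assert (Px : 0 < x) by apply scale_pt_pos.
  assert (Pn := pos1_gt0 n); assert (Pm := pos1_gt0 m).
  assert (Py : 0 < y) by (now apply Rmult_lt_0_compat).
  assert (Ly : ln y = 2 * PI * INR k / a + ln (pos1 n)).
  { unfold y, x, scale_pt; rewrite ln_mult, ln_exp; [easy|apply exp_pos|easy]. }
  set (d := a * (ln (pos1 m) - ln y)).
  assert (Ed : d = a * ldiff m n - 2 * PI * INR k) by (unfold d, ldiff; rewrite Ly; field; lra).
  assert (Hd : Rabs d <= PI).
  { replace d with (2 * PI * (a * ldiff m n / (2 * PI) - INR k)) by (rewrite Ed; field; lra).
    rewrite Rabs_mult, (Rabs_pos_eq (2 * PI)) by lra; nra. }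
  assert (Hcd : cos (a * ldiff m n) = cos d).
  { rewrite <- (cos_period d k); f_equal; rewrite Ed; ring. }
  assert (Hmy : pos1 m <> y).
  { intros E; apply Hcos; rewrite Hcd; unfold d; rewrite E, Rminus_diag, Rmult_0_r; apply cos_0. }
  set (E := exp (PI / a)).
  assert (HE : 1 <= E) by (apply exp_ge1, Rmult_le_pos; [lra|apply Rlt_le, Rinv_0_lt_compat; easy]).
  assert (Hl : Rabs (ln (pos1 m) - ln y) <= PI / a).
  { apply Rmult_le_reg_l with a; [easy|].
    replace (a * (PI / a)) with PI by (field; lra).
    rewrite <- (Rabs_pos_eq a) at 1 by lra; rewrite <- Rabs_mult; exact Hd. }
  apply Rabs_le_between in Hl.
  assert (H1 : pos1 m <= E * y).
  { rewrite <- (exp_ln (pos1 m)), <- (exp_ln y) by easy; unfold E; rewrite <- exp_plus.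
    apply exp_mono; lra. }
  assert (H2 : y <= E * pos1 m).
  { rewrite <- (exp_ln (pos1 m)), <- (exp_ln y) by easy; unfold E; rewrite <- exp_plus.
    apply exp_mono; lra. }
  unfold maj; fold x; fold y; fold E.
  destruct (excluded_middle_informative _) as [_|Hno].
  2: { exfalso; apply Hno; split; [|easy]; nra. }
  set (R := exp (- (PI / a)) ^ k).
  assert (HR : 0 < R) by (apply pow_lt, exp_pos).
  assert (HRx : R * R * x = 1) by (apply scale_pt_pow; easy).
  assert (Sm := sqrt_lt_R0 _ Pm); assert (Sn := sqrt_lt_R0 _ Pn).
  assert (Qm := sqrt_sqrt _ (Rlt_le _ _ Pm)); assert (Qn := sqrt_sqrt _ (Rlt_le _ _ Pn)).
  apply Rmult_le_compat.
  - apply Rlt_le, wt_pos.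
  - apply Rlt_le, Rmin1_pos, Rinv_0_lt_compat, Rmult_lt_0_compat; [nra|].
    assert (A := COS_bound (a * ldiff m n)); lra.
  (* Since [R^2 x = 1], the number [n] is [R^2 y], which is at most [E R^2 m]. *)
  - assert (K : sqrt (pos1 n) <= E * R * sqrt (pos1 m)).
    { apply Rsqr_incr_0; [|lra|repeat apply Rmult_le_pos; lra].
      unfold Rsqr; rewrite Qn.
      replace (E * R * sqrt (pos1 m) * (E * R * sqrt (pos1 m)))
        with (E * (R * R) * (E * (sqrt (pos1 m) * sqrt (pos1 m)))) by ring.
      rewrite Qm.
      apply Rle_trans with (E * (R * R) * y).
      - replace (E * (R * R) * y) with (E * (R * R * x) * pos1 n) by (unfold y; ring).
        rewrite HRx; nra.
      - apply Rmult_le_compat_l; [repeat apply Rmult_le_pos; lra|easy]. }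
    unfold wt; set (sn := sqrt (pos1 n)) in *; set (sm := sqrt (pos1 m)) in *; rewrite <- Qn.
    apply Rmult_le_reg_r with (sm * (sn * sn)); [repeat apply Rmult_lt_0_compat; easy|].
    replace (/ (sm * sn) * (sm * (sn * sn))) with sn by (field; lra).
    replace (E * R / (sn * sn) * (sm * (sn * sn))) with (E * R * sm) by (field; lra).
    exact K.
  - unfold osc_ker; rewrite Hcd.
    apply Rle_min_compat_l.
    assert (L := ln_ratio_lower (pos1 m) y E Pm Py HE H1).
    assert (C := one_sub_cos_lower d Hd).
    assert (Ns : 0 < (pos1 m - y) * (pos1 m - y)) by (apply Rmult_self_pos; lra).
    set (l := Rabs (ln (pos1 m) - ln y)) in *.
    assert (D2 : d * d = a * a * (l * l)).
    { unfold l, d; rewrite <- Rabs_mult, Rabs_pos_eq by apply Rle_0_sqr; ring. }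
    assert (Eyp : 0 < E * y) by (apply Rmult_lt_0_compat; lra).
    assert (L2 : (pos1 m - y) * (pos1 m - y) / ((E * y) * (E * y)) <= l * l).
    { replace ((pos1 m - y) * (pos1 m - y)) with (Rabs (pos1 m - y) * Rabs (pos1 m - y))
        by (rewrite <- Rabs_mult; apply Rabs_pos_eq, Rle_0_sqr).
      replace (Rabs (pos1 m - y) * Rabs (pos1 m - y) / (E * y * (E * y)))
        with ((Rabs (pos1 m - y) / (E * y)) * (Rabs (pos1 m - y) / (E * y))) by (field; lra).
      assert (0 <= Rabs (pos1 m - y) / (E * y))
        by (apply Rmult_le_pos; [apply Rabs_pos|apply Rlt_le, Rinv_0_lt_compat; easy]).
      apply Rmult_le_compat; easy. }
    replace (16 * (E / a) ^ 2 * (y / T * (y / T)) / ((pos1 m - y) * (pos1 m - y)))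
      with (/ (T * T * (a * a * ((pos1 m - y) * (pos1 m - y) / ((E * y) * (E * y))) / 16))).
    2: { field; repeat split; lra. }
    apply Rinv_le_contravar.
    + apply Rmult_lt_0_compat; [nra|].
      apply Rdiv_lt_0_compat; [|lra].
      apply Rmult_lt_0_compat; [nra|].
      apply Rdiv_lt_0_compat; [easy|now apply Rmult_lt_0_compat].
    + apply Rmult_le_compat_l; [nra|].
      eapply Rle_trans; [|exact C]; rewrite D2.
      apply Rmult_le_compat_r; [lra|]; apply Rmult_le_compat_l; [nra|easy].
Qed.

Lemma Rmin1_scale A t : 0 <= A -> 0 < t -> Rmin 1 (A / t) <= (A + 1) * Rmin 1 (/ t).
Proof.
  intros HA Ht; assert (0 < / t) by (now apply Rinv_0_lt_compat).
  unfold Rmin at 2; destruct (Rle_dec 1 (/ t)).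
  - eapply Rle_trans; [apply Rmin_l|lra].
  - eapply Rle_trans; [apply Rmin_r|unfold Rdiv; nra].
Qed.

(** For fixed [n] the sum over [m] is bounded, the [m] being spaced by 1 around [y]; summing the
    weights over [n] leaves [harmonic N]. The constant depends on neither [k] nor [T], as the
    domination over [k] requires. *)
Lemma maj_sum_bound a Y : 0 < a -> 0 <= Y -> exists C, 0 <= C /\ forall T k N, 0 < T ->
  rsum2 (maj a Y T k) N <= C * exp (- (PI / a)) ^ k * harmonic N.
Proof.
  intros Ha HY.
  set (E := exp (PI / a)); set (C2 := 16 * (E / a) ^ 2).
  assert (HE : 0 < E) by apply exp_pos.
  assert (HC2 : 0 <= C2) by (apply Rmult_le_pos; [lra|apply pow2_ge_0]).
  assert (HK : 0 <= C2 * (Y * Y)) by (apply Rmult_le_pos; [easy|nra]).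
  exists (E * ((C2 * (Y * Y) + 1) * 20)); split; [apply Rmult_le_pos; lra|].
  intros T k N HT; rewrite rsum2_swap; unfold rsum2, harmonic.
  rewrite <- rsum_scal; apply rsum_le; intros n _.
  set (y := scale_pt a k * pos1 n); set (R := exp (- (PI / a)) ^ k).
  assert (HR : 0 < R) by (apply pow_lt, exp_pos).
  assert (Pn := Rinv_0_lt_compat _ (pos1_gt0 n)).
  assert (Hc : 0 <= E * R / pos1 n) by (apply Rmult_le_pos; nra).
  assert (Py : 0 < y) by (apply Rmult_lt_0_compat; [apply exp_pos|apply pos1_gt0]).
  assert (IT : 0 < / T) by (now apply Rinv_0_lt_compat).
  apply Rle_trans with (rsum (fun m => E * R / pos1 n * (C2 * (Y * Y) + 1) *
     Rmin 1 (/ ((pos1 m - y) * (pos1 m - y)))) N).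
  - apply rsum_le; intros m _; unfold maj; fold y; fold E; fold C2; fold R.
    assert (Hz : 0 <= Rmin 1 (/ ((pos1 m - y) * (pos1 m - y)))).
    { destruct (Req_dec (pos1 m - y) 0) as [Z|Z].
      - rewrite Z, Rmult_0_l, Rinv_0; unfold Rmin; destruct (Rle_dec 1 0); lra.
      - apply Rlt_le, Rmin1_pos, Rinv_0_lt_compat, Rmult_self_pos; easy. }
    destruct (excluded_middle_informative _) as [[Hy Hne]|_].
    + rewrite Rmult_assoc; apply Rmult_le_compat_l; [easy|].
      assert (Nz : 0 < (pos1 m - y) * (pos1 m - y)) by (apply Rmult_self_pos; lra).
      assert (B : C2 * (y / T * (y / T)) <= C2 * (Y * Y)).
      { apply Rmult_le_compat_l; [easy|].
        assert (0 < y / T) by (apply Rdiv_lt_0_compat; easy).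
        assert (y / T <= Y).
        { apply Rmult_le_reg_r with T; [easy|]; unfold Rdiv; rewrite Rmult_assoc, Rinv_l by lra; lra. }
        apply Rmult_le_compat; lra. }
      eapply Rle_trans; [|apply Rmin1_scale; easy].
      apply Rle_min_compat_l, Rmult_le_compat_r; [apply Rlt_le, Rinv_0_lt_compat; easy|easy].
    + apply Rmult_le_pos; [apply Rmult_le_pos; lra|easy].
  - rewrite rsum_scal.
    assert (A := rsum_inv_sqr N y).
    apply Rle_trans with (E * R / pos1 n * (C2 * (Y * Y) + 1) * 20).
    + apply Rmult_le_compat_l; [apply Rmult_le_pos; lra|easy].
    + right; unfold Rdiv; ring.
Qed.

(** Near pairs have kernel at most 1 and are counted by [near_pairs_sparse]. For the others, one
    factor [y / T] is bounded by [Y] and the other is kept: as [y = xn], it cancels the weight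
    [1/n], so each [n] contributes [O(1/T)] and all of them [O(1)]. *)
Lemma maj_sum_sparse a Y c (k Q : nat) : 0 < a -> 0 <= Y -> 0 < c -> (1 <= Q)%nat ->
  exists C, forall T, 1 <= T ->
  rsum2 (maj a Y T k) (natup (c * T)) <= C + exp (PI / a) * (harmonic (natup (c * T)) / INR Q).
Proof.
  intros Ha HY Hc HQ.
  set (x := scale_pt a k).
  assert (Hx : 0 < x) by apply exp_pos.
  destruct (near_pairs_sparse x Q HQ) as [eta [Heta Hnear]].
  set (E := exp (PI / a)); set (C2 := 16 * (E / a) ^ 2).
  assert (HE : 0 < E) by apply exp_pos.
  assert (HC2 : 0 <= C2) by (apply Rmult_le_pos; [lra|apply pow2_ge_0]).
  set (D := C2 * (Y * x) * / (eta * eta) * 20).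
  assert (HD : 0 <= D).
  { unfold D; repeat apply Rmult_le_pos; try lra; apply Rlt_le, Rinv_0_lt_compat; nra. }
  exists (E * (1 + D * (c + 1))); intros T HT.
  set (N := natup (c * T)).
  assert (HN : INR N <= (c + 1) * T) by (assert (A := natup_spec (c * T) ltac:(nra)); fold N in A; lra).
  assert (IT : 0 < / T) by (apply Rinv_0_lt_compat; lra).
  set (R := exp (- (PI / a)) ^ k).
  assert (HR : 0 < R <= 1).
  { split; [apply pow_lt, exp_pos|].
    assert (A := scale_pt_pow a k Ha); fold R in A; fold x in A.
    assert (1 <= x).
    { apply exp_ge1; apply Rmult_le_pos; [|apply Rlt_le, Rinv_0_lt_compat; easy].
      assert (B := pos_INR k); assert (B' := PI2_3_2); nra. }
    assert (0 < R) by (apply pow_lt, exp_pos).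
    nra. }
  rewrite rsum2_swap.
  apply Rle_trans with (E * (rsum (fun n => / pos1 n *
      rsum (fun m => if excluded_middle_informative (near x eta n m) then 1 else 0) N) N
      + rsum (fun _ => D * / T) N)).
  - rewrite <- rsum_plus, <- rsum_scal; apply rsum_le; intros n _.
    set (y := x * pos1 n).
    assert (Pn := pos1_gt0 n); assert (Pn' := Rinv_0_lt_compat _ Pn).
    assert (Py : 0 < y) by (now apply Rmult_lt_0_compat).
    assert (Hz : forall m, 0 <= Rmin 1 (/ ((pos1 m - y) * (pos1 m - y)))).
    { intros m; destruct (Req_dec (pos1 m - y) 0) as [Z|Z].
      - rewrite Z, Rmult_0_l, Rinv_0; unfold Rmin; destruct (Rle_dec 1 0); lra.
      - apply Rlt_le, Rmin1_pos, Rinv_0_lt_compat, Rmult_self_pos; easy. }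
    set (G := C2 * (Y * (y / T)) * / (eta * eta)).
    assert (HG : 0 <= G).
    { unfold G; repeat apply Rmult_le_pos; try lra; apply Rlt_le, Rinv_0_lt_compat; nra. }
    apply Rle_trans with (rsum (fun m => E / pos1 n *
       ((if excluded_middle_informative (near x eta n m) then 1 else 0) +
        G * Rmin 1 (/ ((pos1 m - y) * (pos1 m - y))))) N).
    + apply rsum_le; intros m _; specialize (Hz m).
      unfold maj; fold x; fold y; fold E; fold C2; fold R.
      assert (I0 : 0 <= (if excluded_middle_informative (near x eta n m) then 1 else 0))
        by (destruct (excluded_middle_informative _); lra).
      destruct (excluded_middle_informative (y <= Y * T /\ pos1 m <> y)) as [[Hy Hne]|_].
      2: { apply Rmult_le_pos; [apply Rmult_le_pos; lra|]; assert (A := Rmult_le_pos _ _ HG Hz); lra. }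
      assert (Nz : 0 < (pos1 m - y) * (pos1 m - y)) by (apply Rmult_self_pos; lra).
      assert (Hp : 0 < y / T) by (apply Rdiv_lt_0_compat; lra).
      assert (HyT : y / T <= Y).
      { apply Rmult_le_reg_r with T; [lra|]; unfold Rdiv; rewrite Rmult_assoc, Rinv_l by lra; lra. }
      assert (Hq : 0 <= C2 * (y / T * (y / T))) by (apply Rmult_le_pos; nra).
      apply Rmult_le_compat.
      * apply Rmult_le_pos; nra.
      * apply Rmin_glb; [lra|]; apply Rmult_le_pos; [easy|apply Rlt_le, Rinv_0_lt_compat; easy].
      * apply Rmult_le_compat_r; [lra|]; nra.
      * destruct (excluded_middle_informative (near x eta n m)) as [_|Hfar].
        { assert (A := Rmin_l 1 (C2 * (y / T * (y / T)) / ((pos1 m - y) * (pos1 m - y)))).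
          assert (B := Rmult_le_pos _ _ HG Hz); lra. }
        rewrite Rplus_0_l.
        eapply Rle_trans; [apply Rmin_r|].
        assert (Heta2 : eta * eta <= (pos1 m - y) * (pos1 m - y)).
        { assert (A : eta <= Rabs (pos1 m - y)).
          { apply Rnot_lt_le; intros L; apply Hfar; split; [apply Rabs_pos_lt; fold y; lra|exact L]. }
          replace ((pos1 m - y) * (pos1 m - y)) with (Rabs (pos1 m - y) * Rabs (pos1 m - y))
            by (rewrite <- Rabs_mult; apply Rabs_pos_eq, Rle_0_sqr).
          apply Rmult_le_compat; lra. }
        assert (He2 : 0 < eta * eta) by nra.
        set (q := (pos1 m - y) * (pos1 m - y)) in *.
        (* As [q >= eta^2], [1/q] can be traded for its truncation at 1, whose sum over [m] is
           bounded uniformly in [y]. *)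
        assert (K : / q <= / (eta * eta) * Rmin 1 (/ q)).
        { assert (Iq : 0 < / q) by (now apply Rinv_0_lt_compat).
          assert (Ie : 1 <= / (eta * eta)) by (rewrite <- Rinv_1; apply Rinv_le_contravar; [easy|nra]).
          unfold Rmin; destruct (Rle_dec 1 (/ q)).
          - rewrite Rmult_1_r; now apply Rinv_le_contravar.
          - nra. }
        unfold G; rewrite (Rmult_assoc (C2 * (Y * (y / T)))).
        apply Rmult_le_compat; [easy|apply Rlt_le, Rinv_0_lt_compat; easy| |exact K].
        apply Rmult_le_compat_l; [easy|]; apply Rmult_le_compat_r; lra.
    + rewrite rsum_scal, rsum_plus, rsum_scal.
      assert (A := rsum_inv_sqr N y).
      set (S1 := rsum _ N); set (S2 := rsum _ N) in *.
      unfold Rdiv; rewrite (Rmult_assoc E); apply Rmult_le_compat_l; [lra|].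
      rewrite Rmult_plus_distr_l; apply Rplus_le_compat_l.
      apply Rle_trans with (/ pos1 n * (G * 20)).
      * apply Rmult_le_compat_l; [lra|]; now apply Rmult_le_compat_l.
      * right; unfold G, D, y; field; split; [|split]; lra.
  - rewrite rsum_const.
    assert (A := Hnear N).
    assert (B : INR N * (D * / T) <= D * (c + 1)).
    { apply Rle_trans with ((c + 1) * T * (D * / T)).
      - apply Rmult_le_compat_r; [apply Rmult_le_pos; lra|easy].
      - right; field; lra. }
    nra.
Qed.

(** [Q] is fixed first, large in terms of [eps]. The constant of the sparse bound then depends on
    [Q] in an uncontrolled way, but it is divided by [ln T]. *)
Lemma maj_sum_vanishes a Y c k : 0 < a -> 0 <= Y -> 0 < c ->
  vanishes (fun T => rsum2 (maj a Y T k) (natup (c * T)) / ln T).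
Proof.
  intros Ha HY Hc eps He.
  destruct (harmonic_natup c Hc) as [H [HH HB]].
  set (E := exp (PI / a)); assert (HE : 0 < E) by apply exp_pos.
  set (Q := S (natup (2 * (E * (1 + H)) / eps))).
  assert (HQ : 2 * (E * (1 + H)) / eps <= INR Q).
  { unfold Q; rewrite S_INR.
    assert (A := natup_spec (2 * (E * (1 + H)) / eps)
      ltac:(apply Rmult_le_pos; [nra|apply Rlt_le, Rinv_0_lt_compat; easy])); lra. }
  destruct (maj_sum_sparse a Y c k Q Ha HY Hc ltac:(unfold Q; lia)) as [C HC].
  destruct (vanishes_const_ln C (eps / 2) ltac:(lra)) as [T0 HT0].
  exists (Rmax T0 3); intros T HT.
  assert (T1 : T0 <= T) by (eapply Rle_trans; [apply Rmax_l|eassumption]).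
  assert (T2 : 3 <= T) by (eapply Rle_trans; [apply Rmax_r|eassumption]).
  assert (L := ln_ge1 T T2); assert (IL : 0 < / ln T) by (apply Rinv_0_lt_compat; lra).
  specialize (HC T ltac:(lra)); specialize (HB T ltac:(lra)); specialize (HT0 T T1).
  set (N := natup (c * T)) in *.
  assert (P : 0 <= rsum2 (maj a Y T k) N).
  { apply rsum_ge0; intros; apply rsum_ge0; intros; apply maj_ge0; lra. }
  rewrite Rabs_pos_eq by (apply Rmult_le_pos; lra).
  assert (HNb : harmonic N <= (1 + H) * ln T) by (apply Rabs_le_between in HB; nra).
  assert (PQ : 0 < INR Q) by (unfold Q; apply pos1_gt0).
  assert (A : E * (harmonic N / INR Q) <= eps / 2 * ln T).
  { apply Rle_trans with (E * ((1 + H) * ln T / INR Q)).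
    - apply Rmult_le_compat_l; [lra|]; apply Rmult_le_compat_r; [apply Rlt_le, Rinv_0_lt_compat|]; easy.
    - replace (E * ((1 + H) * ln T / INR Q)) with (E * (1 + H) / INR Q * ln T) by (field; lra).
      apply Rmult_le_compat_r; [lra|].
      apply Rmult_le_reg_r with (INR Q); [easy|].
      unfold Rdiv; rewrite Rmult_assoc, Rinv_l, Rmult_1_r by lra.
      apply Rle_trans with (eps * / 2 * (2 * (E * (1 + H)) / eps)); [right; field; lra|].
      apply Rmult_le_compat_l; lra. }
  assert (B := RRle_abs (C / ln T)); fold E in HC.
  apply Rle_trans with ((C + eps / 2 * ln T) / ln T).
  - apply Rmult_le_compat_r; lra.
  - replace ((C + eps / 2 * ln T) / ln T) with (C / ln T + eps / 2) by (field; lra); lra.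
Qed.

Lemma off_entry_ge0 a T m n : 0 < T -> 0 <= off_entry a T m n.
Proof.
  intros HT; unfold off_entry; destruct (Req_EM_T _ _) as [|Ne]; [lra|].
  apply Rmult_le_pos; [apply Rlt_le, wt_pos|].
  apply Rlt_le, Rmin1_pos, Rinv_0_lt_compat, Rmult_lt_0_compat; [nra|].
  assert (A := COS_bound (a * ldiff m n)); lra.
Qed.

Lemma off_entry_sym a T m n : off_entry a T m n = off_entry a T n m.
Proof.
  unfold off_entry, osc_ker; replace (a * ldiff m n) with (- (a * ldiff n m)) by (unfold ldiff; ring).
  rewrite !cos_neg, (wt_sym m n); reflexivity.
Qed.

(** The relevant [k] depends on the pair, so each entry is bounded by the sum over all [k < K T],
    with [K T] about [a log N]. Exchanging [m] and [n] reduces to [m >= n] and costs the factor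
    2. *)
Lemma offdiag_vanishes a c : 0 < a -> 0 < c ->
  vanishes (fun T => rsum2 (off_entry a T) (natup (c * T)) / ln T).
Proof.
  intros Ha Hc.
  (* [c + 1] absorbs the rounding in [natup (c * T)], which is at most [1 <= T]. *)
  set (Y := exp (PI / a) * (c + 1)).
  assert (HY : 0 <= Y) by (apply Rmult_le_pos; [apply Rlt_le, exp_pos|lra]).
  set (K := fun T => natup (a * ln (INR (natup (c * T)) + 1) + 1)).
  destruct (maj_sum_bound a Y Ha HY) as [C [HC HCb]].
  destruct (harmonic_natup c Hc) as [H [HH HB]].
  assert (V : vanishes (fun T => rsum (fun k => rsum2 (maj a Y T k) (natup (c * T)) / ln T) (K T))).
  { apply (tannery_vanishes (fun k T => rsum2 (maj a Y T k) (natup (c * T)) / ln T) K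
             (C * (1 + H)) (exp (- (PI / a))) 3).
    - split; [apply Rlt_le, exp_pos|].
      rewrite <- exp_0; apply exp_increasing.
      assert (0 < PI / a) by (apply Rdiv_lt_0_compat; [apply PI_RGT_0|easy]); lra.
    - intros k; now apply maj_sum_vanishes.
    - intros k T HT.
      assert (L := ln_ge1 T HT); assert (IL : 0 < / ln T) by (apply Rinv_0_lt_compat; lra).
      specialize (HB T ltac:(lra)); specialize (HCb T k (natup (c * T)) ltac:(lra)).
      set (N := natup (c * T)) in *; set (R := exp (- (PI / a)) ^ k) in *.
      assert (HR : 0 < R) by (apply pow_lt, exp_pos).
      assert (P : 0 <= rsum2 (maj a Y T k) N).
      { apply rsum_ge0; intros; apply rsum_ge0; intros; apply maj_ge0; lra. }
      rewrite Rabs_pos_eq by (apply Rmult_le_pos; lra).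
      apply Rmult_le_reg_r with (ln T); [lra|].
      unfold Rdiv; rewrite Rmult_assoc, Rinv_l, Rmult_1_r by lra.
      eapply Rle_trans; [exact HCb|].
      replace (C * (1 + H) * R * ln T) with (C * R * ((1 + H) * ln T)) by ring.
      apply Rmult_le_compat_l; [apply Rmult_le_pos; lra|].
      apply Rabs_le_between in HB; nra. }
  apply (vanishes_scal 2) in V.
  refine (vanishes_le _ _ 3 _ V).
  intros T HT.
  assert (L := ln_ge1 T HT); assert (IL : 0 < / ln T) by (apply Rinv_0_lt_compat; lra).
  assert (NS := natup_spec (c * T) ltac:(nra)).
  unfold K; set (N := natup (c * T)) in *; set (KT := natup _).
  assert (P : 0 <= rsum2 (off_entry a T) N).
  { apply rsum_ge0; intros; apply rsum_ge0; intros; apply off_entry_ge0; lra. }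
  rewrite Rabs_pos_eq by (apply Rmult_le_pos; lra).
  assert (B : rsum2 (off_entry a T) N <= 2 * rsum (fun k => rsum2 (maj a Y T k) N) KT).
  { assert (U : forall m n, (m < N)%nat -> (n < N)%nat -> 0 <= ldiff m n ->
        off_entry a T m n <= rsum (fun k => maj a Y T k m n) KT).
    { intros m n Hm Hn HL; unfold off_entry; destruct (Req_EM_T _ _) as [|Ne].
      - apply rsum_ge0; intros; apply maj_ge0; lra.
      - assert (Hm' : pos1 m <= INR N) by (apply le_INR; lia).
        destruct (off_entry_le_maj a (c + 1) T m n Ha ltac:(lra) ltac:(nra) HL Ne) as [k [Hk Hb]].
        eapply Rle_trans; [exact Hb|].
        apply (rsum_ge_term (fun k => maj a Y T k m n)); [|intros; apply maj_ge0; lra].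
        apply INR_lt.
        assert (LN : ldiff m n <= ln (INR N + 1)).
        { assert (A1 := ln_ge0 (pos1 n) (pos1_ge1 n)).
          assert (A2 : ln (pos1 m) <= ln (INR N + 1)) by (apply ln_le; [apply pos1_gt0|lra]).
          unfold ldiff; lra. }
        assert (KS := natup_spec (a * ln (INR N + 1) + 1) ltac:(nra)); fold KT in KS.
        nra. }
    assert (W : rsum2 (off_entry a T) N <=
        rsum2 (fun m n => rsum (fun k => maj a Y T k m n) KT + rsum (fun k => maj a Y T k n m) KT) N).
    { apply rsum_le; intros m Hm; apply rsum_le; intros n Hn.
      assert (G : forall i j, 0 <= rsum (fun k => maj a Y T k i j) KT)
        by (intros; apply rsum_ge0; intros; apply maj_ge0; lra).
      assert (G1 := G m n); assert (G2 := G n m).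
      destruct (Rle_dec 0 (ldiff m n)) as [HL|HL].
      - assert (A := U m n Hm Hn HL); lra.
      - assert (A := U n m Hn Hm ltac:(unfold ldiff in *; lra)); rewrite off_entry_sym; lra. }
    eapply Rle_trans; [exact W|].
    rewrite rsum2_plus, (rsum2_rsum (maj a Y T)), (rsum2_rsum (fun k m n => maj a Y T k n m)).
    rewrite (rsum_ext (fun k => rsum2 (fun m n => maj a Y T k n m) N) (fun k => rsum2 (maj a Y T k) N))
      by (intros; symmetry; apply rsum2_swap).
    lra. }
  apply Rle_trans with (2 * rsum (fun k => rsum2 (maj a Y T k) N) KT / ln T).
  - apply Rmult_le_compat_r; lra.
  - right; rewrite (rsum_ext (fun k => rsum2 (maj a Y T k) N / ln T) (fun k => / ln T * rsum2 (maj a Y T k) N))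
      by (intros; unfold Rdiv; ring).
    rewrite rsum_scal; unfold Rdiv; ring.
Qed.

(** * Diagonal pairs *)

Definition diag_entry (a b : R) (m n : nat) : R :=
  if Req_EM_T (cos (a * ldiff m n)) 1 then wt m n * cos (b * ldiff m n) else 0.

Lemma cos_eq_1 t : cos t = 1 -> exists k : Z, t = 2 * PI * IZR k.
Proof.
  intros H.
  assert (E := cos_2a_sin (t / 2)); replace (2 * (t / 2)) with t in E by field.
  assert (S : sin (t / 2) = 0) by nra.
  apply sin_eq_0_0 in S; destruct S as [k Hk]; exists k; lra.
Qed.

Lemma cos_2PI_nat k : cos (2 * PI * INR k) = 1.
Proof.
  replace (2 * PI * INR k) with (0 + 2 * INR k * PI) by ring.
  rewrite cos_period; apply cos_0.
Qed.

Lemma least_nat (P : nat -> Prop) : (exists n, P n) -> exists n, P n /\ forall k, (k < n)%nat -> ~ P k.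
Proof.
  intros [n Hn]; induction n as [n IH] using (well_founded_induction lt_wf).
  destruct (classic (exists k, (k < n)%nat /\ P k)) as [[k [Hk Pk]]|H]; [eauto|].
  exists n; split; [easy|]; intros k Hk Pk; apply H; eauto.
Qed.

Lemma rational_pos_reduced x : 0 < x -> is_rational x ->
  exists m n : Z, (m > 0)%Z /\ (n > 0)%Z /\ Z.gcd m n = 1%Z /\ x = IZR m / IZR n.
Proof.
  intros Hx [p [q [Hq E]]].
  assert (Hp : p <> 0%Z) by (intros ->; rewrite E in Hx; unfold Rdiv in Hx; lra).
  set (g := Z.gcd p q).
  assert (Hg : (0 < g)%Z).
  { assert (A := Z.gcd_nonneg p q); fold g in A.
    destruct (Z.eq_dec g 0) as [G|]; [|lia].
    apply Z.gcd_eq_0_l in G; lia. }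
  destruct (Z.gcd_divide_l p q) as [p' Hp']; destruct (Z.gcd_divide_r p q) as [q' Hq'].
  fold g in Hp', Hq'.
  exists (Z.abs p'), (Z.abs q'); repeat split.
  - enough (p' <> 0)%Z by lia; intros ->; lia.
  - enough (q' <> 0)%Z by lia; intros ->; lia.
  - rewrite Z.gcd_abs_l, Z.gcd_abs_r.
    assert (G : (Z.gcd (p / g) (q / g) = 1)%Z) by (apply Z.gcd_div_gcd; [lia|reflexivity]).
    rewrite Hp', Hq', !Z.div_mul in G by lia; exact G.
  - rewrite !abs_IZR.
    assert (Hg' : IZR g <> 0) by (apply not_0_IZR; lia).
    assert (Hq0 : IZR q' <> 0) by (apply not_0_IZR; intros ->; lia).
    assert (E' : x = IZR p' / IZR q').
    { rewrite E, Hp', Hq', !mult_IZR; field; easy. }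
    unfold Rdiv; rewrite <- Rabs_inv, <- Rabs_mult.
    fold (IZR p' / IZR q'); rewrite <- E', Rabs_pos_eq; lra.
Qed.

(** As [delta] is a choice, only existence is at stake: a least exponent by well-foundedness, and a
    reduced fraction by dividing out the gcd. *)
Lemma delta_spec_holds alpha beta : delta_spec alpha beta (delta alpha beta).
Proof.
  unfold delta; apply epsilon_spec.
  destruct (classic (exists n : nat, (1 <= n)%nat /\ is_rational (exp (2 * PI * IZR (Z.of_nat n) / alpha)))) as [H|H].
  - destruct (least_nat _ H) as [n [[Hn Hr] Hmin]].
    destruct (rational_pos_reduced _ (exp_pos _) Hr) as [p [q [Hp [Hq [Hg E]]]]].
    exists (delta_formula p q beta); right; exists (Z.of_nat n), p, q.
    repeat split; try easy; try lia.
    intros l Hl Hrl; apply (Hmin (Z.to_nat l)); [lia|].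
    rewrite Z2Nat.id by lia; split; [lia|easy].
  - exists 0; left; split; [|easy]; intros l Hl Hrl; apply H; exists (Z.to_nat l).
    rewrite Z2Nat.id by lia; split; [lia|easy].
Qed.

Lemma ldiff_sym m n : ldiff n m = - ldiff m n.
Proof. unfold ldiff; ring. Qed.

Lemma ldiff_0 m n : ldiff m n = 0 -> m = n.
Proof.
  unfold ldiff; intros H.
  assert (E : pos1 m = pos1 n) by (apply ln_inv; [apply pos1_gt0|apply pos1_gt0|lra]).
  apply INR_eq in E; lia.
Qed.

Lemma diag_entry_sym a b m n : diag_entry a b m n = diag_entry a b n m.
Proof.
  unfold diag_entry; rewrite (ldiff_sym m n), !Ropp_mult_distr_r_reverse, !cos_neg, (wt_sym m n); reflexivity.
Qed.

Lemma wt_diag n : wt n n = / pos1 n.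
Proof. unfold wt; rewrite sqrt_sqrt; [easy|apply Rlt_le, pos1_gt0]. Qed.

Lemma diag_level a m n : 0 < a -> 0 < ldiff m n -> cos (a * ldiff m n) = 1 ->
  exists k : Z, (0 < k)%Z /\ ldiff m n = 2 * PI * IZR k / a /\
    exp (2 * PI * IZR k / a) = pos1 m / pos1 n.
Proof.
  intros Ha HL Hc; destruct (cos_eq_1 _ Hc) as [k Hk].
  assert (E : ldiff m n = 2 * PI * IZR k / a) by (rewrite <- Hk; field; lra).
  exists k; split; [|split; [easy|]].
  - apply lt_IZR; assert (P := PI_RGT_0).
    assert (0 < a * ldiff m n) by (now apply Rmult_lt_0_compat); nra.
  - rewrite <- E; unfold ldiff; rewrite <- ln_div by apply pos1_gt0.
    apply exp_ln, Rdiv_lt_0_compat; apply pos1_gt0.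
Qed.

Lemma pos1_ratio_rational m n : is_rational (pos1 m / pos1 n).
Proof.
  exists (Z.of_nat (S m)), (Z.of_nat (S n)); split; [lia|].
  rewrite <- !INR_IZR_INZ; reflexivity.
Qed.

(** A resonant pair with [m > n] would make some [e^{2 pi k/a}] with [k > 0] equal to the rational
    [m/n]. *)
Lemma diag_sum_irrational a b N : 0 < a ->
  (forall l : Z, (l > 0)%Z -> ~ is_rational (exp (2 * PI * IZR l / a))) ->
  rsum2 (diag_entry a b) N = harmonic N.
Proof.
  intros Ha Hirr; apply rsum_ext; intros m Hm.
  assert (Z : forall i j, 0 < ldiff i j -> diag_entry a b i j = 0).
  { intros i j HL; unfold diag_entry; destruct (Req_EM_T _ _) as [Hc|]; [exfalso|easy].
    destruct (diag_level a i j Ha HL Hc) as [k [Hk [_ E]]].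
    apply (Hirr k ltac:(lia)); rewrite E; apply pos1_ratio_rational. }
  rewrite (rsum_single _ N m Hm).
  - unfold diag_entry; replace (ldiff m m) with 0 by (unfold ldiff; ring).
    rewrite !Rmult_0_r, cos_0, wt_diag; destruct (Req_EM_T 1 1); lra.
  - intros n Hn Hne; destruct (Rtotal_order (ldiff m n) 0) as [L|[L|L]].
    + rewrite diag_entry_sym; apply Z; rewrite ldiff_sym; lra.
    + apply ldiff_0 in L; lia.
    + now apply Z.
Qed.

(** * Resonant pairs in the rational case *)

Definition level_entry (b lam : R) (j m n : nat) : R :=
  if Req_EM_T (ldiff m n) (INR j * lam) then wt m n * cos (b * ldiff m n) else 0.

(** Levels [j] and [-j] are exchanged by swapping [m] and [n]. Summing both from [j = 0] counts the
    diagonal twice, hence the subtracted [1/n]. *)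
Lemma diag_entry_levels a b lam (K m n : nat) : 0 < lam ->
  (forall m n, 0 <= ldiff m n -> cos (a * ldiff m n) = 1 <-> exists j : nat, ldiff m n = INR j * lam) ->
  Rabs (ldiff m n) < INR K * lam ->
  diag_entry a b m n =
  rsum (fun j => level_entry b lam j m n + level_entry b lam j n m) K
  - (if Nat.eq_dec m n then / pos1 n else 0).
Proof.
  intros Hl Hlev HK.
  assert (Neg : forall i j k, ldiff i j < 0 -> level_entry b lam k i j = 0).
  { intros i j k L; unfold level_entry; destruct (Req_EM_T _ _) as [E|]; [exfalso|easy].
    assert (A := pos_INR k); nra. }
  assert (Main : forall i j, 0 < ldiff i j -> ldiff i j < INR K * lam ->
    diag_entry a b i j = rsum (fun k => level_entry b lam k i j + level_entry b lam k j i) K).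
  { intros i j L LK.
    rewrite (rsum_ext _ (fun k => level_entry b lam k i j)).
    2: { intros k _; rewrite (Neg j i) by (rewrite ldiff_sym; lra); ring. }
    unfold diag_entry; destruct (Req_EM_T _ _) as [Hc|Hc].
    - apply (Hlev i j ltac:(lra)) in Hc; destruct Hc as [k Hk].
      assert (HkK : (k < K)%nat).
      { apply INR_lt; rewrite Hk in LK; apply Rmult_lt_reg_r with lam; easy. }
      rewrite (rsum_single _ K k HkK).
      + unfold level_entry; destruct (Req_EM_T _ _); easy.
      + intros k' _ Hne; unfold level_entry; destruct (Req_EM_T _ _) as [E|]; [exfalso|easy].
        apply Hne, INR_eq; rewrite Hk in E; apply Rmult_eq_reg_r with lam; lra.
    - symmetry; apply rsum_zero; intros k _; unfold level_entry.
      destruct (Req_EM_T _ _) as [E|]; [exfalso; apply Hc, Hlev; [lra|now exists k]|easy]. }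
  destruct (Rtotal_order (ldiff m n) 0) as [L|[L|L]].
  - rewrite Rabs_left in HK by easy.
    rewrite diag_entry_sym, Main by (rewrite ldiff_sym; lra).
    destruct (Nat.eq_dec m n) as [->|_]; [unfold ldiff in L; lra|].
    rewrite Rminus_0_r; apply rsum_ext; intros; ring.
  - assert (E := ldiff_0 _ _ L); subst n.
    destruct (Nat.eq_dec m m) as [_|]; [|easy].
    assert (HK0 : (0 < K)%nat).
    { apply INR_lt; rewrite L, Rabs_R0 in HK; simpl; nra. }
    rewrite (rsum_single _ K 0 HK0).
    + unfold diag_entry, level_entry; rewrite L, !Rmult_0_r, cos_0, wt_diag; simpl INR; rewrite Rmult_0_l.
      destruct (Req_EM_T 1 1); [|easy]; destruct (Req_EM_T 0 0); [ring|easy].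
    + intros k _ Hk; unfold level_entry; destruct (Req_EM_T _ _) as [E|]; [exfalso|ring].
      rewrite L in E; assert (0 < INR k) by (apply lt_0_INR; lia); nra.
  - rewrite Rabs_pos_eq in HK by lra.
    rewrite Main by easy.
    destruct (Nat.eq_dec m n) as [->|_]; [unfold ldiff in L; lra|ring].
Qed.

Lemma level_iff (P Q j m n : nat) : (1 <= P)%nat -> (1 <= Q)%nat ->
  ldiff m n = INR j * (ln (INR P) - ln (INR Q)) <-> (S m * Q ^ j = S n * P ^ j)%nat.
Proof.
  intros HP HQ.
  assert (HP' : 0 < INR P) by (apply lt_0_INR; lia).
  assert (HQ' : 0 < INR Q) by (apply lt_0_INR; lia).
  assert (HPj : 0 < INR P ^ j) by (now apply pow_lt).
  assert (HQj : 0 < INR Q ^ j) by (now apply pow_lt).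
  assert (Pm := pos1_gt0 m); assert (Pn := pos1_gt0 n).
  assert (LP : ln (INR P ^ j) = INR j * ln (INR P)) by (now apply ln_pow).
  assert (LQ : ln (INR Q ^ j) = INR j * ln (INR Q)) by (now apply ln_pow).
  unfold ldiff; split; intros H.
  - apply INR_eq; rewrite !mult_INR, !pow_INR.
    apply ln_inv; try (apply Rmult_lt_0_compat; easy).
    rewrite !ln_mult by easy; lra.
  - apply (f_equal INR) in H; rewrite !mult_INR, !pow_INR in H.
    apply (f_equal ln) in H; rewrite !ln_mult in H by easy; lra.
Qed.

Lemma coprime_proportion (A B m n : nat) : (1 <= A)%nat -> (1 <= B)%nat ->
  rel_prime (Z.of_nat A) (Z.of_nat B) -> (S m * B = S n * A)%nat ->
  exists i, S m = (A * S i)%nat /\ S n = (B * S i)%nat.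
Proof.
  intros HA HB HAB H.
  assert (D : (Z.of_nat A | Z.of_nat (S m))%Z).
  { apply Gauss with (Z.of_nat B); [|easy].
    exists (Z.of_nat (S n)); rewrite Z.mul_comm, <- !Nat2Z.inj_mul; congruence. }
  destruct D as [t Ht].
  assert (Hpos : (0 < t)%Z) by nia.
  exists (Z.to_nat t - 1)%nat.
  assert (E : S m = (A * Z.to_nat t)%nat).
  { apply Nat2Z.inj; rewrite Nat2Z.inj_mul, Z2Nat.id by lia; lia. }
  replace (S (Z.to_nat t - 1)) with (Z.to_nat t) by lia.
  split; [easy|].
  rewrite E in H; apply (Nat.mul_cancel_r _ _ A); lia.
Qed.

(** By coprimality the solutions are the multiples [(A i, B i)] with [i >= 1], and [B <= A] makes
    [A i <= N] the only constraint. *)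
Lemma rsum2_proportional (f : nat -> nat -> R) (A B N : nat) : (1 <= B <= A)%nat ->
  rel_prime (Z.of_nat A) (Z.of_nat B) ->
  rsum2 (fun m n => if Nat.eq_dec (S m * B) (S n * A) then f m n else 0) N =
  rsum (fun i => f (A * S i - 1)%nat (B * S i - 1)%nat) (N / A).
Proof.
  intros HAB Hc.
  set (e := fun i m n => if Nat.eq_dec m (A * S i - 1) then
       (if Nat.eq_dec n (B * S i - 1) then f m n else 0) else 0).
  assert (Hi : forall i, (i < N / A)%nat -> (A * S i <= N)%nat).
  { intros i Hi; assert (H := Nat.Div0.mul_div_le N A); nia. }
  rewrite (rsum2_ext _ (fun m n => rsum (fun i => e i m n) (N / A))).
  - rewrite rsum2_rsum; apply rsum_ext; intros i Hlt; specialize (Hi i Hlt).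
    rewrite (rsum2_single _ N (A * S i - 1) (B * S i - 1)); [|nia|nia|].
    + unfold e; destruct (Nat.eq_dec _ _); [|easy]; destruct (Nat.eq_dec _ _); easy.
    + intros m n _ _ Hne; unfold e.
      destruct (Nat.eq_dec m _); [|easy]; destruct (Nat.eq_dec n _); [tauto|easy].
  - intros m n Hm Hn; destruct (Nat.eq_dec (S m * B) (S n * A)) as [E|Ne].
    + destruct (coprime_proportion A B m n ltac:(lia) ltac:(lia) Hc E) as [i [E1 E2]].
      assert (Hlt : (i < N / A)%nat).
      { apply (Nat.div_le_lower_bound N A (S i)); lia. }
      rewrite (rsum_single _ _ i Hlt).
      * unfold e; destruct (Nat.eq_dec m _); [|lia]; destruct (Nat.eq_dec n _); [easy|lia].
      * intros k _ Hk; unfold e; destruct (Nat.eq_dec m _) as [E3|]; [|easy].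
        exfalso; apply Hk; nia.
    + symmetry; apply rsum_zero; intros i _; unfold e.
      destruct (Nat.eq_dec m _) as [E1|]; [|easy]; destruct (Nat.eq_dec n _) as [E2|]; [|easy].
      exfalso; apply Ne; replace (S m) with (A * S i)%nat by nia; replace (S n) with (B * S i)%nat by nia; ring.
Qed.

(** The pairs on level [j] are [(P^j i, Q^j i)], of weight [(PQ)^{-j/2} / i], with [i] up to
    [N / P^j]. *)
Lemma level_sum (P Q : nat) b j N : (1 <= Q <= P)%nat -> rel_prime (Z.of_nat P) (Z.of_nat Q) ->
  let lam := ln (INR P) - ln (INR Q) in
  rsum2 (level_entry b lam j) N =
  (/ sqrt (INR P * INR Q)) ^ j * cos (INR j * (b * lam)) * harmonic (N / P ^ j).
Proof.
  intros HPQ Hc lam.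
  assert (HP' : 0 < INR P) by (apply lt_0_INR; lia).
  assert (HQ' : 0 < INR Q) by (apply lt_0_INR; lia).
  rewrite (rsum2_ext _ (fun m n => if Nat.eq_dec (S m * Q ^ j) (S n * P ^ j) then
     wt m n * cos (INR j * (b * lam)) else 0)).
  - rewrite (rsum2_proportional (fun m n => wt m n * cos (INR j * (b * lam)))).
    + unfold harmonic; rewrite <- rsum_scal; apply rsum_ext; intros i _.
      unfold wt.
      assert (HPj : (1 <= P ^ j)%nat) by (apply Nat.neq_0_lt_0, Nat.pow_nonzero; lia).
      assert (HQj : (1 <= Q ^ j)%nat) by (apply Nat.neq_0_lt_0, Nat.pow_nonzero; lia).
      replace (S (P ^ j * S i - 1)) with (P ^ j * S i)%nat by nia.
      replace (S (Q ^ j * S i - 1)) with (Q ^ j * S i)%nat by nia.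
      rewrite !mult_INR, !pow_INR, <- sqrt_mult_alt.
      2: { apply Rmult_le_pos; [apply pow_le; lra|apply Rlt_le, pos1_gt0]. }
      set (v := pos1 i); assert (Hv : 0 < v) by apply pos1_gt0.
      set (s := sqrt (INR P * INR Q)).
      assert (Hs : 0 < s) by (apply sqrt_lt_R0, Rmult_lt_0_compat; easy).
      assert (Hss : s * s = INR P * INR Q) by (apply sqrt_sqrt, Rlt_le, Rmult_lt_0_compat; easy).
      assert (Hsj : 0 < s ^ j) by (now apply pow_lt).
      replace (INR P ^ j * v * (INR Q ^ j * v)) with ((s ^ j * v) * (s ^ j * v)).
      2: { replace (s ^ j * v * (s ^ j * v)) with ((s ^ j * s ^ j) * (v * v)) by ring.
           rewrite <- Rpow_mult_distr, Hss, Rpow_mult_distr; ring. }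
      rewrite sqrt_square by (apply Rlt_le, Rmult_lt_0_compat; easy).
      rewrite pow_inv; field; lra.
    + split; [apply Nat.neq_0_lt_0, Nat.pow_nonzero; lia|apply Nat.pow_le_mono_l; lia].
    + rewrite !Nat2Z.inj_pow; apply rel_prime_Zpower; [lia|lia|easy].
  - intros m n _ _; unfold level_entry.
    assert (I := level_iff P Q j m n ltac:(lia) ltac:(lia)); fold lam in I.
    destruct (Req_EM_T _ _) as [E|Ne]; destruct (Nat.eq_dec _ _) as [E'|Ne']; try tauto.
    rewrite E; f_equal; f_equal; ring.
Qed.

(** Shortening a harmonic sum by a fixed factor changes it by a bounded amount, which disappears
    after division by [ln T]. *)
Lemma harmonic_div c A : 0 < c -> (1 <= A)%nat ->
  vanishes (fun T => harmonic (natup (c * T) / A) / ln T - 1).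
Proof.
  intros Hc HA.
  destruct (harmonic_natup c Hc) as [H [HH HB]].
  assert (PA : 0 < INR A) by (apply lt_0_INR; lia).
  set (C := H + Rabs (ln (c / INR A))).
  refine (vanishes_le _ _ 3 _ (vanishes_const_ln C)).
  intros T HT.
  assert (L := ln_ge1 T HT); assert (IL : 0 < / ln T) by (apply Rinv_0_lt_compat; lra).
  specialize (HB T ltac:(lra)); assert (NS := natup_spec (c * T) ltac:(nra)).
  set (N := natup (c * T)) in *.
  assert (U : harmonic (N / A) <= harmonic N).
  { apply rsum_le_more; [apply Nat.Div0.div_le_upper_bound; nia|].
    intros; apply Rlt_le, Rinv_0_lt_compat, pos1_gt0. }
  assert (D : ln (c / INR A) + ln T <= harmonic (N / A)).
  { eapply Rle_trans; [|apply harmonic_bounds].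
    rewrite <- ln_mult by (try apply Rdiv_lt_0_compat; lra).
    apply ln_le; [apply Rmult_lt_0_compat; [apply Rdiv_lt_0_compat|]; lra|].
    apply Rmult_le_reg_l with (INR A); [easy|].
    replace (INR A * (c / INR A * T)) with (c * T) by (field; lra).
    rewrite <- mult_INR; apply Rle_trans with (INR N); [lra|].
    apply le_INR; assert (Q := Nat.mul_succ_div_gt N A ltac:(lia)); lia. }
  replace (harmonic (N / A) / ln T - 1) with ((harmonic (N / A) - ln T) * / ln T) by (field; lra).
  rewrite Rabs_mult, (Rabs_pos_eq (/ ln T)) by lra.
  apply Rmult_le_compat_r; [lra|].
  apply Rabs_le_between in HB; unfold C.
  assert (B1 := RRle_abs (- ln (c / INR A))); rewrite Rabs_Ropp in B1.
  assert (B2 := Rabs_pos (ln (c / INR A))).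
  apply Rabs_le; lra.
Qed.

(** Real part of the geometric sum of [r e^{ig}], cleared of its denominator [|1 - r e^{ig}|^2]. *)
Lemma geometric_cos_sum r g K :
  (1 - 2 * r * cos g + r * r) * rsum (fun j => r ^ j * cos (INR j * g)) K =
  1 - r * cos g - r ^ K * cos (INR K * g) + r ^ S K * cos (INR K * g - g).
Proof.
  induction K as [|K IH].
  - simpl; rewrite Rmult_0_l, cos_0, Rminus_0_l, cos_neg; ring.
  - cbn [rsum]; rewrite Rmult_plus_distr_l, IH.
    replace (INR (S K) * g) with (INR K * g + g) by (rewrite S_INR; ring).
    replace (INR K * g + g - g) with (INR K * g) by ring.
    assert (R := cos_rec (INR K * g) g).
    replace (cos (INR K * g - g)) with (2 * cos g * cos (INR K * g) - cos (INR K * g + g)) by lra.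
    simpl; ring.
Qed.

Lemma vanishes_pow r (K : R -> nat) : 0 <= r < 1 -> (forall T, 1 <= T -> T <= INR (K T)) ->
  vanishes (fun T => r ^ K T).
Proof.
  intros Hr HK eps He.
  destruct (pow_lt_1_zero r ltac:(rewrite Rabs_pos_eq; lra) eps He) as [K0 H0].
  exists (INR K0 + 1); intros T HT; apply Rlt_le, H0.
  assert (A := pos_INR K0); specialize (HK T ltac:(lra)); apply INR_le; lra.
Qed.

Lemma geometric_cos_limit r g (K : R -> nat) : 0 <= r < 1 -> (forall T, 1 <= T -> T <= INR (K T)) ->
  vanishes (fun T => rsum (fun j => r ^ j * cos (INR j * g)) (K T)
                     - (1 - r * cos g) / (1 - 2 * r * cos g + r * r)).
Proof.
  intros Hr HK.
  assert (Hd : 0 < 1 - 2 * r * cos g + r * r).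
  { assert (A := COS_bound g); assert (r * cos g <= r) by nra; nra. }
  set (d := 1 - 2 * r * cos g + r * r) in *.
  assert (V := vanishes_scal (2 / d) _ (vanishes_pow r K Hr HK)).
  refine (vanishes_le _ _ 1 _ V); intros T _.
  assert (E := geometric_cos_sum r g (K T)); fold d in E.
  set (s := rsum _ _) in *.
  replace (s - (1 - r * cos g) / d) with
    ((r ^ S (K T) * cos (INR (K T) * g - g) - r ^ K T * cos (INR (K T) * g)) * / d).
  2: { apply Rmult_eq_reg_l with d; [|lra]; rewrite Rmult_minus_distr_l, E; field; lra. }
  rewrite Rabs_mult, (Rabs_pos_eq (/ d)) by (apply Rlt_le, Rinv_0_lt_compat; easy).
  replace (2 / d * r ^ K T) with (2 * r ^ K T * / d) by (unfold Rdiv; ring).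
  apply Rmult_le_compat_r; [apply Rlt_le, Rinv_0_lt_compat; easy|].
  assert (P : 0 <= r ^ K T) by (apply pow_le; lra).
  assert (B1 := COS_bound (INR (K T) * g - g)); assert (B2 := COS_bound (INR (K T) * g)).
  simpl pow; set (q := r ^ K T) in *.
  assert (0 <= r * q <= q) by nra.
  apply Rabs_le; split; nra.
Qed.

Lemma exp_pow_nat x j : exp x ^ j = exp (INR j * x).
Proof.
  induction j as [|j IH]; [simpl; rewrite Rmult_0_l, exp_0; ring|].
  simpl pow; rewrite IH, <- exp_plus, S_INR; f_equal; ring.
Qed.

(** Divide the exponent [k] of a resonant pair by [l0], with quotient [j] and remainder [r]: then
    [e^{2 pi r/a} = (m/n) (Q/P)^j] is again rational, so minimality of [l0] forces [r = 0]. *)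
Lemma diag_level_iff a (l0 : Z) (P Q m n : nat) : 0 < a -> (l0 > 0)%Z -> (1 <= P)%nat -> (1 <= Q)%nat ->
  exp (2 * PI * IZR l0 / a) = INR P / INR Q ->
  (forall l : Z, (0 < l < l0)%Z -> ~ is_rational (exp (2 * PI * IZR l / a))) ->
  0 <= ldiff m n ->
  cos (a * ldiff m n) = 1 <-> exists j : nat, ldiff m n = INR j * (2 * PI * IZR l0 / a).
Proof.
  intros Ha Hl HP HQ E Hmin HL.
  assert (HP' : 0 < INR P) by (apply lt_0_INR; lia).
  assert (HQ' : 0 < INR Q) by (apply lt_0_INR; lia).
  split.
  - intros Hc; destruct HL as [HL|HL].
    2: { exists O; simpl; lra. }
    destruct (diag_level a m n Ha HL Hc) as [k [Hk [E1 E2]]].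
    set (j := Z.to_nat (k / l0)); set (r := (k mod l0)%Z).
    assert (Hj : Z.of_nat j = (k / l0)%Z) by (apply Z2Nat.id, Z.div_pos; lia).
    assert (Hr : (0 <= r < l0)%Z) by (apply Z.mod_pos_bound; lia).
    assert (Hk' : k = (l0 * Z.of_nat j + r)%Z) by (rewrite Hj; apply Z.div_mod; lia).
    assert (EQ : 2 * PI * IZR k / a = 2 * PI * IZR r / a + INR j * (2 * PI * IZR l0 / a)).
    { rewrite Hk', plus_IZR, mult_IZR, <- INR_IZR_INZ; field; lra. }
    destruct (Z.eq_dec r 0) as [Hr0|Hr0].
    + exists j; rewrite E1, EQ, Hr0; unfold Rdiv; rewrite Rmult_0_r, Rmult_0_l, Rplus_0_l; reflexivity.
    + exfalso; apply (Hmin r ltac:(lia)).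
      rewrite EQ, exp_plus, <- exp_pow_nat, E in E2.
      exists (Z.of_nat (S m * Q ^ j)), (Z.of_nat (S n * P ^ j)); split.
      * assert (P ^ j <> 0)%nat by (apply Nat.pow_nonzero; lia); lia.
      * rewrite <- !INR_IZR_INZ, !mult_INR, !pow_INR.
        assert (HPj : 0 < INR P ^ j) by (now apply pow_lt).
        assert (HQj : 0 < INR Q ^ j) by (now apply pow_lt).
        assert (Pn := pos1_gt0 n).
        set (ex := exp (2 * PI * IZR r / a)) in *.
        unfold Rdiv in E2; rewrite Rpow_mult_distr, pow_inv in E2.
        replace (pos1 m) with (pos1 m * / pos1 n * pos1 n) by (field; lra).
        rewrite <- E2; field; lra.
  - intros [j Hj]; rewrite Hj.
    replace (a * (INR j * (2 * PI * IZR l0 / a))) with (2 * PI * INR (j * Z.to_nat l0)).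
    + apply cos_2PI_nat.
    + rewrite mult_INR, (INR_IZR_INZ (Z.to_nat l0)), Z2Nat.id by lia; field; lra.
Qed.

(** Once [e^{K lam}] exceeds [N + 1], no ratio of integers up to [N] reaches level [K], so the
    levels below [K] exhaust the resonant pairs. *)
Lemma diag_sum_levels a b (P Q : nat) (K N : nat) : (1 <= Q < P)%nat ->
  rel_prime (Z.of_nat P) (Z.of_nat Q) ->
  let lam := ln (INR P) - ln (INR Q) in
  (forall m n, 0 <= ldiff m n -> cos (a * ldiff m n) = 1 <-> exists j : nat, ldiff m n = INR j * lam) ->
  ln (pos1 N) < INR K * lam ->
  rsum2 (diag_entry a b) N =
  2 * rsum (fun j => (/ sqrt (INR P * INR Q)) ^ j * cos (INR j * (b * lam)) * harmonic (N / P ^ j)) K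
  - harmonic N.
Proof.
  intros HPQ Hc lam Hlev HK.
  assert (Hlam : 0 < lam).
  { unfold lam; enough (ln (INR Q) < ln (INR P)) by lra.
    apply ln_increasing; [apply lt_0_INR|apply lt_INR]; lia. }
  rewrite (rsum2_ext _ (fun m n => rsum (fun j => level_entry b lam j m n + level_entry b lam j n m) K
    - (if Nat.eq_dec m n then / pos1 n else 0))).
  2: { intros m n Hm Hn; apply diag_entry_levels; [easy|easy|].
       assert (A1 := ln_ge0 (pos1 n) (pos1_ge1 n)); assert (A2 := ln_ge0 (pos1 m) (pos1_ge1 m)).
       assert (A3 : ln (pos1 m) <= ln (pos1 N)) by (apply ln_le; [apply pos1_gt0|apply le_INR; lia]).
       assert (A4 : ln (pos1 n) <= ln (pos1 N)) by (apply ln_le; [apply pos1_gt0|apply le_INR; lia]).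
       unfold ldiff; apply Rabs_def1; lra. }
  rewrite rsum2_minus; f_equal.
  - rewrite (rsum2_rsum (fun j m n => level_entry b lam j m n + level_entry b lam j n m)), <- rsum_scal.
    apply rsum_ext; intros j _.
    rewrite rsum2_plus, <- (rsum2_swap (level_entry b lam j)).
    change (rsum2 (fun m n => level_entry b lam j m n) N) with (rsum2 (level_entry b lam j) N).
    unfold lam; rewrite level_sum by (easy || lia); ring.
  - unfold rsum2, harmonic; apply rsum_ext; intros m Hm.
    rewrite (rsum_single _ N m Hm).
    + destruct (Nat.eq_dec m m); easy.
    + intros n _ Hn; destruct (Nat.eq_dec m n); [lia|easy].
Qed.

(** In the rational case put [r = (pq)^{-1/2}] and [g = b lam]. After division by [ln T], level [j]
    tends to [r^j cos(jg)] and is bounded by a multiple of [r^j], so limit and sum may be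
    exchanged. *)
Lemma diag_sum_limit a b c : 0 < a -> 0 < c ->
  vanishes (fun T => rsum2 (diag_entry a b) (natup (c * T)) / ln T - (1 + delta a b)).
Proof.
  intros Ha Hc.
  assert (V1 := harmonic_div c 1 Hc (Nat.le_refl _)).
  assert (V1' : vanishes (fun T => harmonic (natup (c * T)) / ln T - 1)).
  { refine (vanishes_ext _ _ 1 _ V1); intros; rewrite Nat.div_1_r; reflexivity. }
  clear V1; destruct (harmonic_natup c Hc) as [H [HH HB]].
  destruct (delta_spec_holds a b) as [[Hirr Hd]|[l0 [p [q [Hl0 [_ [Hmin [Hp [Hq [Hg [E Hd]]]]]]]]]]].
  - refine (vanishes_ext _ _ 1 _ V1'); intros T _; cbv beta.
    rewrite (diag_sum_irrational a b _ Ha Hirr), Hd; ring.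
  - set (P := Z.to_nat p); set (Q := Z.to_nat q).
    assert (EP : INR P = IZR p) by (unfold P; rewrite INR_IZR_INZ, Z2Nat.id by lia; easy).
    assert (EQ : INR Q = IZR q) by (unfold Q; rewrite INR_IZR_INZ, Z2Nat.id by lia; easy).
    assert (HP1 : (1 <= P)%nat) by (unfold P; lia); assert (HQ1 : (1 <= Q)%nat) by (unfold Q; lia).
    assert (HP' : 0 < INR P) by (apply lt_0_INR; lia).
    assert (HQ' : 0 < INR Q) by (apply lt_0_INR; lia).
    rewrite <- EP, <- EQ in E.
    set (x := 2 * PI * IZR l0 / a) in *.
    assert (Hx : 0 < x).
    { apply Rdiv_lt_0_compat; [|easy]; assert (A := PI_RGT_0).
      apply Rmult_lt_0_compat; [lra|]; apply IZR_lt; lia. }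
    set (lam := ln (INR P) - ln (INR Q)).
    assert (Elam : lam = x).
    { unfold lam; rewrite <- ln_div, <- E, ln_exp by easy; reflexivity. }
    assert (HPQ : (1 <= Q < P)%nat).
    { split; [easy|]; apply INR_lt, ln_lt_inv; unfold lam in Elam; lra. }
    assert (Hrp : rel_prime (Z.of_nat P) (Z.of_nat Q)).
    { unfold P, Q; rewrite !Z2Nat.id by lia; now apply Zgcd_1_rel_prime. }
    assert (Hlev : forall m n, 0 <= ldiff m n ->
       cos (a * ldiff m n) = 1 <-> exists j : nat, ldiff m n = INR j * lam).
    { intros m n HL; rewrite Elam; apply (diag_level_iff a l0 P Q); easy. }
    set (s := sqrt (INR P * INR Q)).
    assert (Hss : s * s = INR P * INR Q) by (apply sqrt_sqrt, Rlt_le, Rmult_lt_0_compat; easy).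
    assert (Hs0 : 0 < s) by (apply sqrt_lt_R0, Rmult_lt_0_compat; easy).
    assert (Hs : 1 < s).
    { assert (2 <= INR P) by (apply (le_INR 2); lia); assert (1 <= INR Q) by (apply (le_INR 1); lia); nra. }
    assert (Hr : 0 <= / s < 1).
    { split; [apply Rlt_le, Rinv_0_lt_compat; easy|]; rewrite <- Rinv_1; apply Rinv_lt_contravar; lra. }
    set (g := b * lam).
    (* The first summand lets [K T] exceed every level that occurs; the second makes it tend to
       infinity at a known rate. *)
    set (K := fun T => (natup (ln (pos1 (natup (c * T))) / lam) + natup T)%nat).
    assert (VG : vanishes (fun T => rsum (fun j => (/ s) ^ j * cos (INR j * g) *
        (harmonic (natup (c * T) / P ^ j) / ln T - 1)) (K T))).
    { apply (tannery_vanishes (fun j T => (/ s) ^ j * cos (INR j * g) *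
        (harmonic (natup (c * T) / P ^ j) / ln T - 1)) K (2 + H) (/ s) 3 Hr).
      - intros j; apply (vanishes_scal ((/ s) ^ j * cos (INR j * g))).
        apply harmonic_div; [easy|]; apply Nat.neq_0_lt_0, Nat.pow_nonzero; lia.
      - intros j T HT.
        assert (L := ln_ge1 T HT); assert (IL : 0 < / ln T) by (apply Rinv_0_lt_compat; lra).
        specialize (HB T ltac:(lra)).
        assert (Hpj : 0 <= (/ s) ^ j) by (apply pow_le; lra).
        rewrite !Rabs_mult, (Rabs_pos_eq ((/ s) ^ j)) by easy.
        set (N := natup (c * T)) in *.
        assert (U : harmonic (N / P ^ j) <= harmonic N).
        { apply rsum_le_more; [apply Nat.Div0.div_le_upper_bound;
            assert (P ^ j <> 0)%nat by (apply Nat.pow_nonzero; lia); nia|].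
          intros; apply Rlt_le, Rinv_0_lt_compat, pos1_gt0. }
        assert (U0 := harmonic_ge0 (N / P ^ j)).
        assert (Bd : 0 <= harmonic (N / P ^ j) / ln T <= 1 + H).
        { split; [apply Rmult_le_pos; lra|].
          apply Rmult_le_reg_r with (ln T); [lra|].
          unfold Rdiv; rewrite Rmult_assoc, Rinv_l, Rmult_1_r by lra.
          apply Rabs_le_between in HB; nra. }
        assert (B1 : Rabs (cos (INR j * g)) <= 1) by (apply Rabs_le, COS_bound).
        assert (B2 : Rabs (harmonic (N / P ^ j) / ln T - 1) <= 2 + H) by (apply Rabs_le; lra).
        assert (B3 := Rabs_pos (cos (INR j * g))).
        assert (B4 := Rabs_pos (harmonic (N / P ^ j) / ln T - 1)).
        rewrite Rmult_assoc, (Rmult_comm (2 + H)).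
        apply Rmult_le_compat_l; [easy|]; nra. }
    assert (VC : vanishes (fun T => rsum (fun j => (/ s) ^ j * cos (INR j * g)) (K T)
                     - (1 - / s * cos g) / (1 - 2 * / s * cos g + / s * / s))).
    { apply geometric_cos_limit; [easy|]; intros T HT; unfold K; rewrite plus_INR.
      assert (A := natup_spec T ltac:(lra)); assert (B := pos_INR (natup (ln (pos1 (natup (c * T))) / lam))); lra. }
    (* Both sides are [(s^2 - 1) / (s^2 + 1 - 2 s cos g)] with [s^2 = pq]. *)
    assert (ED : 2 * ((1 - / s * cos g) / (1 - 2 * / s * cos g + / s * / s)) - 1 = 1 + delta a b).
    { rewrite Hd; unfold delta_formula; rewrite <- EP, <- EQ; fold s.
      replace (b * ln (INR P / INR Q)) with g by (unfold g, lam; rewrite ln_div by easy; ring).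
      rewrite <- Hss.
      assert (Cg := COS_bound g).
      assert (D1 : 0 < s * s + 1 - 2 * s * cos g) by nra.
      field; split; nra. }
    rewrite <- ED.
    refine (vanishes_ext _ _ 3 _ (vanishes_plus _ _
       (vanishes_scal 2 _ (vanishes_plus _ _ VG VC)) (vanishes_scal (-1) _ V1'))).
    intros T HT; cbv beta.
    assert (L := ln_ge1 T HT).
    rewrite (diag_sum_levels a b P Q (K T) (natup (c * T)) HPQ Hrp Hlev).
    2: { fold lam; unfold K; rewrite plus_INR.
         assert (A := pos_INR (natup T)).
         assert (A1 := ln_ge0 (pos1 (natup (c * T))) (pos1_ge1 _)).
         assert (B := natup_spec (ln (pos1 (natup (c * T))) / lam)
            ltac:(apply Rmult_le_pos; [easy|apply Rlt_le, Rinv_0_lt_compat; lra])).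
         apply Rle_lt_trans with (ln (pos1 (natup (c * T))) / lam * lam); [right; field; lra|].
         apply Rmult_lt_compat_r; lra. }
    fold lam; fold s; fold g.
    set (N := natup (c * T)).
    assert (EX : rsum (fun j => (/ s) ^ j * cos (INR j * g) * (harmonic (N / P ^ j) / ln T - 1)) (K T) =
       / ln T * rsum (fun j => (/ s) ^ j * cos (INR j * g) * harmonic (N / P ^ j)) (K T) -
       rsum (fun j => (/ s) ^ j * cos (INR j * g)) (K T)).
    { rewrite <- rsum_scal, <- rsum_minus; apply rsum_ext; intros; field; lra. }
    rewrite EX; set (S1 := rsum _ (K T)); set (S2 := rsum _ (K T)).
    set (F := (1 - / s * cos g) / _); field; lra.
Qed.

(** * Asymptotics of the two moments *)

Definition dirichlet_sq (N : nat) (u : R) : R := rsum2 (fun m n => wt m n * cos (u * ldiff m n)) N.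

Lemma dirichlet_sq_csum u N :
  fst (csum (dterm u) N) ^ 2 + snd (csum (dterm u) N) ^ 2 = dirichlet_sq N u.
Proof.
  rewrite csum_fst, csum_snd.
  replace (rsum (fun k => fst (dterm u k)) N ^ 2 + rsum (fun k => snd (dterm u k)) N ^ 2)
    with (rsum (fun k => fst (dterm u k)) N * rsum (fun k => fst (dterm u k)) N +
          rsum (fun k => snd (dterm u k)) N * rsum (fun k => snd (dterm u k)) N) by ring.
  rewrite !rsum_mult, <- rsum_plus; apply rsum_ext; intros m _.
  rewrite <- rsum_plus; apply rsum_ext; intros n _.
  rewrite !dterm_fst, !dterm_snd; unfold wt, ldiff.
  rewrite Rmult_minus_distr_l, cos_minus; field.
  split; apply Rgt_not_eq, sqrt_lt_R0, pos1_gt0.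
Qed.

(** On the support [T <= t <= 2T], so [aT/2 <= |at + b| <= cT] with [c = 2a + |b| + 1]; the
    threshold [T1] is there for the lower bound. With [N] close to [cT], the error [N/|u|] of the
    approximation is then bounded. *)
Lemma zeta_dirichlet_error a b B phi : 0 < a -> support_in phi 1 2 -> (forall x, Rabs (phi x) <= B) ->
  exists C T1, 0 <= C /\ forall T t, T1 <= T ->
  Rabs (zeta_crit_abs2 (a * t + b) * phi (t / T) -
        dirichlet_sq (natup ((2 * a + Rabs b + 1) * T)) (a * t + b) * phi (t / T)) <= C.
Proof.
  intros Ha Hs Hb; set (c := 2 * a + Rabs b + 1).
  assert (Ab := Rabs_pos b).
  assert (HB : 0 <= B) by (eapply Rle_trans; [apply Rabs_pos|apply (Hb 0)]).
  exists (145920 * (2 * (c + 2) / a) * B), (1 + 2 * (Rabs b + 1) / a); split.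
  { repeat apply Rmult_le_pos; unfold c; try lra; apply Rlt_le, Rinv_0_lt_compat; easy. }
  intros T t HT.
  assert (P : 0 <= 2 * (Rabs b + 1) / a) by (apply Rmult_le_pos; [lra|apply Rlt_le, Rinv_0_lt_compat; easy]).
  assert (HaT : Rabs b + 1 <= a * T / 2).
  { apply Rle_trans with (a * (2 * (Rabs b + 1) / a) / 2); [right; field; lra|].
    unfold Rdiv at 1; apply Rmult_le_compat_r; [lra|]; apply Rmult_le_compat_l; lra. }
  set (N := natup (c * T)).
  assert (NS := natup_spec (c * T) ltac:(unfold c; nra)); fold N in NS.
  rewrite <- Rmult_minus_distr_r, Rabs_mult.
  destruct (Req_dec (phi (t / T)) 0) as [Z|Z].
  { rewrite Z, Rabs_R0, Rmult_0_r; repeat apply Rmult_le_pos; unfold c; try lra; apply Rlt_le, Rinv_0_lt_compat; easy. }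
  assert (Ht := Hs _ Z).
  assert (Ht' : T <= t <= 2 * T).
  { split; apply Rmult_le_reg_r with (/ T); try (apply Rinv_0_lt_compat; lra).
    - rewrite Rinv_r by lra; apply Ht.
    - replace (2 * T * / T) with 2 by (field; lra); apply Ht. }
  apply Rmult_le_compat; try apply Rabs_pos; [|apply Hb].
  rewrite <- dirichlet_sq_csum.
  assert (B1 := RRle_abs b); assert (B2 := RRle_abs (- b)); rewrite Rabs_Ropp in B2.
  assert (U : a * T / 2 <= Rabs (a * t + b) <= c * T).
  { rewrite Rabs_pos_eq by nra; unfold c; split; nra. }
  eapply Rle_trans; [apply zeta_approx|].
  - apply INR_le; simpl INR; unfold c in *; nra.
  - rewrite S_INR; lra.
  - apply Rmult_le_compat_l; [lra|].
    rewrite S_INR.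
    apply Rle_trans with ((c + 2) * T / (a * T / 2)).
    + apply Rmult_le_compat; [lra|apply Rlt_le, Rinv_0_lt_compat; lra|lra|apply Rinv_le_contravar; lra].
    + right; field; lra.
Qed.

(** Integer samples cannot see a phase [2 pi k l]. This aliasing, absent from the integral, is the
    origin of [delta]. *)
Lemma osc_sum_diag a b (phi : R -> R) T M m n : cos (a * ldiff m n) = 1 ->
  rsum (fun l => cos ((a * INR l + b) * ldiff m n) * phi (INR l / T)) M =
  cos (b * ldiff m n) * rsum (fun l => phi (INR l / T)) M.
Proof.
  intros Hc; rewrite <- rsum_scal; apply rsum_ext; intros l _; f_equal.
  destruct (cos_eq_1 _ Hc) as [k Hk].
  replace ((a * INR l + b) * ldiff m n) with (b * ldiff m n + a * ldiff m n * INR l) by ring.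
  rewrite Hk, cos_plus.
  assert (Es : sin (2 * PI * IZR k * INR l) = 0).
  { apply sin_eq_0_1; exists (2 * k * Z.of_nat l)%Z.
    rewrite !mult_IZR, <- INR_IZR_INZ; ring. }
  assert (Ec : cos (2 * PI * IZR k * INR l) = 1).
  { assert (A := cos_2a_sin (PI * IZR k * INR l)).
    replace (2 * (PI * IZR k * INR l)) with (2 * PI * IZR k * INR l) in A by ring.
    rewrite A, (sin_eq_0_1 (PI * IZR k * INR l)); [ring|].
    exists (k * Z.of_nat l)%Z; rewrite mult_IZR, <- INR_IZR_INZ; ring. }
  rewrite Es, Ec; ring.
Qed.

Lemma discrete_moment B phi phi1 phi2 a b T M N : test_function B phi phi1 phi2 ->
  2 <= T -> 2 * T + 1 < INR M <= 3 * T ->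
  Rabs (rsum (fun l => dirichlet_sq N (a * INR l + b) * phi (INR l / T)) M -
        rsum (fun l => phi (INR l / T)) M * rsum2 (diag_entry a b) N)
  <= 6 * B * T * rsum2 (off_entry a T) N.
Proof.
  intros H HT HM.
  set (Phi := rsum (fun l => phi (INR l / T)) M).
  set (S := fun m n => rsum (fun l => cos ((a * INR l + b) * ldiff m n) * phi (INR l / T)) M).
  assert (E : rsum (fun l => dirichlet_sq N (a * INR l + b) * phi (INR l / T)) M =
              rsum2 (fun m n => wt m n * S m n) N).
  { rewrite (rsum_ext _ (fun l => rsum2 (fun m n => wt m n * (cos ((a * INR l + b) * ldiff m n) * phi (INR l / T))) N)).
    - rewrite <- (rsum2_rsum (fun l m n => wt m n * (cos ((a * INR l + b) * ldiff m n) * phi (INR l / T)))).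
      apply rsum2_ext; intros; unfold S; rewrite rsum_scal; reflexivity.
    - intros l _; unfold dirichlet_sq; rewrite Rmult_comm, <- rsum2_scal.
      apply rsum2_ext; intros; ring. }
  rewrite E, <- rsum2_scal, <- rsum2_minus, <- rsum2_scal.
  eapply Rle_trans; [apply rsum2_abs|]; apply rsum2_le; intros m n.
  unfold diag_entry, off_entry; destruct (Req_EM_T _ _) as [Hc|Hc].
  - unfold S; rewrite (osc_sum_diag a b phi T M m n Hc); fold Phi.
    match goal with |- Rabs ?e <= _ => replace e with 0 by ring end; rewrite Rabs_R0; lra.
  - rewrite Rmult_0_r, Rminus_0_r, Rabs_mult, (Rabs_pos_eq (wt m n)) by apply Rlt_le, wt_pos.
    assert (A := osc_sum_bound B phi phi1 phi2 T M (a * ldiff m n) (b * ldiff m n) H HT HM).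
    replace (6 * B * T * (wt m n * osc_ker T (a * ldiff m n)))
      with (wt m n * (6 * B * (T * osc_ker T (a * ldiff m n)))) by ring.
    apply Rmult_le_compat_l; [apply Rlt_le, wt_pos|].
    eapply Rle_trans; [|apply A].
    + right; f_equal; unfold S; apply rsum_ext; intros l _.
      replace ((a * INR l + b) * ldiff m n) with (a * ldiff m n * INR l + b * ldiff m n) by ring; reflexivity.
    + assert (Q := COS_bound (a * ldiff m n)); lra.
Qed.

Lemma is_RInt_rsum (f : nat -> R -> R) x y n :
  (forall k, ex_RInt (f k) x y) ->
  is_RInt (fun t => rsum (fun k => f k t) n) x y (rsum (fun k => RInt (f k) x y) n).
Proof.
  intros H; induction n as [|n IH]; simpl.
  - evar_last; [apply (is_RInt_const (V := R_NormedModule))|].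
    unfold scal; simpl; unfold mult; simpl; ring.
  - apply (is_RInt_plus (V := R_NormedModule)); [apply IH|].
    apply (RInt_correct (V := R_CompleteNormedModule)), H.
Qed.

Lemma one_sub_cos_upper th : 2 - 2 * cos th <= th * th.
Proof.
  assert (E := cos_2a_sin (th / 2)); replace (2 * (th / 2)) with th in E by field.
  assert (A := Rabs_sin_le (th / 2)).
  assert (B : sin (th / 2) * sin (th / 2) <= th / 2 * (th / 2)) by (now apply Rsqr_le_abs_1).
  lra.
Qed.

Lemma rsum2_wt N : rsum2 wt N <= 4 * INR N.
Proof.
  replace (rsum2 wt N) with (rsum (fun k => / sqrt (pos1 k)) N * rsum (fun k => / sqrt (pos1 k)) N).
  - assert (A := rsum_inv_sqrt N); assert (Q := sqrt_sqrt _ (pos_INR N)).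
    assert (0 <= rsum (fun k => / sqrt (pos1 k)) N) by (apply rsum_ge0; intros; apply Rlt_le, inv_sqrt_pos).
    nra.
  - rewrite rsum_mult; apply rsum_ext; intros; apply rsum_ext; intros; unfold wt.
    rewrite Rinv_mult; reflexivity.
Qed.

Lemma continuous_moment a b T (f phi : R -> R) : (forall u, continuous f u) -> (forall x, continuous phi x) ->
  forall t, continuous (fun t => f (a * t + b) * phi (t / T)) t.
Proof.
  intros Hf Hp t.
  apply (continuous_mult (fun t => f (a * t + b)) (fun t => phi (t / T))).
  - apply (continuous_comp (fun t => a * t + b) f); [|apply Hf].
    apply (ex_derive_continuous (fun t => a * t + b)); auto_derive; easy.
  - now apply continuous_dilate.
Qed.

Lemma continuous_dirichlet_sq N u : continuous (dirichlet_sq N) u.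
Proof.
  apply (continuous_rsum (fun m u => rsum (fun n => wt m n * cos (u * ldiff m n)) N)); intros m.
  apply (continuous_rsum (fun n u => wt m n * cos (u * ldiff m n))); intros n.
  apply (ex_derive_continuous (fun u => wt m n * cos (u * ldiff m n))); auto_derive; easy.
Qed.

(** As [|1 - e^{i th}|^2 <= th^2], non-resonant pairs cost no more than in the discrete sum.
    Off-diagonal pairs that resonate there are now error terms, but they have [|th| >= 2 pi], so
    each costs a multiple of [T] times [1/T^2] times its weight, and the weights add up to at most
    [4N]. *)
Lemma integral_moment B phi phi1 phi2 a b T M N : test_function B phi phi1 phi2 ->
  0 < a -> 2 <= T -> 2 * T + 1 < INR M <= 3 * T ->
  Rabs (RInt (fun t => dirichlet_sq N (a * t + b) * phi (t / T)) 0 (INR M) -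
        RInt (fun t => phi (t / T)) 0 (INR M) * harmonic N)
  <= 6 * B * T * (rsum2 (off_entry a T) N + / (T * T) * (4 * INR N)).
Proof.
  intros H Ha HT HM.
  assert (HB : 0 <= B) by (eapply Rle_trans; [apply Rabs_pos|apply (test_bound _ _ _ _ H 0)]).
  assert (C0 : forall x, continuous phi x) by (intros x; apply (continuous_derivable phi phi1), H).
  assert (IT : 0 < / (T * T)) by (apply Rinv_0_lt_compat; nra).
  set (A := RInt (fun t => phi (t / T)) 0 (INR M)).
  set (J := fun m n => RInt (fun t => wt m n * (cos (a * ldiff m n * t + b * ldiff m n) * phi (t / T))) 0 (INR M)).
  assert (CC : forall m n t, continuous (fun t => cos (a * ldiff m n * t + b * ldiff m n) * phi (t / T)) t).
  { intros m n t; apply (continuous_mult (fun t => cos (a * ldiff m n * t + b * ldiff m n)) (fun t => phi (t / T)));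
      [apply continuous_cos_lin|now apply continuous_dilate]. }
  assert (EX0 : forall m n, ex_RInt (fun t => cos (a * ldiff m n * t + b * ldiff m n) * phi (t / T)) 0 (INR M)).
  { intros m n; apply (ex_RInt_continuous (V := R_CompleteNormedModule)); intros; apply CC. }
  assert (EX : forall m n, ex_RInt (fun t => wt m n * (cos (a * ldiff m n * t + b * ldiff m n) * phi (t / T))) 0 (INR M)).
  { intros m n; apply (ex_RInt_scal (V := R_CompleteNormedModule) (fun t => cos (a * ldiff m n * t + b * ldiff m n) * phi (t / T))), EX0. }
  assert (EJ : forall m n, J m n = wt m n * RInt (fun t => cos (a * ldiff m n * t + b * ldiff m n) * phi (t / T)) 0 (INR M)).
  { intros m n; unfold J.
    apply (RInt_scal (V := R_CompleteNormedModule) (fun t => cos (a * ldiff m n * t + b * ldiff m n) * phi (t / T))), EX0. }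
  assert (E : RInt (fun t => dirichlet_sq N (a * t + b) * phi (t / T)) 0 (INR M) = rsum2 J N).
  { apply is_RInt_unique.
    apply is_RInt_ext with (fun t => rsum (fun m => rsum (fun n =>
       wt m n * (cos (a * ldiff m n * t + b * ldiff m n) * phi (t / T))) N) N).
    { intros t _; unfold dirichlet_sq; rewrite Rmult_comm, <- rsum2_scal.
      apply rsum2_ext; intros m n _ _.
      replace ((a * t + b) * ldiff m n) with (a * ldiff m n * t + b * ldiff m n) by ring; ring. }
    assert (I1 : forall m, is_RInt (fun t => rsum (fun n =>
       wt m n * (cos (a * ldiff m n * t + b * ldiff m n) * phi (t / T))) N) 0 (INR M) (rsum (fun n => J m n) N)).
    { intros m; apply (is_RInt_rsum (fun n t => wt m n * (cos (a * ldiff m n * t + b * ldiff m n) * phi (t / T)))).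
      intros n; apply EX. }
    assert (I2 := is_RInt_rsum (fun m t => rsum (fun n =>
       wt m n * (cos (a * ldiff m n * t + b * ldiff m n) * phi (t / T))) N) 0 (INR M) N).
    replace (rsum2 J N) with (rsum (fun m => RInt (fun t => rsum (fun n =>
       wt m n * (cos (a * ldiff m n * t + b * ldiff m n) * phi (t / T))) N) 0 (INR M)) N).
    - apply I2; intros m; eexists; apply I1.
    - apply rsum_ext; intros m _; apply is_RInt_unique, I1. }
  assert (EH : A * harmonic N = rsum2 (fun m n => if Nat.eq_dec m n then A * / pos1 n else 0) N).
  { unfold harmonic; rewrite <- rsum_scal; apply rsum_ext; intros m Hm.
    rewrite (rsum_single _ N m Hm).
    - destruct (Nat.eq_dec m m); easy.
    - intros n _ Hn; destruct (Nat.eq_dec m n); [lia|easy]. }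
  rewrite E, EH, <- rsum2_minus.
  apply Rle_trans with (6 * B * T * (rsum2 (off_entry a T) N + / (T * T) * rsum2 wt N)).
  2: { apply Rmult_le_compat_l; [nra|]; apply Rplus_le_compat_l, Rmult_le_compat_l; [lra|apply rsum2_wt]. }
  rewrite <- (rsum2_scal (/ (T * T))), <- rsum2_plus, <- rsum2_scal.
  eapply Rle_trans; [apply rsum2_abs|]; apply rsum2_le; intros m n.
  rewrite EJ.
  assert (W := wt_pos m n).
  assert (OG := off_entry_ge0 a T m n ltac:(lra)).
  assert (WG : 0 <= / (T * T) * wt m n) by (apply Rmult_le_pos; lra).
  destruct (Nat.eq_dec m n) as [->|Hne].
  - replace (ldiff n n) with 0 by (unfold ldiff; ring).
    rewrite <- (wt_diag n), (RInt_ext _ (fun t => phi (t / T))).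
    + fold A; match goal with |- Rabs ?e <= _ => replace e with 0 by ring end.
      rewrite Rabs_R0; apply Rmult_le_pos; [nra|lra].
    + intros t _; rewrite !Rmult_0_r, Rmult_0_l, Rplus_0_l, cos_0, Rmult_1_l; reflexivity.
  - rewrite Rminus_0_r.
    assert (HL : ldiff m n <> 0) by (intros L; apply ldiff_0 in L; easy).
    set (th := a * ldiff m n) in *.
    assert (Hth : th <> 0) by (unfold th; apply Rmult_integral_contrapositive; split; lra).
    assert (BD := osc_int_bound B phi phi1 phi2 T M th (b * ldiff m n) H HT HM Hth).
    rewrite Rabs_mult, (Rabs_pos_eq (wt m n)) by lra.
    apply Rle_trans with (wt m n * (6 * B * (T * Rmin 1 (/ (T * T * (th * th)))))).
    { apply Rmult_le_compat_l; [lra|exact BD]. }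
    replace (wt m n * (6 * B * (T * Rmin 1 (/ (T * T * (th * th))))))
      with (6 * B * T * (wt m n * Rmin 1 (/ (T * T * (th * th))))) by ring.
    apply Rmult_le_compat_l; [nra|].
    assert (Hth2 := Rmult_self_pos _ Hth).
    unfold off_entry in OG |- *; fold th in OG |- *; destruct (Req_EM_T (cos th) 1) as [Hc|Hc].
    + rewrite Rplus_0_l, (Rmult_comm (/ (T * T))); apply Rmult_le_compat_l; [lra|].
      eapply Rle_trans; [apply Rmin_r|]; apply Rinv_le_contravar; [nra|].
      enough (1 <= th * th) by nra.
      destruct (cos_eq_1 _ Hc) as [k Hk].
      assert (HP := PI2_3_2).
      assert (Hk0 : k <> 0%Z) by (intros ->; rewrite Rmult_0_r in Hk; easy).
      assert (Hk1 : 1 <= Rabs (IZR k)) by (rewrite <- abs_IZR; apply IZR_le; lia).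
      assert (Hk2 : 1 <= IZR k * IZR k).
      { rewrite <- (Rabs_pos_eq (IZR k * IZR k)) by apply Rle_0_sqr; rewrite Rabs_mult; nra. }
      rewrite Hk; nra.
    + apply Rle_trans with (wt m n * osc_ker T th); [|lra].
      apply Rmult_le_compat_l; [lra|]; apply Rle_min_compat_l.
      assert (Q := COS_bound th).
      apply Rinv_le_contravar; [apply Rmult_lt_0_compat; [nra|lra]|].
      apply Rmult_le_compat_l; [nra|apply one_sub_cos_upper].
Qed.

(** * Reduction of the sum over [Z] and the integral over [R] to finite ranges *)

Lemma sum_Z_support (f : Z -> R) M :
  (forall l, (l < 0 \/ Z.of_nat M <= l)%Z -> f l = 0) ->
  sum_Z f = rsum (fun l => f (Z.of_nat l)) M.
Proof.
  intros H; unfold sum_Z; apply seq_lim_unique.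
  intros eps He; exists M; intros N HN.
  rewrite sum_f_R0_rsum.
  replace (S (2 * N)) with (N + (M + (S N - M)))%nat by lia.
  rewrite rsum_split, rsum_split.
  rewrite (rsum_zero (fun k => f (Z.of_nat k - Z.of_nat N)%Z)) by (intros; apply H; lia).
  rewrite (rsum_zero (fun k => f (Z.of_nat (N + (M + k)) - Z.of_nat N)%Z)) by (intros; apply H; lia).
  rewrite (rsum_ext _ (fun l => f (Z.of_nat l))) by (intros; f_equal; lia).
  unfold Rdist; match goal with |- Rabs ?e < _ => replace e with 0 by ring end.
  rewrite Rabs_R0; lra.
Qed.

(** Every proof of integrability yields the same number [RInt f x y], so the choice made by
    [epsilon] is forced. *)
Lemma Defs_RInt_eq f x y : ex_RInt f x y -> Defs.RInt f x y = RInt f x y.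
Proof.
  intros H; unfold Defs.RInt.
  assert (S := epsilon_spec (inhabits 0) (fun I => exists pr : Riemann_integrable f x y, RiemannInt pr = I)).
  destruct S as [pr E].
  - exists (RInt f x y), (ex_RInt_Reals_0 _ _ _ H); symmetry; apply RInt_Reals.
  - rewrite <- E; symmetry; apply RInt_Reals.
Qed.

Lemma RInt_R_support (g : R -> R) M : (forall t, continuous g t) ->
  (forall t, t < 0 \/ INR M < t -> g t = 0) -> RInt_R g = RInt g 0 (INR M).
Proof.
  intros Hc H; unfold RInt_R; apply seq_lim_unique.
  assert (EX : forall x y, ex_RInt g x y).
  { intros; apply (ex_RInt_continuous (V := R_CompleteNormedModule)); intros; apply Hc. }
  assert (Z : forall x y, x <= y -> (forall t, x < t < y -> g t = 0) -> RInt g x y = 0).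
  { intros x y Hxy Hz; rewrite (RInt_ext g (fun _ => 0)).
    - etransitivity; [apply (RInt_const (V := R_CompleteNormedModule))|apply Rmult_0_r].
    - intros t Ht; rewrite Rmin_left, Rmax_right in Ht by easy; auto. }
  intros eps He; exists M; intros n Hn.
  assert (Hn' : INR M <= INR n) by (apply le_INR; lia).
  assert (P0 := pos_INR n); assert (P1 := pos_INR M).
  rewrite Defs_RInt_eq by apply EX.
  assert (E1 : RInt g (- INR n) (INR n) = RInt g (- INR n) 0 + RInt g 0 (INR n))
    by (symmetry; apply (RInt_Chasles (V := R_CompleteNormedModule)); apply EX).
  assert (E2 : RInt g 0 (INR n) = RInt g 0 (INR M) + RInt g (INR M) (INR n))
    by (symmetry; apply (RInt_Chasles (V := R_CompleteNormedModule)); apply EX).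
  rewrite E1, E2, (Z (- INR n) 0), (Z (INR M) (INR n)); try lra.
  - unfold Rdist; rewrite Rplus_0_l, Rplus_0_r, Rminus_diag, Rabs_R0; lra.
  - intros; apply H; lra.
  - intros; apply H; lra.
Qed.

(** * Limits of the two moments and their quotient *)

(** Four errors add up: the diagonal sum against its limit, the Riemann sum of [phi] against its
    integral, the non-resonant pairs, and zeta against the Dirichlet polynomial. The second is
    bounded but multiplies the diagonal sum, so it amounts to [O(ln T)]. *)
Lemma discrete_limit B phi phi1 phi2 a b : test_function B phi phi1 phi2 -> 0 < a ->
  is_lim (fun T => rsum (fun l => zeta_crit_abs2 (a * INR l + b) * phi (INR l / T)) (natup (2 * T + 1))
                   / (T * ln T)) p_infty (RInt phi 0 3 * (1 + delta a b)).
Proof.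
  intros H Ha; apply vanishes_is_lim.
  destruct (zeta_dirichlet_error a b B phi Ha (test_supp _ _ _ _ H) (test_bound _ _ _ _ H)) as [C [T1 [HC HE]]].
  set (c := 2 * a + Rabs b + 1) in *.
  assert (Hc : 0 < c) by (unfold c; assert (A := Rabs_pos b); lra).
  assert (HB : 0 <= B) by (eapply Rle_trans; [apply Rabs_pos|apply (test_bound _ _ _ _ H 0)]).
  set (A := RInt phi 0 3).
  assert (VD := diag_sum_limit a b c Ha Hc); assert (VO := offdiag_vanishes a c Ha Hc).
  set (L := Rabs (1 + delta a b) + 1).
  (* This instance of the convergence serves only to bound the diagonal sum by [L ln T]. *)
  destruct (VD 1 ltac:(lra)) as [T2 HT2].
  assert (VA : vanishes (fun T => Rabs A * Rabs (rsum2 (diag_entry a b) (natup (c * T)) / ln T - (1 + delta a b)))).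
  { apply vanishes_scal; intros e Hpos; destruct (VD e Hpos) as [T0 HT0]; exists T0; intros; rewrite Rabs_Rabsolu; auto. }
  assert (VS := vanishes_plus _ _ VA (vanishes_plus _ _ (vanishes_scal (6 * B) _ VO)
        (vanishes_const_ln (3 * B * L + 3 * C)))).
  refine (vanishes_le _ _ (Rmax 3 (Rmax T1 T2)) _ VS); clear VS VA VO VD.
  intros T HT.
  assert (HT3 : 3 <= T) by (eapply Rle_trans; [apply Rmax_l|eassumption]).
  assert (HT' : Rmax T1 T2 <= T) by (eapply Rle_trans; [apply Rmax_r|eassumption]).
  assert (HTa : T1 <= T) by (eapply Rle_trans; [apply Rmax_l|eassumption]).
  assert (HTb : T2 <= T) by (eapply Rle_trans; [apply Rmax_r|eassumption]).
  specialize (HT2 T HTb).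
  assert (Ln := ln_ge1 T HT3).
  set (M := natup (2 * T + 1)); set (N := natup (c * T)) in *.
  assert (HM : 2 * T + 1 < INR M <= 3 * T).
  { assert (Q := natup_spec (2 * T + 1) ltac:(lra)); fold M in Q; lra. }
  set (Sd := rsum (fun l => zeta_crit_abs2 _ * _) M).
  set (D := rsum2 (diag_entry a b) N) in *; set (O := rsum2 (off_entry a T) N).
  set (Phi := rsum (fun l => phi (INR l / T)) M).
  set (Sz := rsum (fun l => dirichlet_sq N (a * INR l + b) * phi (INR l / T)) M).
  assert (E1 : Rabs (Sd - Sz) <= 3 * T * C).
  { unfold Sd, Sz; rewrite <- rsum_minus.
    eapply Rle_trans; [apply rsum_abs|].
    apply Rle_trans with (rsum (fun _ => C) M); [apply rsum_le; intros l _; apply (HE T (INR l) HTa)|].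
    rewrite rsum_const; apply Rmult_le_compat_r; lra. }
  assert (E2 : Rabs (Sz - Phi * D) <= 6 * B * T * O) by (apply (discrete_moment B phi phi1 phi2); [easy|lra|easy]).
  assert (E3 : Rabs (Phi - T * A) <= 3 * B).
  { unfold Phi, A; rewrite <- (RInt_dilate B phi phi1 phi2 T M H ltac:(lra) HM).
    apply (riemann_sum_error B phi phi1 phi2); [easy|lra|lra]. }
  assert (E4 : Rabs D <= L * ln T).
  { replace D with (((D / ln T - (1 + delta a b)) + (1 + delta a b)) * ln T) by (field; lra).
    rewrite Rabs_mult, (Rabs_pos_eq (ln T)) by lra; apply Rmult_le_compat_r; [lra|].
    eapply Rle_trans; [apply Rabs_triang|]; unfold L; lra. }
  assert (E5 : Rabs ((Phi - T * A) * D) <= 3 * B * (L * ln T)).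
  { rewrite Rabs_mult; apply Rmult_le_compat; try apply Rabs_pos; easy. }
  replace (Sd / (T * ln T) - A * (1 + delta a b)) with
    (A * (D / ln T - (1 + delta a b)) + ((Phi - T * A) * D + (Sz - Phi * D) + (Sd - Sz)) / (T * ln T))
    by (field; lra).
  eapply Rle_trans; [apply Rabs_triang|]; rewrite Rabs_mult; apply Rplus_le_compat_l.
  assert (PT : 0 < T * ln T) by nra; assert (IT : 0 < / (T * ln T)) by (now apply Rinv_0_lt_compat).
  unfold Rdiv at 1; rewrite Rabs_mult, (Rabs_pos_eq (/ (T * ln T))) by lra.
  apply Rle_trans with ((3 * B * (L * ln T) + 6 * B * T * O + 3 * T * C) * / (T * ln T)).
  - apply Rmult_le_compat_r; [lra|].
    eapply Rle_trans; [apply Rabs_triang|]; apply Rplus_le_compat; [|easy].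
    eapply Rle_trans; [apply Rabs_triang|]; apply Rplus_le_compat; easy.
  - replace ((3 * B * (L * ln T) + 6 * B * T * O + 3 * T * C) * / (T * ln T))
      with (6 * B * (O / ln T) + (3 * B * L * (ln T / T) + 3 * C) / ln T) by (field; lra).
    apply Rplus_le_compat_l, Rmult_le_compat_r; [apply Rlt_le, Rinv_0_lt_compat; lra|].
    apply Rplus_le_compat_r.
    rewrite <- (Rmult_1_r (3 * B * L)) at 2; apply Rmult_le_compat_l.
    + apply Rmult_le_pos; [lra|]; unfold L; assert (Q := Rabs_pos (1 + delta a b)); lra.
    + apply Rmult_le_reg_r with T; [lra|]; unfold Rdiv; rewrite Rmult_assoc, Rinv_l by lra.
      assert (Q := ln_le_sub1 T ltac:(lra)); lra.
Qed.

(** The main term is now [harmonic N], which is [ln T + O(1)] since [N] is a constant times [T] up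
    to rounding. *)
Lemma integral_limit B phi phi1 phi2 a b : test_function B phi phi1 phi2 -> 0 < a ->
  is_lim (fun T => RInt (fun t => zeta_crit_abs2 (a * t + b) * phi (t / T)) 0 (INR (natup (2 * T + 1)))
                   / (T * ln T)) p_infty (RInt phi 0 3).
Proof.
  intros H Ha; apply vanishes_is_lim.
  destruct (zeta_dirichlet_error a b B phi Ha (test_supp _ _ _ _ H) (test_bound _ _ _ _ H)) as [C [T1 [HC HE]]].
  set (c := 2 * a + Rabs b + 1) in *.
  assert (Hc : 0 < c) by (unfold c; assert (A := Rabs_pos b); lra).
  assert (HB : 0 <= B) by (eapply Rle_trans; [apply Rabs_pos|apply (test_bound _ _ _ _ H 0)]).
  assert (C0 : forall x, continuous phi x) by (intros x; apply (continuous_derivable phi phi1), H).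
  set (A := RInt phi 0 3).
  assert (VO := offdiag_vanishes a c Ha Hc).
  destruct (harmonic_natup c Hc) as [Hh [HH HHB]].
  assert (VS := vanishes_plus _ _ (vanishes_scal (6 * B) _ VO)
        (vanishes_const_ln (Rabs A * Hh + 24 * B * (c + 1) + 3 * C))).
  refine (vanishes_le _ _ (Rmax 3 T1) _ VS); clear VS VO.
  intros T HT.
  assert (HT3 : 3 <= T) by (eapply Rle_trans; [apply Rmax_l|eassumption]).
  assert (HTa : T1 <= T) by (eapply Rle_trans; [apply Rmax_r|eassumption]).
  assert (Ln := ln_ge1 T HT3).
  specialize (HHB T ltac:(lra)).
  assert (NS := natup_spec (c * T) ltac:(nra)).
  set (M := natup (2 * T + 1)); set (N := natup (c * T)) in *.
  assert (HM : 2 * T + 1 < INR M <= 3 * T).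
  { assert (Q := natup_spec (2 * T + 1) ltac:(lra)); fold M in Q; lra. }
  set (Id := RInt (fun t => zeta_crit_abs2 _ * _) 0 (INR M)).
  set (O := rsum2 (off_entry a T) N).
  set (Iz := RInt (fun t => dirichlet_sq N (a * t + b) * phi (t / T)) 0 (INR M)).
  assert (EXz : ex_RInt (fun t => zeta_crit_abs2 (a * t + b) * phi (t / T)) 0 (INR M)).
  { apply (ex_RInt_continuous (V := R_CompleteNormedModule)); intros.
    apply (continuous_moment a b T zeta_crit_abs2 phi); [apply continuous_zeta_crit_abs2|easy]. }
  assert (EXd : ex_RInt (fun t => dirichlet_sq N (a * t + b) * phi (t / T)) 0 (INR M)).
  { apply (ex_RInt_continuous (V := R_CompleteNormedModule)); intros.
    apply (continuous_moment a b T (dirichlet_sq N) phi); [apply continuous_dirichlet_sq|easy]. }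
  assert (E1 : Rabs (Id - Iz) <= 3 * T * C).
  { replace (Id - Iz) with (RInt (fun t => zeta_crit_abs2 (a * t + b) * phi (t / T) -
        dirichlet_sq N (a * t + b) * phi (t / T)) 0 (INR M))
      by (apply (RInt_minus (V := R_CompleteNormedModule) (fun t => zeta_crit_abs2 (a * t + b) * phi (t / T))); easy).
    eapply Rle_trans.
    - apply (abs_RInt_le_const _ _ _ C); [lra| |intros t _; apply (HE T t HTa)].
      apply (ex_RInt_minus (V := R_CompleteNormedModule) (fun t => zeta_crit_abs2 (a * t + b) * phi (t / T))); easy.
    - apply Rmult_le_compat_r; lra. }
  assert (E2 := integral_moment B phi phi1 phi2 a b T M N H Ha ltac:(lra) HM).
  rewrite (RInt_dilate B phi phi1 phi2 T M H ltac:(lra) HM) in E2.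
  fold A in E2; fold Iz in E2; fold O in E2.
  assert (E3 : Rabs (T * A * (harmonic N - ln T)) <= T * (Rabs A * Hh)).
  { rewrite !Rabs_mult, (Rabs_pos_eq T), Rmult_assoc by lra; apply Rmult_le_compat_l; [lra|].
    apply Rmult_le_compat_l; [apply Rabs_pos|easy]. }
  assert (E4 : 6 * B * T * (O + / (T * T) * (4 * INR N)) <= 6 * B * T * O + 24 * B * (c + 1)).
  { apply Rle_trans with (6 * B * T * O + 24 * B * (INR N / T)); [right; field; lra|].
    apply Rplus_le_compat_l, Rmult_le_compat_l; [lra|].
    apply Rmult_le_reg_r with T; [lra|]; unfold Rdiv; rewrite Rmult_assoc, Rinv_l by lra; lra. }
  replace (Id / (T * ln T) - A) with
    ((T * A * (harmonic N - ln T) + (Iz - T * A * harmonic N) + (Id - Iz)) / (T * ln T))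
    by (field; lra).
  assert (PT : 0 < T * ln T) by nra; assert (IT : 0 < / (T * ln T)) by (now apply Rinv_0_lt_compat).
  unfold Rdiv at 1; rewrite Rabs_mult, (Rabs_pos_eq (/ (T * ln T))) by lra.
  apply Rle_trans with ((T * (Rabs A * Hh) + (6 * B * T * O + 24 * B * (c + 1)) + 3 * T * C) * / (T * ln T)).
  - apply Rmult_le_compat_r; [lra|].
    eapply Rle_trans; [apply Rabs_triang|]; apply Rplus_le_compat; [|easy].
    eapply Rle_trans; [apply Rabs_triang|]; apply Rplus_le_compat; [easy|lra].
  - replace ((T * (Rabs A * Hh) + (6 * B * T * O + 24 * B * (c + 1)) + 3 * T * C) * / (T * ln T))
      with (6 * B * (O / ln T) + (Rabs A * Hh + 24 * B * (c + 1) * / T + 3 * C) / ln T) by (field; lra).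
    apply Rplus_le_compat_l, Rmult_le_compat_r; [apply Rlt_le, Rinv_0_lt_compat; lra|].
    apply Rplus_le_compat_r, Rplus_le_compat_l.
    rewrite <- (Rmult_1_r (24 * B * (c + 1))) at 2; apply Rmult_le_compat_l; [apply Rmult_le_pos; lra|].
    rewrite <- Rinv_1; apply Rinv_le_contravar; lra.
Qed.

Theorem theorem2 (alpha beta : R) (phi : R -> R)
  (halpha : 0 < alpha)
  (hsmooth : smooth phi)
  (hnonneg : forall x, 0 <= phi x)
  (hnonzero : exists x, phi x <> 0)
  (hsupp : support_in phi 1 2) :
  exists o : R -> R,
    (forall eps, eps > 0 -> exists T0, forall T, T >= T0 -> Rabs (o T) < eps) /\
    (exists T0, forall T, T >= T0 ->
       sum_Z (fun l => zeta_crit_abs2 (alpha * IZR l + beta) * phi (IZR l / T))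
       = (1 + delta alpha beta + o T) *
         RInt_R (fun t => zeta_crit_abs2 (alpha * t + beta) * phi (t / T))).
Proof.
  destruct (smooth_test_function phi hsmooth hsupp) as [B [phi1 [phi2 H]]].
  assert (HA := RInt_test_pos B phi phi1 phi2 H hnonneg hnonzero).
  set (A := RInt phi 0 3) in *.
  set (Sd := fun T => rsum (fun l => zeta_crit_abs2 (alpha * INR l + beta) * phi (INR l / T)) (natup (2 * T + 1))).
  set (Id := fun T => RInt (fun t => zeta_crit_abs2 (alpha * t + beta) * phi (t / T)) 0 (INR (natup (2 * T + 1)))).
  assert (LS := discrete_limit B phi phi1 phi2 alpha beta H halpha).
  assert (LI := integral_limit B phi phi1 phi2 alpha beta H halpha).
  fold A in LS, LI; change (is_lim (fun T => Sd T / (T * ln T)) p_infty (A * (1 + delta alpha beta))) in LS.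
  change (is_lim (fun T => Id T / (T * ln T)) p_infty A) in LI.
  (* The quotient by the integral makes sense for large [T]: divided by [T log T], the integral is
     eventually at least [A / 2]. *)
  assert (Hpos : exists T0, forall T, T0 <= T -> 3 <= T /\ 0 < Id T).
  { destruct (is_lim_vanishes _ _ LI (A / 2) ltac:(lra)) as [T0 HT0].
    exists (Rmax 3 T0); intros T HT.
    assert (HT3 : 3 <= T) by (eapply Rle_trans; [apply Rmax_l|eassumption]).
    assert (HT' : T0 <= T) by (eapply Rle_trans; [apply Rmax_r|eassumption]).
    split; [easy|]; specialize (HT0 T HT'); apply Rabs_le_between in HT0.
    assert (Ln := ln_ge1 T HT3).
    replace (Id T) with (Id T / (T * ln T) * (T * ln T)) by (field; lra).
    apply Rmult_lt_0_compat; nra. }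
  destruct Hpos as [Tp Hpos].
  assert (LQ : vanishes (fun T => Sd T / Id T - (1 + delta alpha beta))).
  { assert (L : is_lim (fun T => (Sd T / (T * ln T)) / (Id T / (T * ln T))) p_infty
        (A * (1 + delta alpha beta) / A)).
    { apply (is_lim_div _ _ p_infty (A * (1 + delta alpha beta)) A LS LI).
      - intros E; injection E; lra.
      - simpl; easy. }
    apply is_lim_vanishes in L.
    refine (vanishes_ext _ _ Tp _ L); intros T HT; cbv beta.
    destruct (Hpos T HT) as [HT3 HI]; assert (Ln := ln_ge1 T HT3).
    field; repeat split; lra. }
  (* Taking the exact deviation of the quotient as error term makes the identity automatic once sum
     and integral are reduced to finite ranges; the content is that this deviation vanishes. *)
  exists (fun T => Sd T / Id T - (1 + delta alpha beta)); split.
  - intros eps He; destruct (LQ (eps / 2) ltac:(lra)) as [T0 HT0].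
    exists T0; intros T HT; specialize (HT0 T ltac:(lra)); lra.
  - exists Tp; intros T HT; destruct (Hpos T ltac:(lra)) as [HT3 HI].
    assert (NS := natup_spec (2 * T + 1) ltac:(lra)).
    assert (Hout : forall t, t < 0 \/ 2 * T + 1 < t -> phi (t / T) = 0).
    { intros t Ht; apply support_out; [easy|].
      assert (IT : 0 < / T) by (apply Rinv_0_lt_compat; lra).
      destruct Ht as [Ht|Ht]; [left; unfold Rdiv; nra|right].
      apply Rmult_lt_reg_r with T; [lra|]; unfold Rdiv; rewrite Rmult_assoc, Rinv_l by lra; lra. }
    rewrite (sum_Z_support _ (natup (2 * T + 1))).
    + rewrite (RInt_R_support _ (natup (2 * T + 1))).
      * change (RInt _ 0 _) with (Id T).
        rewrite (rsum_ext _ (fun l => zeta_crit_abs2 (alpha * INR l + beta) * phi (INR l / T)))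
          by (intros; rewrite <- INR_IZR_INZ; reflexivity).
        change (rsum _ _) with (Sd T); field; lra.
      * apply (continuous_moment alpha beta T zeta_crit_abs2 phi); [apply continuous_zeta_crit_abs2|].
        intros x; apply (continuous_derivable phi phi1), H.
      * intros t Ht; rewrite Hout; [ring|lra].
    + intros l Hl; rewrite Hout; [ring|].
      destruct Hl as [Hl|Hl]; [left; apply IZR_lt; easy|right].
      apply IZR_le in Hl; rewrite <- INR_IZR_INZ in Hl; lra.
Qed.
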